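(* For every fixed real $C>0$ there is $\gamma>0$ (depending only on $C$) such that every $n$-vertex $C$-Ramsey graph $G$ satisfies $|\Psi(G)|\ge \gamma n^{5/2}$.
   Context: All graphs are finite and simple. An induced subgraph is homogeneous if it is a clique or an independent set. For a fixed $C>0$, an $n$-vertex graph is $C$-Ramsey if it has no homogeneous induced subgraph of size $C\log_2 n$ (that is, no homogeneous induced subgraph on at least $C\log_2 n$ vertices). For a graph $H$, $v(H)$ and $e(H)$ denote its numbers of vertices and edges. For a graph $G$, $\Psi(G)=\{(v(H),e(H)) : H \text{ is an induced subgraph of } G\}$. *)

(* Defs.v *)
(* MathComp / MathComp-Analysis. A finite simple graph is given by a finite
   vertex type T and a symmetric irreflexive adjacency relation e on T; its
   induced subgraphs are represented by their vertex sets S : {set T}. *)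
From HB Require Import structures.
From mathcomp Require Import all_boot all_order all_algebra finmap.
From mathcomp Require Import reals exp.

Set Implicit Arguments.
Unset Strict Implicit.
Unset Printing Implicit Defensive.

Import Order.TTheory GRing.Theory Num.Theory.

Local Open Scope ring_scope.

Definition simple_graph (T : finType) (e : rel T) : Prop :=
  symmetric e /\ irreflexive e.

(* Edges are unordered pairs [set x; y], so each edge is counted once. *)
Definition induced_edges (T : finType) (e : rel T) (S : {set T}) :
  {set {set T}} := [set [set x; y] | x in S, y in S & e x y].

Definition clique (T : finType) (e : rel T) (S : {set T}) : Prop :=
  {in S &, forall x y, x != y -> e x y}.

Definition independent (T : finType) (e : rel T) (S : {set T}) : Prop :=
  {in S &, forall x y, ~~ e x y}.

Definition homogeneous (T : finType) (e : rel T) (S : {set T}) : Prop :=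
  clique e S \/ independent e S.

(* [ln 0 = 0] in the library, so log2 0 = 0. *)
Definition log2 (R : realType) (x : R) : R := ln x / ln 2.

Definition ramsey (R : realType) (C : R) (T : finType) (e : rel T) : Prop :=
  ~ exists S : {set T}, homogeneous e S /\ C * log2 #|T|%:R <= #|S|%:R.

Definition Psi (T : finType) (e : rel T) : {fset nat * nat} :=
  [fset (#|S : {set T}|, #|induced_edges e S|) | S in [set: {set T}]]%fset.

(* Main.v *)
Require Import Defs.
From HB Require Import structures.
From mathcomp Require Import all_boot all_order all_algebra finmap.
From mathcomp Require Import reals exp.
From mathcomp Require Import boolp.
From mathcomp Require Import zify ring lra.

Set Implicit Arguments.
Unset Strict Implicit.
Unset Printing Implicit Defensive.

Import Order.TTheory GRing.Theory Num.Theory.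

Local Open Scope ring_scope.

(** Let n be the number of vertices and q about its square root.  The aim is
    to find c q^2 numbers of vertices and, for each of them, c q^3 numbers of
    edges.

    Richness.  By the Erdos-Szemeredi theorem ([sparse_density]) a graph whose
    homogeneous sets are logarithmic is not too sparse on any set of polynomial
    size, and neither is its complement.  Iterating this ([rich_subset]) gives
    a set X of linear size such that, for each W inside X that is not too
    small, all but about n^(1/4) vertices of X have at least eps |W| neighbours
    and at least eps |W| non-neighbours in W.

    Randomness.  A random set of exactly u vertices is made by choosing one
    vertex from each of u disjoint pairs.  Its number of edges is a quadratic
    function of independent signs, and two estimates control it.  If the two
    vertices of most pairs have close degrees, the variance is only O(q^4)
    ([Ex_en2]), so the number of edges stays within O(n) of its mean.  On the
    other hand richness yields many pairs along which the difference of the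
    adjacencies to two given vertices varies ([responsive_pairs]); the
    difference of the degrees of these two vertices is then a sum of many
    independent steps and falls into a given interval of length r with
    probability O((r + 1) / q) ([anticoncentration]).  Every random choice is
    turned into an actual one by comparing a potential with its mean.

    Three scales.  Split part of X into blocks Q, P, A1, A2, V of 2u vertices,
    u being of order n.  Choosing t vertices of P prescribes the total number
    of vertices, t + 3u + 2.  With t fixed, single exchanges in Q move the
    number of edges through an interval of length c q^3 by steps O(q^2)
    ([coarse_path]), so it can be brought into each of c q windows of length
    O(q^2).  From there, about q exchanges in A1 raise it by an amount of order
    q each ([local_climb]).  After each of these exchanges, a random half of A2
    together with two vertices of V produces of order q different values within
    O(q) of each other when the two vertices run through suitable pairs
    ([fine_pairs], [many_values]).  In total every window receives of order q^2
    values, hence every t of order q^3 values, and summing over t gives of order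
    q^5 points, that is n^(5/2) ([card_Psi_of_rich]). *)

(** * Number of edges on a list of weighted vertices *)
Section Energy.
Variables (R : realType) (T : finType) (e : rel T).

Definition adj (x y : T) : R := (e x y)%:R.
Definition deg (l : seq T) (v : T) : R := \sum_(x <- l) adj v x.
(** The double sum meets every edge from both ends: on a list without repetition
    this is the weight of the list plus the number of edges inside it. *)
Definition en (w : T -> R) (l : seq T) : R :=
  \sum_(v <- l) w v + (\sum_(v <- l) deg l v) / 2.

Lemma adj_ge0 x y : 0 <= adj x y. Proof. exact: ler0n. Qed.
Lemma adj_le1 x y : adj x y <= 1. Proof. by rewrite /adj; case: (e x y). Qed.

Lemma deg_cat l1 l2 v : deg (l1 ++ l2) v = deg l1 v + deg l2 v.
Proof. by rewrite /deg big_cat. Qed.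
Lemma deg_cons x l v : deg (x :: l) v = adj v x + deg l v.
Proof. by rewrite /deg big_cons. Qed.
Lemma deg_nil v : deg [::] v = 0.
Proof. by rewrite /deg big_nil. Qed.
Lemma deg_perm l1 l2 v : perm_eq l1 l2 -> deg l1 v = deg l2 v.
Proof. by move=> h; apply: perm_big. Qed.
Lemma deg_ge0 l v : 0 <= deg l v.
Proof. by apply: sumr_ge0 => x _; apply: adj_ge0. Qed.
Lemma deg_le l v : deg l v <= (size l)%:R.
Proof.
elim: l => [|x l IH]; first by rewrite deg_nil.
by rewrite deg_cons /= -natr1 addrC lerD // adj_le1.
Qed.
Lemma deg_count l v : deg l v = (count (e v) l)%:R.
Proof.
elim: l => [|x l IH]; first by rewrite deg_nil.
by rewrite deg_cons IH /= natrD.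
Qed.

Lemma en_perm w l1 l2 : perm_eq l1 l2 -> en w l1 = en w l2.
Proof.
move=> h; rewrite /en (perm_big _ h) /=; congr (_ + _ / 2).
by rewrite (perm_big _ h) /=; apply: eq_bigr => v _; apply: deg_perm.
Qed.

Lemma eq_en w1 w2 l : w1 =1 w2 -> en w1 l = en w2 l.
Proof. by move=> h; rewrite /en; congr (_ + _); apply: eq_bigr. Qed.

Hypotheses (e_sym : symmetric e) (e_irr : irreflexive e).

Lemma adjC x y : adj x y = adj y x. Proof. by rewrite /adj e_sym. Qed.
Lemma adjxx x : adj x x = 0. Proof. by rewrite /adj e_irr. Qed.

Lemma deg_sumC l1 l2 : \sum_(v <- l1) deg l2 v = \sum_(v <- l2) deg l1 v.
Proof.
rewrite /deg exchange_big /=; apply: eq_bigr => v _; apply: eq_bigr => x _.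
exact: adjC.
Qed.

(** Vertices already placed act on the later ones only by a change of weight, so
    that blocks of vertices can be treated one after another. *)
Lemma en_cat w l1 l2 :
  en w (l1 ++ l2) = en w l1 + en (fun v => w v + deg l1 v) l2.
Proof.
rewrite /en !big_cat /=.
rewrite !(eq_bigr _ (fun v _ => deg_cat l1 l2 v)).
rewrite !big_split /= (deg_sumC l1 l2); lra.
Qed.

Lemma en_cons w x l : en w (x :: l) = w x + en (fun v => w v + adj v x) l.
Proof.
rewrite -cat1s en_cat /en !big_seq1 /= deg_cons deg_nil adjxx addr0 mul0r addr0.
by congr (_ + (_ + _)); apply: eq_bigr => v _; rewrite deg_cons deg_nil addr0.
Qed.

Lemma en_addw w w' l :
  en (fun v => w v + w' v) l = en w l + \sum_(v <- l) w' v.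
Proof. by rewrite /en big_split /=; ring. Qed.

Lemma en_cons' w x l : en w (x :: l) = w x + deg l x + en w l.
Proof.
rewrite en_cons en_addw.
rewrite (_ : \sum_(v <- l) adj v x = deg l x); first by ring.
by apply: eq_bigr => v _; rewrite adjC.
Qed.

Lemma en_swap w x y l l' : perm_eq (x :: l') (y :: l) ->
  en w l' - en w l = w y - w x + deg l y - deg l x - adj x y.
Proof.
move=> h; have := en_perm w h; rewrite !en_cons'.
have: deg (x :: l') x = deg (y :: l) x by apply: deg_perm.
rewrite !deg_cons adjxx; lra.
Qed.
End Energy.

(** * Random choice of one vertex from each pair *)
Section Expect.
Variables (R : realType) (T : eqType).
Implicit Types (ps : seq (T * T)) (f g : seq T -> R).

(** The mean of [f] over all [2 ^ size ps] ways of choosing one entry of each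
    pair; the recursion conditions on the first choice, which is how all moments
    below are computed. *)
Fixpoint Ex ps f : R :=
  if ps is p :: ps' then
    (Ex ps' (fun l => f (p.1 :: l)) + Ex ps' (fun l => f (p.2 :: l))) / 2
  else f [::].

Fixpoint ends ps : seq T :=
  if ps is p :: ps' then p.1 :: p.2 :: ends ps' else [::].

(** The outcomes over which [Ex ps] averages. *)
Definition sel ps (l : seq T) : bool :=
  (size ps == size l) && all2 (fun p v => (v == p.1) || (v == p.2)) ps l.

Lemma sel_cons p ps v l :
  sel (p :: ps) (v :: l) = ((v == p.1) || (v == p.2)) && sel ps l.
Proof. by rewrite /sel /= eqSS andbCA. Qed.

Lemma sel_size ps l : sel ps l -> size l = size ps.
Proof. by case/andP => /eqP ->. Qed.

Lemma sel_cat ps1 ps2 l1 l2 : sel ps1 l1 -> sel ps2 l2 -> sel (ps1 ++ ps2) (l1 ++ l2).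
Proof.
elim: ps1 l1 => [|p ps1 IH] [|v l1] //=.
by rewrite !sel_cons => /andP[-> h1] h2 /=; apply: IH.
Qed.

Lemma sel_subseq ps l : sel ps l -> subseq l (ends ps).
Proof.
elim: ps l => [|p ps IH] [|v l] //=; rewrite sel_cons => /andP[h1 /IH h2].
case: eqP => hv; first by apply: subseq_trans h2 (subseq_cons _ _).
by case/orP: h1 => /eqP h1 //; rewrite h1 eqxx.
Qed.

Lemma ends_cat ps1 ps2 : ends (ps1 ++ ps2) = ends ps1 ++ ends ps2.
Proof. by elim: ps1 => //= p ps ->. Qed.

Lemma size_ends ps : size (ends ps) = (size ps).*2.
Proof. by elim: ps => //= p ps ->. Qed.

Lemma ends_mem ps p : p \in ps -> (p.1 \in ends ps) /\ (p.2 \in ends ps).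
Proof.
elim: ps => //= q ps IH; rewrite !inE => /orP[/eqP ->|/IH[-> ->]].
  by rewrite !eqxx !orbT.
by rewrite !orbT.
Qed.

Lemma eq_Ex ps f g : (forall l, sel ps l -> f l = g l) -> Ex ps f = Ex ps g.
Proof.
elim: ps f g => [|p ps IH] f g h /=; first exact: h.
congr ((_ + _) / _); apply: IH => l hl; apply: h.
  by rewrite sel_cons eqxx.
by rewrite sel_cons eqxx orbT.
Qed.

Lemma le_Ex ps f g : (forall l, sel ps l -> f l <= g l) -> Ex ps f <= Ex ps g.
Proof.
elim: ps f g => [|p ps IH] f g h /=; first exact: h.
rewrite ler_pM2r ?invr_gt0 ?ltr0n // lerD // IH // => l hl; apply: h.
  by rewrite sel_cons eqxx.
by rewrite sel_cons eqxx orbT.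
Qed.

Lemma ExC ps (c : R) : Ex ps (fun=> c) = c.
Proof. by elim: ps => //= p ps ->; field. Qed.

Lemma ExD ps f g : Ex ps (fun l => f l + g l) = Ex ps f + Ex ps g.
Proof. by elim: ps f g => //= p ps IH f g; rewrite !IH; field. Qed.

Lemma ExcD ps (c : R) f : Ex ps (fun l => c + f l) = c + Ex ps f.
Proof. by rewrite ExD ExC. Qed.

Lemma ExZ ps c f : Ex ps (fun l => c * f l) = c * Ex ps f.
Proof. by elim: ps f => //= p ps IH f; rewrite !IH; field. Qed.

Lemma ExN ps f : Ex ps (fun l => - f l) = - Ex ps f.
Proof. by elim: ps f => //= p ps IH f; rewrite !IH; field. Qed.

Lemma Ex_sum (I : Type) (r : seq I) ps (F : I -> seq T -> R) :
  Ex ps (fun l => \sum_(i <- r) F i l) = \sum_(i <- r) Ex ps (F i).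
Proof.
elim: r => [|i r IH].
  rewrite big_nil -[RHS](ExC ps); apply: eq_Ex => l _; exact: big_nil.
rewrite big_cons -IH -ExD; apply: eq_Ex => l _; exact: big_cons.
Qed.

Lemma Ex_cat ps1 ps2 f :
  Ex (ps1 ++ ps2) f = Ex ps1 (fun l1 => Ex ps2 (fun l2 => f (l1 ++ l2))).
Proof. by elim: ps1 f => //= p ps1 IH f; rewrite !IH. Qed.

(** The first moment method, by which random choices become actual ones. *)
Lemma Ex_attained ps f : exists2 l, sel ps l & Ex ps f <= f l.
Proof.
elim: ps f => [|p ps IH] f /=; first by exists [::].
have [l1 h1 k1] := IH (fun l => f (p.1 :: l)).
have [l2 h2 k2] := IH (fun l => f (p.2 :: l)).
have [h|h] := lerP (f (p.2 :: l2)) (f (p.1 :: l1)).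
  by exists (p.1 :: l1); [rewrite sel_cons eqxx | lra].
by exists (p.2 :: l2); [rewrite sel_cons eqxx orbT | lra].
Qed.

Lemma Ex_linear ps (w : T -> R) :
  Ex ps (fun l => \sum_(v <- l) w v) = (\sum_(v <- ends ps) w v) / 2.
Proof.
elim: ps => [|p ps IH] /=; first by rewrite !big_nil mul0r.
rewrite !big_cons.
under eq_Ex do rewrite big_cons.
under [X in _ + X]eq_Ex do rewrite big_cons.
by rewrite !ExD !ExC IH; field.
Qed.

(** Choices in different pairs are independent, so the variance of a sum is the
    sum of the variances [(w p.1 - w p.2) ^ 2 / 4] of the pairs. *)
Lemma Ex_linear2 ps (w : T -> R) (a : R) :
  Ex ps (fun l => (a + \sum_(v <- l) w v) ^+ 2) =
  (a + (\sum_(v <- ends ps) w v) / 2) ^+ 2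
  + (\sum_(p <- ps) (w p.1 - w p.2) ^+ 2) / 4.
Proof.
elim: ps a => [|p ps IH] a /=.
  by rewrite !big_nil !mul0r !addr0.
under eq_Ex do rewrite big_cons addrA.
under [X in _ + X]eq_Ex do rewrite big_cons addrA.
by rewrite !IH !big_cons; field.
Qed.
End Expect.

(** * Mean and variance of the number of edges *)
Section Quadratic.
Variables (R : realType) (T : finType) (e : rel T).
Hypotheses (e_sym : symmetric e) (e_irr : irreflexive e).
Local Notation adj := (@adj R T e).
Local Notation deg := (@deg R T e).
Local Notation en := (@en R T e).

(** The mean of [en w] over random halves of [A], up to the edges inside pairs:
    an edge survives with probability 1/4 and is met twice by the second sum. *)
Definition avg (w : T -> R) (A : seq T) : R :=
  (\sum_(v <- A) w v) / 2 + (\sum_(v <- A) deg A v) / 8.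

Lemma Ex_en (w : T -> R) (ps : seq (T * T)) :
  Ex ps (fun l => en w l) = avg w (ends ps) - (\sum_(p <- ps) adj p.1 p.2) / 4.
Proof.
elim: ps w => [|p ps IH] w /=.
  by rewrite /en /avg !big_nil; lra.
under eq_Ex do rewrite (en_cons e_sym e_irr).
under [X in _ + X]eq_Ex do rewrite (en_cons e_sym e_irr).
rewrite !ExcD !IH /avg !big_cons !deg_cons !big_split /= !adjxx //.
have h x : \sum_(v <- ends ps) adj v x = deg (ends ps) x.
  by apply: eq_bigr => v _; rewrite adjC.
have -> : \sum_(i <- ends ps) deg (p.1 :: p.2 :: ends ps) i =
  deg (ends ps) p.1 + deg (ends ps) p.2 + \sum_(i <- ends ps) deg (ends ps) i.
  rewrite -!h -!big_split /=; apply: eq_bigr => v _.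
  by rewrite !deg_cons addrA.
by rewrite !h (adjC _ e_sym p.2 p.1); lra.
Qed.

(** [D v] is the expected contribution of [v].  Condition on the choice in the
    first pair: the two conditional means differ by [D p.1 - D p.2], and the
    choice shifts the differences of [D] along each later pair by plus or minus
    the same amount, at most 1.  The shifts cancel on average and their squares
    add up to at most [size ps ^+ 2] over the whole induction. *)
Lemma Ex_en2 (w : T -> R) (ps : seq (T * T)) (a : R) :
  let D v := w v + deg (ends ps) v / 2 in
  Ex ps (fun l => (a + en w l) ^+ 2) <=
  (a + Ex ps (fun l => en w l)) ^+ 2
  + (\sum_(p <- ps) (D p.1 - D p.2) ^+ 2 + (size ps)%:R ^+ 2) / 4.
Proof.
elim: ps w a => [|p ps IH] w a /=.
  by rewrite /en !big_nil; nra.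
under eq_Ex do rewrite (en_cons e_sym e_irr) addrA.
under [X in _ + X]eq_Ex do rewrite (en_cons e_sym e_irr) addrA.
have h1 := IH (fun v => w v + adj v p.1) (a + w p.1).
have h2 := IH (fun v => w v + adj v p.2) (a + w p.2).
cbv zeta in h1, h2.
under [X in _ <= (_ + (X + _) / 2) ^+ 2 + _]eq_Ex
  do rewrite (en_cons e_sym e_irr).
under [X in _ <= (_ + (_ + X) / 2) ^+ 2 + _]eq_Ex
  do rewrite (en_cons e_sym e_irr).
rewrite !ExcD !big_cons.
set m1 := Ex ps (fun l => en (fun v => w v + adj v p.1) l) in h1 *.
set m2 := Ex ps (fun l => en (fun v => w v + adj v p.2) l) in h2 *.
set E := ends ps in h1 h2 *.
have hm : m1 - m2 = (deg E p.1 - deg E p.2) / 2.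
  have k x : Ex ps (fun l => en (fun v => w v + adj v x) l) = Ex ps (fun l => en w l) + deg E x / 2.
    under eq_Ex do rewrite en_addw.
    rewrite ExD Ex_linear; congr (_ + _ / 2).
    by apply: eq_bigr => v _; rewrite adjC.
  by rewrite /m1 /m2 !k; field.
rewrite !deg_cons !adjxx //.
have hD v : w v + deg (p.1 :: p.2 :: E) v / 2 =
  w v + deg E v / 2 + (adj v p.1 + adj v p.2) / 2.
  by rewrite !deg_cons; field.
under [X in _ <= _ + (_ + X + _) / _]eq_bigr do rewrite !hD.
set S := \sum_(j <- ps) _.
set S1 := \sum_(p0 <- ps) _ in h1; set S2 := \sum_(p0 <- ps) _ in h2.
have hS : (S1 + S2) / 2 <= S + (size ps)%:R.
  rewrite -sum1_size natr_sum -big_split /= /S1 /S2 -big_split /= mulr_suml.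
  apply: ler_sum => j _.
  set b := adj j.1 p.1 - adj j.1 p.2 - (adj j.2 p.1 - adj j.2 p.2).
  have hb : b ^+ 2 <= 4.
    rewrite /b; move: (adj_ge0 R e j.1 p.1) (adj_ge0 R e j.1 p.2)
      (adj_ge0 R e j.2 p.1) (adj_ge0 R e j.2 p.2)
      (adj_le1 R e j.1 p.1) (adj_le1 R e j.1 p.2)
      (adj_le1 R e j.2 p.1) (adj_le1 R e j.2 p.2).
    by rewrite -/adj => *; nra.
  rewrite (_ : _ / 2 = (w j.1 + deg E j.1 / 2 + (adj j.1 p.1 + adj j.1 p.2) / 2 -
    (w j.2 + deg E j.2 / 2 + (adj j.2 p.1 + adj j.2 p.2) / 2)) ^+ 2 + b ^+ 2 / 4).
    by lra.
  by rewrite /b; field.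
rewrite -[(size ps).+1%:R]natr1.
have hn : 0 <= (size ps)%:R :> R by [].
have hc := adjC R e_sym p.1 p.2.
move: h1 h2 hS hm hc; set n := (size ps)%:R.
set D1 := deg E p.1; set D2 := deg E p.2.
move=> h1 h2 hS hm hc.
have -> : w p.1 + (0 + (adj p.1 p.2 + D1)) / 2 - (w p.2 + (adj p.2 p.1 + (0 + D2)) / 2)
   = (w p.1 + m1) - (w p.2 + m2) by rewrite hc; lra.
lra.
Qed.
End Quadratic.

(** * Anticoncentration of sums of independent choices *)
Section CentralBinomial.
Local Open Scope nat_scope.

Lemma bin_le_step m j : j.+1.*2 <= m.+1 -> 'C(m, j) <= 'C(m, j.+1).
Proof.
move=> h; rewrite -(@leq_pmul2l j.+1) // mul_bin_left leq_pmul2r ?bin_gt0; lia.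
Qed.

Lemma bin_le_half m i k : i + k <= m./2 -> 'C(m, i) <= 'C(m, i + k).
Proof.
elim: k => [|k IH] h; first by rewrite addn0.
apply: leq_trans (IH _) _; first lia.
rewrite addnS; apply: bin_le_step; lia.
Qed.

Lemma bin_le_central m j : 'C(m, j) <= 'C(m, m./2).
Proof.
have key i : i <= m./2 -> 'C(m, i) <= 'C(m, m./2).
  by move=> h; rewrite -[in leqRHS](subnKC h); apply: bin_le_half; rewrite subnKC.
have [h|h] := leqP j m./2; first exact: key.
have [hm|hm] := leqP j m; last by rewrite bin_small.
by rewrite -bin_sub //; apply: key; lia.
Qed.

(** From [k] to [k.+1] the coefficient is multiplied by
    [2 * (2 * k + 1) / (k + 1)], and the bound is preserved because
    [(2 * k + 1) * (2 * k + 3) <= (2 * k + 2) ^ 2]. *)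
Lemma central_bin_even k : 'C(k.*2, k) ^ 2 * k.*2.+1 <= 16 ^ k.
Proof.
elim: k => [|k IH] //.
have h1 : k.+1 * 'C(k.+1.*2, k.+1) = 2 * (k.*2.+1 * 'C(k.*2, k)).
  have h2 := mul_bin_diag k.*2.+2 k; have h3 := mul_bin_diag k.*2.+1 k.
  have h4 : 'C(k.*2.+1, k) = 'C(k.*2.+1, k.+1).
    by rewrite -[LHS]bin_sub; [congr 'C(_, _); lia | lia].
  rewrite /= in h2 h3; rewrite -h4 in h3; rewrite doubleS -h2 h3; lia.
have h5 : k.+1 ^ 2 * ('C(k.+1.*2, k.+1) ^ 2 * k.+1.*2.+1) <= k.+1 ^ 2 * 16 ^ k.+1.
  rewrite mulnA -expnMn h1 [16 ^ k.+1]expnS; move: IH; set c := 'C(_, _); set x := 16 ^ k.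
  move=> IH; apply: (@leq_trans (4 * k.*2.+1 * k.*2.+3 * x)).
    rewrite (_ : _ * _ = 4 * k.*2.+1 * k.*2.+3 * (c ^ 2 * k.*2.+1)).
      by rewrite leq_mul2l IH orbT.
    rewrite doubleS; ring.
  rewrite mulnA leq_mul2r; apply/orP; right.
  rewrite -mul2n (_ : _ ^ 2 = k * k + 2 * k + 1); last ring.
  by lia.
by rewrite leq_pmul2l // in h5.
Qed.

Lemma central_bin m : 'C(m, m./2) ^ 2 * m.+1 <= 4 ^ m.
Proof.
have h16 k : 16 ^ k = 4 ^ k.*2 by rewrite -mul2n expnM.
have [hm|hm] := boolP (odd m); last first.
  have mE : m = m./2.*2 by lia.
  by have := central_bin_even m./2; rewrite h16 -mE.
set k := m./2; have mE : m = k.*2.+1 by rewrite /k; lia.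
have := central_bin_even k.+1.
have h2 := mul_bin_diag k.*2.+2 k; rewrite /= in h2.
have h3 : 'C(k.+1.*2, k.+1) = 2 * 'C(m, k).
  apply/eqP; rewrite -(eqn_pmul2l (ltn0Sn k)) doubleS -h2 mE; lia.
rewrite h3 h16 doubleS -mE [4 ^ m.+1]expnS.
rewrite expnMn; set c := 'C(m, k) ^ 2; set x := 4 ^ m; lia.
Qed.
End CentralBinomial.

Section LittlewoodOfford.
Variables (R : realType) (T : eqType).
Implicit Types (ps : seq (T * T)) (w : T -> R) (h : R -> R).

(** The mean of [h] at a walk of [m] fair steps, each 0 or [d], from [c]. *)
Definition binavg (d : R) (m : nat) h (c : R) : R :=
  (\sum_(j < m.+1) 'C(m, j)%:R * h (c + j%:R * d)) / 2 ^+ m.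

Lemma pascal_sum m (g : nat -> R) :
  \sum_(j < m.+2) 'C(m.+1, j)%:R * g j =
  \sum_(j < m.+1) 'C(m, j)%:R * g j + \sum_(j < m.+1) 'C(m, j)%:R * g j.+1.
Proof.
have <- : \sum_(j < m.+2) 'C(m, j)%:R * g j = \sum_(j < m.+1) 'C(m, j)%:R * g j.
  by rewrite big_ord_recr /= bin_small // mul0r addr0.
rewrite big_ord_recl [in RHS]big_ord_recl !bin0 -addrA -big_split; congr (_ + _).
by apply: eq_bigr => j _; rewrite /bump /= ?add1n binS natrD mulrDl.
Qed.

Lemma binavgS d m h c :
  binavg d m (fun u => (h u + h (u + d)) / 2) c = binavg d m.+1 h c.
Proof.
rewrite /binavg exprS invfM [RHS]mulrA; congr (_ / _).
rewrite (pascal_sum m (fun j => h (c + j%:R * d))) -big_split /= mulr_suml.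
apply: eq_bigr => j _.
rewrite (_ : c + j.+1%:R * d = c + j%:R * d + d); first by lra.
by rewrite -natr1 mulrDl mul1r addrA.
Qed.

(** Fix the choices in all pairs whose difference is not [d], at their worst
    values: what remains is a binomial walk. *)
Lemma Ex_le_binavg ps w d h a : exists c,
  Ex ps (fun l => h (a + \sum_(v <- l) w v)) <=
  binavg d (count (fun p => `|w p.1 - w p.2| == d) ps) h c.
Proof.
elim: ps h a => [|p ps IH] h a /=.
  exists a; rewrite /binavg big_ord_recl big_ord0 /= big_nil.
  by rewrite bin0 mul0r !addr0 mul1r expr0 invr1 mulr1.
under eq_Ex do rewrite big_cons addrA.
under [X in _ + X]eq_Ex do rewrite big_cons addrA.
have [hd|_] := eqVneq `|w p.1 - w p.2| d; last first.
  rewrite add0n.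
  have [c1 h1] := IH h (a + w p.1); have [c2 h2] := IH h (a + w p.2).
  move: h1 h2; set b := binavg _ _ _; set E1 := Ex _ _; set E2 := Ex _ _ => h1 h2.
  by have [h3|h3] := lerP (b c1) (b c2); [exists c2 | exists c1]; lra.
rewrite add1n.
suff [a' ->] : exists a', (Ex ps (fun l => h (a + w p.1 + \sum_(v <- l) w v)) +
    Ex ps (fun l => h (a + w p.2 + \sum_(v <- l) w v))) / 2 =
    Ex ps (fun l => (h (a' + \sum_(v <- l) w v) + h (a' + \sum_(v <- l) w v + d)) / 2).
  have [c hc] := IH (fun u => (h u + h (u + d)) / 2) a'.
  by exists c; rewrite -binavgS.
have hE u v : (Ex ps (fun l => h (u + \sum_(v <- l) w v)) +
    Ex ps (fun l => h (v + \sum_(v <- l) w v))) / 2 =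
    Ex ps (fun l => (h (u + \sum_(v <- l) w v) + h (v + \sum_(v <- l) w v)) / 2).
  by rewrite -ExD mulrC -ExZ; apply: eq_Ex => l _; rewrite mulrC.
rewrite hE; move: hd; have [h0|h0] := lerP (w p.2) (w p.1) => hd.
  exists (a + w p.2); apply: eq_Ex => l _; rewrite addrC; congr ((_ + h _) / _).
  by rewrite -hd; lra.
exists (a + w p.1); apply: eq_Ex => l _; congr ((_ + h _) / _).
by rewrite -hd; lra.
Qed.

Lemma binavg_le d m h c : (forall u, 0 <= h u) ->
  binavg d m h c <= ('C(m, m./2)%:R / 2 ^+ m) * \sum_(j < m.+1) h (c + j%:R * d).
Proof.
move=> h0; rewrite /binavg mulrAC ler_pM2r ?invr_gt0 ?exprn_gt0 ?ltr0n //.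
rewrite mulr_sumr; apply: ler_sum => j _.
by rewrite ler_wpM2r // ler_nat bin_le_central.
Qed.

Lemma central_bin_real (m : nat) (x : R) : 0 < x -> x ^+ 2 <= m%:R ->
  'C(m, m./2)%:R / 2 ^+ m <= 1 / x.
Proof.
move=> x0 hx; rewrite ler_pdivlMr // mulrAC ler_pdivrMr ?exprn_gt0 ?ltr0n // mul1r.
rewrite -(@ler_pXn2r _ 2) ?nnegrE ?mulr_ge0 ?exprn_ge0 ?ler0n ?(ltW x0) //.
have h : 'C(m, m./2)%:R ^+ 2 * m.+1%:R <= (2 ^+ m) ^+ 2 :> R.
  by rewrite -exprM -!natrX -natrM ler_nat [(m * 2)%N]mulnC expnM central_bin.
apply: le_trans h; rewrite exprMn ler_wpM2l ?exprn_ge0 ?ler0n //.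
by apply: le_trans hx _; rewrite ler_nat.
Qed.

Lemma interval_count (c d rho : R) m : 0 <= rho -> 1 <= d ->
  \sum_(j < m) (`|c + j%:R * d| < rho)%R%:R <= 2 * rho + 1 :> R.
Proof.
move=> r0 d1.
have shift c' n : \sum_(j < n.+1) (`|c' + j%:R * d| < rho)%R%:R =
   (`|c'| < rho)%R%:R + \sum_(j < n) (`|(c' + d) + j%:R * d| < rho)%R%:R :> R.
  rewrite big_ord_recl mul0r addr0; congr (_ + _); apply: eq_bigr => j _.
  by rewrite /= /bump /= ?add1n -natr1 (mulrDl j%:R) mul1r [_ + d]addrC addrA.
have key c' n : \sum_(j < n) (`|c' + j%:R * d| < rho)%R%:R <= Num.max 0 (rho - c' + 1) :> R.
  elim: n c' => [|n IH] c'; first by rewrite big_ord0 le_max lexx.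
  rewrite shift; have := IH (c' + d); set S := \sum_(_ < _) _ => hS.
  have [h|h] := ltrP `|c'| rho; last first.
    rewrite add0r; apply: le_trans hS _; rewrite ge_max !le_max lexx /=.
    by apply/orP; right; lra.
  move: h; rewrite ltr_norml => /andP[h1 h2]; rewrite le_max; apply/orP; right.
  by move: hS; rewrite le_max /= mulr1n => /orP[]; lra.
elim: m c => [|m IH] c; first by rewrite big_ord0; lra.
have [h|h] := lerP c (- rho).
  rewrite shift (_ : (`|c| < rho) = false) ?add0r //.
  apply/negbTE; rewrite -leNgt -normrN; apply: le_trans (ler_norm _); lra.
apply: le_trans (key c m.+1) _; rewrite ge_max; apply/andP; split; lra.
Qed.

(** An integer version of the Littlewood-Offord inequality.  The differences are
    at most 4, so a quarter of the nonzero ones share one value [d]; the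
    binomial walk with step [d] has atoms of mass at most [1 / y], and an
    interval of radius [rho] holds at most [2 * rho + 1] of them. *)
Lemma anticoncentration ps w (a rho y : R) :
  0 <= rho -> 0 < y ->
  (forall p, p \in ps -> exists2 z : nat, (z <= 4)%N & `|w p.1 - w p.2| = z%:R) ->
  4 * y ^+ 2 <= (count (fun p => w p.1 != w p.2) ps)%:R ->
  Ex ps (fun l => (`|a + \sum_(v <- l) w v| < rho)%R%:R) <= (2 * rho + 1) / y.
Proof.
move=> r0 y0 hw hc.
pose cnt (d : nat) := count (fun p => `|w p.1 - w p.2| == d%:R) ps.
have [d d0 hd] : exists2 d : nat, (0 < d)%N & y ^+ 2 <= (cnt d)%:R.
  have hs : (count (fun p => w p.1 != w p.2) ps <= cnt 1 + cnt 2 + cnt 3 + cnt 4)%N.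
    rewrite /cnt; elim: ps hw {hc cnt} => //= p ps IH hw.
    have hp := hw p (mem_head _ _).
    have {}IH := IH (fun p0 pin => hw p0 (@mem_behead _ (p :: ps) p0 pin)).
    pose hit (d : nat) : bool := `|w p.1 - w p.2| == d%:R.
    suff : ((w p.1 != w p.2) <= hit 1 + hit 2 + hit 3 + hit 4)%N.
      by move: IH; rewrite /hit; lia.
    rewrite /hit.
    case: hp => z hz hzE; rewrite hzE !eqr_nat.
    have [//|hne] := eqVneq (w p.1) (w p.2).
    case: z hz hzE => [|[|[|[|[|z]]]]] //= _ /normr0_eq0/subr0_eq h0.
    by rewrite h0 eqxx in hne.
  have [h1|h1] := lerP (y ^+ 2) (cnt 1%N)%:R; first by exists 1%N.
  have [h2|h2] := lerP (y ^+ 2) (cnt 2%N)%:R; first by exists 2%N.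
  have [h3|h3] := lerP (y ^+ 2) (cnt 3%N)%:R; first by exists 3%N.
  exists 4%N => //; move: hs; rewrite -(ler_nat R) !natrD; lra.
have [c hE] := Ex_le_binavg ps w d%:R (fun u => (`|u| < rho)%R%:R) a.
apply: le_trans hE _; apply: le_trans (binavg_le _ _ _ _) _ => //.
rewrite mulrC; apply: ler_pM.
- by apply: sumr_ge0.
- by rewrite divr_ge0 ?ler0n ?exprn_ge0.
- by apply: interval_count => //; rewrite ler1n.
- by rewrite -[y^-1]div1r; apply: central_bin_real.
Qed.
End LittlewoodOfford.

(** * Greedy choices and counting in lists *)
Section ListCombinatorics.
Variable T : eqType.
Implicit Types (A : seq T).

Lemma size_classes A (f : T -> nat) b : {in A, forall v, (f v < b)%N} ->
  size A = (\sum_(j < b) count (fun v => f v == j) A)%N.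
Proof.
elim: A => [|x A IH] h /=; first by rewrite big1.
rewrite big_split /= -IH; last by move=> v hv; apply: h; rewrite inE hv orbT.
rewrite (bigD1 (Ordinal (h x (mem_head _ _)))) //= eqxx big1 ?addn0 // => j.
by rewrite eq_sym -val_eqE /= => /negbTE ->.
Qed.

Lemma pigeonhole A (f : T -> nat) b M : {in A, forall v, (f v < b)%N} ->
  (b * M < size A)%N -> exists j, (M < count (fun v => f v == j) A)%N.
Proof.
move=> h hM.
have [j hj|hn] := pickP (fun j : 'I_b => (M < count (fun v => f v == j) A)%N).
  by exists (val j).
suff : (size A <= b * M)%N by lia.
rewrite (size_classes h) -[b in (b * M)%N]card_ord -sum_nat_const.
by apply: leq_sum => j _; move: (hn j); lia.
Qed.

(** Pairs are removed one at a time.  As long as more than [b * s.+1] elements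
    are left, some class of [f] holds [s.+2] of them, and one of these forms a
    good pair with the first. *)
Lemma extract_pairs A (f : T -> nat) (good : rel T) k b s :
  uniq A -> {in A, forall v, (f v < b)%N} ->
  {in A, forall x, (count (fun y => ~~ (good x y || good y x)) A <= s)%N} ->
  (b * s.+1 + k.*2 <= size A)%N ->
  exists ps rest, [/\ size ps = k, perm_eq A (ends ps ++ rest) &
    {in ps, forall p, good p.1 p.2 /\ f p.1 = f p.2}].
Proof.
elim: k A => [|k IH] A uA fA gA hsz; first by exists [::], A.
have [j hj] : exists j, (s.+1 < count (fun v => (f v == j)) A)%N.
  by apply: pigeonhole fA _; lia.
set B := filter (fun v => f v == j) A.
have hB : size B = count (fun v => f v == j) A by rewrite size_filter.
have uB : uniq B by apply: filter_uniq.
have sB : {subset B <= A} by apply: mem_subseq; apply: filter_subseq.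
have fB v : v \in B -> f v = j by rewrite mem_filter => /andP[/eqP].
case EB : B => [|x B'] in hB uB sB fB; first by rewrite -hB in hj.
have xA : x \in A by apply: sB; rewrite mem_head.
have hBA : (count (fun y => ~~ (good x y || good y x)) B' <= s)%N.
  apply: leq_trans (gA x xA).
  have sBA : subseq B' A.
    by apply: subseq_trans (subseq_cons _ x) _; rewrite -EB; apply: filter_subseq.
  exact: leq_count_subseq.
have [y yB hy] : exists2 y, y \in B' & good x y || good y x.
  apply/hasP; rewrite -[has _ _]negbK -all_predC; apply/negP => hall.
  move: hBA; rewrite (eq_in_count (a2 := predT)); last by apply/allP.
  rewrite count_predT; move: hj; rewrite -hB /=; lia.
have hxy : x != y.
  by apply/eqP => hx; move: uB => /=; rewrite hx yB.
have yA : y \in A by apply: sB; rewrite inE yB orbT.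
set A' := rem y (rem x A).
have pA : perm_eq A (x :: y :: A').
  apply: perm_trans (perm_to_rem xA) _; rewrite perm_cons.
  by apply: perm_to_rem; rewrite mem_rem_uniq // !inE eq_sym hxy.
have sA' : {subset A' <= A} by move=> v hv; move/mem_rem: hv => /mem_rem.
have [||||ps [rest [h1 h2 h3]]] := IH A'.
- by rewrite !rem_uniq.
- by move=> v /sA'; apply: fA.
- move=> v /sA' hv; apply: leq_trans (gA v hv).
  by rewrite (permP pA) /= addnA leq_addl.
- by move: (perm_size pA) => /=; lia.
have fxy : f x = f y by rewrite !fB // !inE ?yB ?orbT ?eqxx.
have [hg|hg] := boolP (good x y); last first.
  exists ((y, x) :: ps), rest; split=> /=; first by rewrite h1.
    apply: perm_trans pA _; rewrite -[_ :: _ :: A']/([:: x; y] ++ A').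
    rewrite -[_ :: _ :: _ ++ _]/([:: y; x] ++ _) perm_cat //.
    by apply/permP => P /=; rewrite addnCA.
  move=> p; rewrite inE => /orP[/eqP -> /=|/h3 //].
  by split => //; move: hy; rewrite (negbTE hg).
exists ((x, y) :: ps), rest; split=> /=; first by rewrite h1.
  by apply: perm_trans pA _; rewrite !perm_cons.
by move=> p; rewrite inE => /orP[/eqP -> /=|/h3 //].
Qed.

Lemma greedy_indep (P : seq T) (conf : rel T) d k : uniq P ->
  {in P, forall x, (count (conf x) P <= d)%N} -> (k * d.+1 <= size P)%N ->
  exists Q, [/\ size Q = k, uniq Q, {subset Q <= P} &
                pairwise (fun x y => ~~ conf x y) Q].
Proof.
elim: k P => [|k IH] P uP hP hk; first by exists [::].
case: P uP hP hk => [|x P] //= /andP[xP uP] hP hk.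
have hx := hP x (mem_head _ _).
set P' := filter (fun y => ~~ conf x y) P.
have hs : (size P <= size P' + d)%N.
  rewrite size_filter -(count_predC (conf x) P) addnC leq_add2l.
  by move: hx => /=; lia.
have [|||Q [h1 h2 h3 h4]] := IH P'.
- by apply: filter_uniq.
- move=> y; rewrite mem_filter => /andP[_ hy].
  apply: leq_trans (hP y _); last by rewrite inE hy orbT.
  apply: leq_trans (leq_addl _ _).
  by apply: leq_count_subseq; apply: filter_subseq.
- by move: hk; rewrite mulSn; lia.
exists (x :: Q); split => /=.
- by rewrite h1.
- rewrite h2 andbT; apply/negP => /h3; rewrite mem_filter => /andP[_].
  by rewrite (negbTE xP).
- move=> y; rewrite !inE => /orP[->//|/h3]; rewrite mem_filter => /andP[_ ->].
  by rewrite orbT.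
- rewrite h4 andbT; apply/allP => y /h3; by rewrite mem_filter => /andP[].
Qed.

Lemma keyed_union (J M : nat) (K : nat -> T -> Prop) :
  (forall j j' v, K j v -> K j' v -> j = j') ->
  (forall j, (j < J)%N ->
     exists F, [/\ uniq F, (M <= size F)%N & {in F, forall v, K j v}]) ->
  exists F, [/\ uniq F, (J * M <= size F)%N &
               {in F, forall v, exists2 j, (j < J)%N & K j v}].
Proof.
move=> hK; elim: J => [|J IH] h; first by exists [::].
have [|F [u1 s1 k1]] := IH; first by move=> j hj; apply: h; lia.
have [G [u2 s2 k2]] := h J (ltnSn J).
exists (F ++ G); split.
- rewrite cat_uniq u1 u2 andbT /=; apply/hasPn => v vG; apply/negP => vF.
  have [j hj kj] := k1 v vF; have := hK _ _ _ kj (k2 v vG); lia.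
- by rewrite size_cat mulSn; lia.
- move=> v; rewrite mem_cat => /orP[/k1[j hj kj]|/k2 kJ].
    by exists j => //; lia.
  by exists J.
Qed.
End ListCombinatorics.

Section RealLists.
Variables (R : realType) (T : eqType).
Implicit Types (A : seq T) (D : T -> R).

(** Pair consecutive elements in the order of [D]: the gaps are disjoint parts of
    an interval of length [hi - lo], so their squares sum to at most its
    square. *)
Lemma sorted_pairs A D r (lo hi : R) : size A = r.*2 -> lo <= hi ->
  {in A, forall v, lo <= D v <= hi} ->
  exists2 ps, perm_eq A (ends ps) &
    \sum_(p <- ps) (D p.1 - D p.2) ^+ 2 <= (hi - lo) ^+ 2.
Proof.
move=> hsz hlh hA.
pose leD := (fun x y : T => D x <= D y).
have tD : transitive leD by move=> x y z; apply: le_trans.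
have totD : total leD by move=> x y; apply: le_total.
have hp : perm_eq A (sort leD A) by rewrite perm_sym perm_sort.
suff [ps h1 h2] : exists2 ps, sort leD A = ends ps &
    \sum_(p <- ps) (D p.1 - D p.2) ^+ 2 <= (hi - lo) ^+ 2.
  by exists ps => //; rewrite -h1.
have {hA}: {in sort leD A, forall v, lo <= D v <= hi}.
  by move=> v; rewrite mem_sort; apply: hA.
have {hsz}: size (sort leD A) = r.*2 by rewrite size_sort.
have : sorted leD (sort leD A) by apply: sort_sorted.
elim: r lo (sort leD A) hlh {hp} => [|r IH] lo [|x [|y l]] //= hlh hs hsz hl.
  exists [::] => //; by rewrite big_nil sqr_ge0.
move: hs => /andP[hxy hs].
have /andP[hx1 hx2] := hl x (mem_head _ _).
have /andP[hy1 hy2] := hl y (mem_behead (s := _ :: _) (mem_head _ _)).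
have [||ps h1 h2] := IH (D y) l hy2 (path_sorted hs).
- by move: hsz; lia.
- move=> v hv; have := order_path_min tD hs => /allP /(_ v hv); rewrite /leD => ->.
  by have /(_ v) := hl; rewrite !inE hv !orbT => /(_ isT) /andP[].
exists ((x, y) :: ps); first by rewrite h1.
rewrite big_cons /=; apply: le_trans (lerD (lexx _) h2) _.
move: hxy; rewrite /leD; nra.
Qed.

Definition cellsN (w : R) (f : nat -> R) k : seq int :=
  undup [seq Num.floor (f i / w) | i <- iota 0 k.+1].

(** A walk from [f 0] to [f m] meets the cells of mesh [w] in between, except
    those over which it leaps.  A jump of length [d] leaps over at most
    [(d / w) ^ 2] cells, so the squared jumps pay for the cells never visited. *)
Lemma cells_lower (w : R) (f : nat -> R) m : 0 < w ->
  f m - f 0%N - w - (\sum_(k < m) (f k.+1 - f k) ^+ 2) / w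
    <= w * (size (cellsN w f m))%:R.
Proof.
move=> w0; pose c k := Num.floor (f k / w).
pose E m := (\sum_(k < m) (f k.+1 - f k) ^+ 2) / w.
have ES k : E k.+1 = E k + (f k.+1 - f k) ^+ 2 / w.
  by rewrite /E big_ord_recr /= mulrDl.
have cl k : w * (c k)%:~R <= f k.
  by rewrite mulrC -ler_pdivlMr // floor_le_tmp.
have cu k : f k < w * (c k)%:~R + w.
  have := floorD1_gt (f k / w); rewrite -/(c k) ltr_pdivrMr // intrD; lra.
have memc i k : (i <= k)%N -> c i \in cellsN w f k.
  by move=> h; rewrite mem_undup; apply/mapP; exists i; rewrite // mem_iota; lia.
have main k : forall j, (j <= k)%N ->
    w * ((c j)%:~R - (c 0%N)%:~R) <= w * ((size (cellsN w f k))%:R - 1) + E k.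
  elim: k => [|k IH] j hj.
    have -> : j = 0%N by lia.
    by rewrite /E big_ord0 /= !subrr mulr0 mul0r addr0.
  have E0 : E k <= E k.+1.
    by rewrite ES lerDl divr_ge0 ?sqr_ge0 // ltW.
  have sub : {subset cellsN w f k <= cellsN w f k.+1}.
    move=> z; rewrite !mem_undup => /mapP[i]; rewrite mem_iota => hi ->.
    by apply/mapP; exists i => //; rewrite mem_iota; lia.
  have N0 : ((size (cellsN w f k))%:R : R) <= (size (cellsN w f k.+1))%:R.
    by rewrite ler_nat; apply: uniq_leq_size => //; apply: undup_uniq.
  have mono i : (i <= k)%N ->
     w * ((c i)%:~R - (c 0%N)%:~R) <= w * ((size (cellsN w f k.+1))%:R - 1) + E k.+1.
    move=> hi; apply: le_trans (IH _ hi) _; apply: lerD => //.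
    by rewrite ler_pM2l // lerD2r.
  have [hjk|hjk] := leqP j k; first exact: mono.
  have {hj hjk}-> : j = k.+1 by lia.
  have [hin|hnin] := boolP (c k.+1 \in cellsN w f k).
    move: hin; rewrite mem_undup => /mapP[i]; rewrite mem_iota => hi ->.
    by apply: mono; lia.
  have N1 : ((size (cellsN w f k))%:R + 1 : R) <= (size (cellsN w f k.+1))%:R.
    rewrite natr1 ler_nat -[_.+1]/(size (c k.+1 :: cellsN w f k)).
    apply: uniq_leq_size; first by rewrite /= hnin undup_uniq.
    by move=> z; rewrite inE => /orP[/eqP ->|/sub //]; apply: memc.
  have := IH k (leqnn k); rewrite ES.
  have step : w * ((c k.+1)%:~R - (c k)%:~R) <= w + (f k.+1 - f k) ^+ 2 / w.
    have [hd|hd] := lerP (c k.+1) (c k + 1).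
      apply: (@le_trans _ _ w); last by rewrite lerDl divr_ge0 ?sqr_ge0 // ltW.
      rewrite -[leRHS]mulr1 ler_pM2l // -intrB.
      by rewrite (_ : 1 = 1%:~R) // ler_int; lia.
    have hd2 : (2 : R) <= (c k.+1)%:~R - (c k)%:~R.
      by rewrite -intrB (_ : 2 = 2%:~R) // ler_int; lia.
    set d := (c k.+1)%:~R - (c k)%:~R in hd2 *.
    have hdel : (d - 1) * w <= f k.+1 - f k.
      by move: (cl k.+1) (cu k); rewrite /d; lra.
    have : (d - 1) * w <= (f k.+1 - f k) ^+ 2 / w.
      rewrite ler_pdivlMr //; apply: (@le_trans _ _ (((d - 1) * w) ^+ 2)).
        rewrite exprMn -mulrA -expr2 ler_pM2r ?exprn_gt0 //; nra.
      by rewrite ler_pXn2r // nnegrE; nra.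
    lra.
  have : w * ((size (cellsN w f k))%:R - 1) + w <= w * ((size (cellsN w f k.+1))%:R - 1).
    by move: N1; nra.
  move: step; lra.
have := main m m (leqnn m); rewrite !mulrBr mulr1.
move: (cl 0%N) (cu m); rewrite /E; lra.
Qed.

(** A value lies in or next to at most three given cells. *)
Lemma cell_double_count (V : eqType) (C : seq int) (U : seq V) (cell : V -> int) g :
  uniq C ->
  {in C, forall c, (g <= count (fun v => `|cell v - c| <= 1) U)%N} ->
  (size C * g <= 3 * size U)%N.
Proof.
move=> uC h.
have h3 (z : int) : (count (fun c => `|z - c| <= 1) C <= 3)%N.
  rewrite -size_filter -[3%N]/(size [:: z - 1; z; z + 1]); apply: uniq_leq_size.
    exact: filter_uniq.
  by move=> c; rewrite mem_filter !inE => /andP[]; lia.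
have -> : (3 * size U = \sum_(v <- U) 3)%N.
  by rewrite big_const_seq count_predT iter_addn_0.
apply: (@leq_trans (\sum_(c <- C) count (fun v => `|cell v - c| <= 1) U)%N).
  rewrite big_seq (eq_bigr (fun c => count (fun v => `|cell v - c| <= 1) U)) //.
  rewrite mulnC; have -> : (g * size C = \sum_(c <- C) g)%N.
    by rewrite big_const_seq count_predT iter_addn_0.
  by rewrite big_seq; apply: leq_sum => c /h.
have -> : (\sum_(c <- C) count (fun v => `|cell v - c| <= 1) U =
   \sum_(v <- U) count (fun c => `|cell v - c| <= 1) C)%N.
  under eq_bigr do rewrite -sum1_count big_mkcond.
  by rewrite exchange_big /=; apply: eq_bigr => v _; rewrite -sum1_count [RHS]big_mkcond.
by apply: leq_sum => v _.
Qed.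

Fixpoint collisions (val : T -> R) A : R :=
  if A is x :: A' then \sum_(y <- A') (val x == val y)%:R + collisions val A' else 0.

Lemma collisions_ge0 val A : 0 <= collisions val A.
Proof. by elim: A => //= x A IH; rewrite addr_ge0 ?sumr_ge0. Qed.

(** An element whose value is taken again later is charged to a collision. *)
Lemma distinct_lower val A :
  (size A)%:R - collisions val A <= (size (undup (map val A)))%:R.
Proof.
elim: A => [|x A IH] /=; first by rewrite subrr.
have h0 : 0 <= \sum_(y <- A) (val x == val y)%:R :> R by apply: sumr_ge0.
rewrite -natr1; have [/mapP[y yA xy]|_] := boolP (val x \in map val A); last first.
  by rewrite /= -[X in _ <= X]natr1; lra.
suff : 1 <= \sum_(y <- A) (val x == val y)%:R :> R by lra.
rewrite (big_rem y) //= xy eqxx lerDl; exact: sumr_ge0.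
Qed.
End RealLists.

(** * Density of graphs without large homogeneous sets *)
Section Density.
Variable R : realType.

Section Graph.
Variables (T : finType) (e : rel T).

(** Go through [I], keeping the neighbours of [i] among the remaining vertices
    when they form a proportion [eta], and the non-neighbours otherwise.  The
    first case costs a factor [eta] but occurs at most [k] times; the second one
    costs only a factor [1 - eta]. *)
Lemma trace_pigeonhole (eta : R) (I : seq T) (Y : {set T}) k :
  0 < eta < 1 -> {in Y, forall y, (count (e y) I <= k)%N} ->
  exists Y' : {set T},
    [/\ Y' \subset Y,
        #|Y|%:R * eta ^+ k * (1 - eta) ^+ size I <= #|Y'|%:R &
        {in Y' &, forall y y', {in I, e y =1 e y'}}].
Proof.
move=> /andP[eta0 eta1]; have eta1' : 0 < 1 - eta by rewrite subr_gt0.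
elim: I Y k => [|i I IH] Y k hY.
  by exists Y; split => //=; rewrite expr0 mulr1 ler_piMr // exprn_ile1 // ltW.
pose Y1 := [set y in Y | e y i]; pose Y2 := [set y in Y | ~~ e y i].
have hc : (#|Y|%:R : R) = #|Y1|%:R + #|Y2|%:R.
  rewrite -natrD -(cardsID [set y | e y i] Y); congr (_ + _)%:R; apply: eq_card => y.
    by rewrite !inE.
  by rewrite !inE andbC.
have use (Z : {set T}) (bb : bool) k' : Z \subset Y -> {in Z, forall y, e y i = bb} ->
    {in Z, forall y, (count (e y) I <= k')%N} ->
    #|Y|%:R * eta ^+ k * (1 - eta) ^+ (size I).+1 <=
      #|Z|%:R * eta ^+ k' * (1 - eta) ^+ size I ->
    exists Y' : {set T},
    [/\ Y' \subset Y,
        #|Y|%:R * eta ^+ k * (1 - eta) ^+ (size I).+1 <= #|Y'|%:R &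
        {in Y' &, forall y y', {in i :: I, e y =1 e y'}}].
  move=> ZY Zb Zk hZ; have [Y' [h1 h2 h3]] := IH Z k' Zk.
  exists Y'; split; first exact: subset_trans ZY.
    exact: le_trans h2.
  move=> y y' hy hy' z; rewrite inE => /orP[/eqP ->|]; last exact: h3.
  by rewrite (Zb y) ?(Zb y') //; apply: (subsetP h1).
have hp : 0 <= (1 - eta) ^+ size I by rewrite exprn_ge0 // ltW.
have he j : 0 <= eta ^+ j by rewrite exprn_ge0 // ltW.
have s1 : Y1 \subset Y by apply/subsetP => y; rewrite inE => /andP[].
have s2 : Y2 \subset Y by apply/subsetP => y; rewrite inE => /andP[].
have [[k0 [hk h1]]|h1] : (exists k0, k = k0.+1 /\ eta * #|Y|%:R <= #|Y1|%:R) \/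
    (1 - eta) * #|Y|%:R <= #|Y2|%:R.
  case: k hY {use} => [|k0] hY.
    right; rewrite hc [X in X%:R + _](_ : #|Y1| = 0%N).
      by rewrite add0r ler_piMl // lerBlDr lerDl ltW.
    apply: eq_card0 => y; rewrite !inE; apply/negP => /andP[/hY].
    by rewrite /=; case: (e y i).
  have [h|h] := lerP (eta * #|Y|%:R) #|Y1|%:R; first by left; exists k0.
  by right; move: hc h; lra.
- apply: (use Y1 true k0 s1).
  + by move=> y; rewrite inE => /andP[].
  + by move=> y; rewrite inE => /andP[/hY /= h2 h3]; move: h2; rewrite h3 hk; lia.
  + rewrite hk !exprSr; set A := eta ^+ k0; set P := (1 - eta) ^+ size I.
    have AP : 0 <= A * P by rewrite mulr_ge0 // he.
    rewrite (_ : _ * _ = (eta * #|Y|%:R) * (A * P) * (1 - eta)); last by ring.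
    apply: (@le_trans _ _ (eta * #|Y|%:R * (A * P))).
      have Z0 : 0 <= eta * #|Y|%:R * (A * P).
        by apply: mulr_ge0 => //; apply: mulr_ge0 => //; apply: ltW.
      by rewrite ler_piMr // lerBlDr lerDl ltW.
    by rewrite -[leRHS]mulrA ler_wpM2r.
- apply: (use Y2 false k s2).
  + by move=> y; rewrite inE => /andP[_ /negbTE].
  + by move=> y; rewrite inE => /andP[/hY /= h2 h3]; move: h2; lia.
  + rewrite exprS mulrA ler_wpM2r // mulrAC ler_wpM2r //.
    by rewrite mulrC.
Qed.

(** The usual induction for off-diagonal Ramsey numbers: if neither the
    neighbours nor the non-neighbours of a vertex met the threshold, then adding
    up the two failures would contradict the threshold for [Y]. *)
Lemma ramsey_threshold (eta : R) a b (Y : {set T}) :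
  symmetric e -> irreflexive e -> 0 < eta < 1 ->
  2 <= (#|Y|%:R + 1) * eta ^+ a * (1 - eta) ^+ b ->
  (exists S : {set T}, [/\ S \subset Y, independent e S & (a <= #|S|)%N]) \/
  (exists S : {set T}, [/\ S \subset Y, clique e S & (b <= #|S|)%N]).
Proof.
move=> e_sym e_irr /andP[eta0 eta1]; have eta1' : 0 < 1 - eta by rewrite subr_gt0.
have pa j : 0 < eta ^+ j by rewrite exprn_gt0.
have pb j : 0 < (1 - eta) ^+ j by rewrite exprn_gt0.
elim: a b Y => [|a IHa] b Y.
  by move=> _; left; exists set0; split => //; [exact: sub0set|move=> x y; rewrite inE].
elim: b Y => [|b IHb] Y hY.
  by right; exists set0; split => //; [exact: sub0set|move=> x y; rewrite inE].
have [Y0|[v vY]] := set_0Vmem Y.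
  move: hY; rewrite Y0 cards0 add0r mul1r => hY.
  have : eta ^+ a.+1 * (1 - eta) ^+ b.+1 <= 1.
    by rewrite mulr_ile1 ?exprn_ile1 ?(ltW (pa _)) ?(ltW (pb _)) ?(ltW eta0) ?(ltW eta1')
       ?(ltW eta1) //; lra.
  lra.
pose Y1 := [set y in Y :\ v | ~~ e v y]; pose Y2 := [set y in Y :\ v | e v y].
have s1 : Y1 \subset Y by apply/subsetP => y; rewrite !inE => /andP[/andP[]].
have s2 : Y2 \subset Y by apply/subsetP => y; rewrite !inE => /andP[/andP[]].
have hc : (#|Y|%:R : R) = #|Y1|%:R + #|Y2|%:R + 1.
  rewrite -natrD natr1 (cardsD1 v) vY add1n; congr _.+1%:R.
  rewrite -(cardsID [set y | ~~ e v y] (Y :\ v)); congr (_ + _)%N; apply: eq_card => y.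
    by rewrite !inE.
  by rewrite !inE negbK andbC.
have [h|h] := lerP 2 ((#|Y1|%:R + 1) * eta ^+ a * (1 - eta) ^+ b.+1).
  have [[S [h1 h2 h3]]|[S [h1 h2 h3]]] := IHa _ _ h; last first.
    by right; exists S; split => //; apply: subset_trans s1.
  left; have vS : v \notin S by apply/negP => /(subsetP h1); rewrite !inE eqxx.
  exists (v |: S); split.
  - by rewrite subUset sub1set vY (subset_trans h1).
  - have hv y : y \in S -> ~~ e v y by move=> /(subsetP h1); rewrite !inE => /andP[].
    move=> x y; rewrite !inE => /orP[/eqP ->|xS] /orP[/eqP ->|yS]; last exact: h2.
    + by rewrite e_irr.
    + exact: hv.
    + by rewrite e_sym hv.
  - by rewrite cardsU1 vS.
have [h'|h'] := lerP 2 ((#|Y2|%:R + 1) * eta ^+ a.+1 * (1 - eta) ^+ b).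
  have [[S [h1 h2 h3]]|[S [h1 h2 h3]]] := IHb _ h'.
    by left; exists S; split => //; apply: subset_trans s2.
  right; have vS : v \notin S by apply/negP => /(subsetP h1); rewrite !inE eqxx.
  exists (v |: S); split.
  - by rewrite subUset sub1set vY (subset_trans h1).
  - have hv y : y \in S -> e v y by move=> /(subsetP h1); rewrite !inE => /andP[].
    move=> x y; rewrite !inE => /orP[/eqP ->|xS] /orP[/eqP ->|yS]; last exact: h2.
    + by rewrite eqxx.
    + by move=> _; apply: hv.
    + by move=> _; rewrite e_sym hv.
  - by rewrite cardsU1 vS.
exfalso; move: h h' hY; rewrite hc !exprSr.
set A := eta ^+ a; set B := (1 - eta) ^+ b.
have A0 : 0 < A := pa a; have B0 : 0 < B := pb b.
set y1 : R := #|Y1|%:R + 1; set y2 : R := #|Y2|%:R + 1.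
have -> : #|Y1|%:R + #|Y2|%:R + 1 + 1 = y1 + y2 :> R by rewrite /y1 /y2; lra.
set AB := A * B.
have h1 : y1 * A * (B * (1 - eta)) = y1 * AB * (1 - eta) by rewrite /AB; ring.
have h2 : y2 * (A * eta) * B = y2 * AB * eta by rewrite /AB; ring.
have h3 : (y1 + y2) * (A * eta) * (B * (1 - eta)) = (y1 * AB * (1 - eta)) * eta + (y2 * AB * eta) * (1 - eta).
  by rewrite /AB; ring.
rewrite h1 h2 h3; set u := y1 * _ * _; set w := y2 * _ * _; nra.
Qed.
End Graph.

Lemma sum_card_adj (T : finType) (f : rel T) (A B : {set T}) : symmetric f ->
  (\sum_(x in A) #|[set y in B | f x y]| = \sum_(y in B) #|[set x in A | f y x]|)%N.
Proof.
move=> f_sym.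
have h (A' B' : {set T}) : (\sum_(x in A') #|[set y in B' | f x y]| =
    \sum_(x in A') \sum_(y in B') f x y)%N.
  apply: eq_bigr => x _; rewrite -sum1_card big_mkcond [RHS]big_mkcond.
  by apply: eq_bigr => y _; rewrite !inE; case: (y \in B'); case: (f x y).
rewrite !h exchange_big; apply: eq_bigr => x _; apply: eq_bigr => y _.
by rewrite f_sym.
Qed.

Lemma card_markov (T : finType) (A : {set T}) (g : T -> nat) (t M : R) :
  (\sum_(x in A) g x)%N%:R <= M -> 
  #|[set x in A | t < (g x)%:R]|%:R * t <= M.
Proof.
move=> hM; apply: le_trans hM; rewrite natr_sum mulrC.
have -> : t * #|[set x in A | t < (g x)%:R]|%:R = \sum_(x in [set x in A | t < (g x)%:R]) t.
  by rewrite sumr_const mulr_natr.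
rewrite [leRHS](big_setID [set x | t < (g x)%:R]) /=.
rewrite (eq_bigl (mem (A :&: [set x | t < (g x)%:R]))); last first.
  by move=> x; rewrite !inE.
apply: (@le_trans _ _ (\sum_(x in A :&: [set x | t < (g x)%:R]) (g x)%:R)).
  by apply: ler_sum => x; rewrite !inE => /andP[_ /ltW].
by rewrite lerDl sumr_ge0.
Qed.

(** The Erdos-Szemeredi theorem.  Suppose that [X] is sparse and let [I] be a
    largest independent set among its vertices of low degree.  By double
    counting, many vertices have only few neighbours in [I]; by
    [trace_pigeonhole] many of them have the same neighbours in [I].  Among the
    latter there is no large clique, so [ramsey_threshold] gives an independent
    set [S] with more elements than this common trace.  Replacing the trace by
    [S] contradicts the choice of [I]. *)
Lemma sparse_density (K : nat) : exists2 eps : R, 0 < eps & exists m0 : nat,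
  forall (T : finType) (e : rel T) (b : nat) (X : {set T}),
  symmetric e -> irreflexive e ->
  (forall S : {set T}, homogeneous e S -> (#|S| < b)%N) ->
  (2 ^ b <= #|X| ^ K)%N -> (m0 <= #|X|)%N ->
  eps * #|X|%:R ^+ 2 <= (\sum_(x in X) #|[set y in X | e x y]|)%N%:R.
Proof.
wlog K0 : K / (0 < K)%N.
  move=> h; have [eps e0 [m0 H]] := h K.+1 isT; exists eps => //.
  exists m0.+1 => T e b X sy ir hom h2 hm; apply: (H T e b X) => //; last by lia.
  by apply: leq_trans h2 _; apply: leq_pexp2l; lia.
pose h := (16 * K)%N; pose g := (8 * K * h)%N.
have g0 : (0 < g)%N by rewrite /g /h; lia.
have gE : g = (8 * K * h)%N by [].
pose eta : R := (2 ^+ h)^-1.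
have eta0 : 0 < eta by rewrite invr_gt0 exprn_gt0.
have hh : (h%:R : R) <= 2 ^+ h by rewrite -natrX ler_nat ltnW // ltn_expl.
have etaK : eta * (16 * K%:R) <= 1.
  by rewrite -natrM mulrC ler_pdivrMr ?exprn_gt0 // mul1r.
have K1 : (1 : R) <= K%:R by rewrite ler1n.
have eta1 : eta < 1 by nra.
have eta1' : 0 < 1 - eta by rewrite subr_gt0.
pose eps : R := (8 * g%:R)^-1.
have epsE0 : eps = (8 * g%:R)^-1 by [].
have g0' : (0 : R) < g%:R by rewrite ltr0n.
have eps0 : 0 < eps by rewrite invr_gt0 mulr_gt0.
clearbody eps.
exists eps => //.
exists (Num.truncn (256 / eta ^+ 2)).+1 => T e b X e_sym e_irr hom h2b hm.
rewrite leNgt; apply/negP => hsp.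
set n : R := #|X|%:R in hsp.
have hn : 256 / eta ^+ 2 <= n.
  apply: le_trans (ltW (truncnS_gt _)) _; by rewrite ler_nat.
have n0 : 0 < n by apply: lt_le_trans hn; rewrite divr_gt0 ?exprn_gt0.
have root_ge1 (x : R) : 0 <= x -> 1 <= x ^+ K -> 1 <= x.
  by move=> x0; rewrite expr_ge1 ?(lt0n_neq0 K0) // -lt0n.
have h2b' : 2 ^+ b <= n ^+ K by rewrite -!natrX ler_nat.
clear h2b.
(* Since [b] is logarithmic in [n], the losses [(1 - eta) ^+ b] and
   [eta ^+ k0] are only small powers of [n]: [eta] is small compared with
   [1 / K], and [g] makes [eta ^+ (8 * K * k0)] at least [2 ^- b]. *)
have hP : 1 <= n * (1 - eta) ^+ (8 * b).
  apply: root_ge1; first by rewrite mulr_ge0 ?exprn_ge0 ?ltW.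
  rewrite exprMn -exprM (_ : (8 * b * K = 8 * K * b)%N); last by rewrite mulnAC.
  rewrite exprM; apply: (@le_trans _ _ (2 ^+ b * ((1 - eta) ^+ (8 * K)) ^+ b)).
    rewrite -exprMn exprn_ege1 //.
    have : 1 - (8 * K)%:R * eta <= (1 - eta) ^+ (8 * K).
      elim: (8 * K)%N => [|j IH]; first by rewrite expr0 mul0r subr0.
      rewrite exprS -[j.+1%:R]natr1; have : (0 : R) <= j%:R by [].
      by nra.
    rewrite natrM; lra.
  by rewrite ler_wpM2r // !exprn_ge0 // ltW.
pose k0 := (b %/ g)%N.
have k0g : (k0 * g <= b)%N by rewrite leq_divM.
have k0max t : (t * g <= b)%N -> (t <= k0)%N by rewrite leq_divRL.
clearbody k0 g.
have hQ : 1 <= n * eta ^+ (8 * k0).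
  apply: root_ge1; first by rewrite mulr_ge0 ?exprn_ge0 ?ltW.
  rewrite exprMn -exprM (_ : (8 * k0 * K = 8 * K * k0)%N); last by rewrite mulnAC.
  apply: (@le_trans _ _ (2 ^+ b * eta ^+ (8 * K * k0))); last first.
    by rewrite ler_wpM2r // exprn_ge0 // ltW.
  rewrite /eta exprVn -exprM ler_pdivlMr ?exprn_gt0 // mul1r.
  rewrite ler_eXn2l ?ltr1n //.
  by apply: leq_trans k0g; rewrite gE; apply: eq_leq; ring.
have hb : 8 * b%:R <= n.
  have hinv : (1 - eta) ^+ (8 * b) * (1 + eta) ^+ (8 * b) <= 1.
    rewrite -exprMn exprn_ile1 //; nra.
  have hbern : 1 + (4 * b)%:R * eta <= (1 + eta) ^+ (4 * b).
    elim: (4 * b)%N => [|j IH]; first by rewrite expr0 mul0r addr0.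
    rewrite exprS -[j.+1%:R]natr1; have : (0 : R) <= j%:R by [].
    by nra.
  have hsq : (4 * b%:R * eta) ^+ 2 <= n.
    have hq : (1 + eta) ^+ (8 * b) <= n.
      have p0 : 0 < (1 - eta) ^+ (8 * b) by rewrite exprn_gt0.
      rewrite -(ler_pM2l p0); apply: le_trans hinv _.
      rewrite [leRHS]mulrC; exact: hP.
    apply: le_trans hq; rewrite (_ : (8 * b = 4 * b * 2)%N); last by rewrite mulnAC.
    rewrite exprM.
    rewrite ler_pXn2r ?nnegrE ?mulr_ge0 ?exprn_ge0 //; [|lra..].
    by apply: le_trans hbern; rewrite natrM; lra.
  rewrite -(@ler_pXn2r _ 2) ?nnegrE ?mulr_ge0 //.
  have h4 : 4 / eta ^+ 2 <= n.
    by apply: le_trans hn; rewrite ler_pM2r ?invr_gt0 ?exprn_gt0 //; lra.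
  rewrite ler_pdivrMr ?exprn_gt0 // in h4.
  have e2 : 0 < eta ^+ 2 by rewrite exprn_gt0.
  rewrite -(ler_pM2r e2) (_ : _ * _ = 4 * (4 * b%:R * eta) ^+ 2); last by ring.
  by rewrite expr2 -mulrA; nra.
(* Markov's inequality removes at most half of [X], and below a quarter. *)
pose hd := [set x in X | 2 * eps * n < #|[set y in X | e x y]|%:R].
have hhd : 2 * #|hd|%:R <= n.
  have := card_markov (2 * eps * n) (ltW hsp); rewrite -/hd.
  have en0 : 0 < eps * n by rewrite mulr_gt0.
  move=> h1; rewrite -(ler_pM2r en0); move: h1; nra.
pose X' := X :\: hd.
have X'X : X' \subset X by rewrite subDset subsetUr.
have X'deg x : x \in X' -> #|[set y in X | e x y]|%:R <= 2 * eps * n.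
  by rewrite !inE => /andP[h1 xX]; move: h1; rewrite xX /= -leNgt.
pose indb (S : {set T}) := [forall x in S, [forall y in S, ~~ e x y]].
have indP S : reflect (independent e S) (indb S).
  apply: (iffP forall_inP) => H x; last by move=> xS; apply/forall_inP => y yS; apply: H.
  by move=> y xS yS; have /forall_inP := H x xS; apply.
have ind0 : indb set0 && (set0 \subset X').
  by rewrite sub0set andbT; apply/indP => x y; rewrite inE.
case: (arg_maxnP (P := fun S : {set T} => indb S && (S \subset X'))
   (fun S : {set T} => #|S|) ind0) => I /andP[/indP Iind IX'] Imax.
have Ib : (#|I| < b)%N by apply: hom; right.
pose t v := #|[set i in I | e v i]|.
pose bad := [set x in X | #|I|%:R / g%:R < (t x)%:R :> R].
have hbad : 4 * #|bad|%:R <= n.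
  have [I0|I0] := posnP #|I|.
    suff -> : #|bad| = 0%N by rewrite mulr0 ltW.
    apply: eq_card0 => x; rewrite !inE I0 mul0r /t.
    have -> : I = set0 by apply/eqP; rewrite -cards_eq0 I0.
    rewrite (_ : [set i in set0 | e x i] = set0) ?cards0 ?ltxx ?andbF //.
    by apply/setP => y; rewrite !inE.
  have I0' : (0 : R) < #|I|%:R by rewrite ltr0n.
  have hs : (\sum_(x in X) t x)%N%:R <= #|I|%:R * (2 * eps * n).
    rewrite /t sum_card_adj // natr_sum.
    have -> : #|I|%:R * (2 * eps * n) = \sum_(i in I) (2 * eps * n).
      by rewrite sumr_const mulr_natl.
    apply: ler_sum => i iI; apply: X'deg; exact: (subsetP IX').
  have := card_markov (#|I|%:R / g%:R) hs; rewrite -/bad => h1.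
  have epsE : 8 * eps = g%:R^-1 by rewrite epsE0 invfM; field; rewrite ?gt_eqF.
  have h2 : 0 < #|I|%:R * (2 * eps) by rewrite mulr_gt0 // mulr_gt0.
  rewrite -(ler_pM2l h2); move: h1; rewrite -epsE; lra.
pose Y := (X' :\: bad) :\: I.
have hY : n / 8 <= #|Y|%:R.
  have : (#|X| <= #|hd| + #|bad| + #|I| + #|Y|)%N.
    have sub : X \subset hd :|: bad :|: I :|: Y.
      apply/subsetP => x xX; rewrite /Y /X'; rewrite !inE xX /=.
      by case: (_ < _); case: (_ < _); case: (x \in I).
    apply: leq_trans (subset_leq_card sub) _.
    by do 3 (apply: leq_trans (leq_card_setU _ _) _; rewrite leq_add2r).
  rewrite -(ler_nat R) !natrD -/n.
  have : (#|I|%:R : R) <= b%:R by rewrite ler_nat ltnW.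
  lra.
have tk v : v \in Y -> (count (e v) (enum I) <= k0)%N.
  rewrite !inE => /andP[vI /andP[vb /andP[vh vX]]].
  have tE : count (e v) (enum I) = t v.
    rewrite /t -sum1_count -sum1_card big_enum_cond.
    by apply: eq_bigl => i; rewrite !inE.
  move: vb; rewrite vX /= -leNgt ler_pdivlMr // -natrM ler_nat tE => hh1.
  by apply: k0max; apply: leq_trans hh1 (ltnW Ib).
have [Y' [Y'Y hY' htr]] := trace_pigeonhole (eta := eta) (I := enum I) (k := k0) (Y := Y)
   (introT andP (conj eta0 eta1)) tk.
have hbig : 2 <= (#|Y'|%:R + 1) * eta ^+ k0.+1 * (1 - eta) ^+ b.
  set A := eta ^+ k0; set B := (1 - eta) ^+ b.
  have A0 : 0 < A by rewrite exprn_gt0.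
  have B0 : 0 < B by rewrite exprn_gt0.
  have BI : B <= (1 - eta) ^+ size (enum I).
    rewrite -cardE; apply: ler_wiXn2l; [exact: ltW | | exact: ltnW].
    by rewrite lerBlDr lerDl ltW.
  have h1 : n / 8 * A * B <= #|Y'|%:R.
    apply: le_trans hY'; apply: ler_pM BI; last by rewrite ler_wpM2r // ltW.
      by rewrite mulr_ge0 ?divr_ge0 // ltW.
    exact: ltW.
  have hPQ : 1 <= n * (A * B) ^+ 4.
    have hA8 : 1 <= n * (A ^+ 2) ^+ 4.
      by rewrite /A -!exprM (_ : (k0 * (2 * 4) = 8 * k0)%N) // mulnC.
    have hB8 : 1 <= n * (B ^+ 2) ^+ 4.
      by rewrite /B -!exprM (_ : (b * (2 * 4) = 8 * b)%N) // mulnC.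
    have : 1 <= (n * (A * B) ^+ 4) ^+ 2.
      have -> : (n * (A * B) ^+ 4) ^+ 2 = (n * (A ^+ 2) ^+ 4) * (n * (B ^+ 2) ^+ 4) by ring.
      by rewrite -[leLHS]mulr1; apply: ler_pM.
    by rewrite expr_ge1 // mulr_ge0 ?exprn_ge0 ?mulr_ge0 // ltW.
  set C := A * B in hPQ.
  have C0 : 0 < C by rewrite mulr_gt0.
  have h3 : 16 / eta <= n * C ^+ 2.
    have nn1 : 0 <= 16 / eta by rewrite divr_ge0 // ltW.
    have nn2 : 0 <= n * C ^+ 2 by apply: mulr_ge0; [exact: ltW | exact: sqr_ge0].
    rewrite -(@ler_pXn2r _ 2) //.
    have -> : (n * C ^+ 2) ^+ 2 = n * (n * C ^+ 4) by ring.
    have -> : (16 / eta) ^+ 2 = 256 / eta ^+ 2.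
      by rewrite expr_div_n; congr (_ / _); rewrite -natrX.
    by apply: le_trans hn _; rewrite -[leLHS]mulr1 ler_wpM2l.
  rewrite ler_pdivrMr // in h3.
  have -> : (#|Y'|%:R + 1) * eta ^+ k0.+1 * B = (#|Y'|%:R + 1) * (C * eta).
    by rewrite exprS -/A /C; ring.
  have h4 : n / 8 * C * (C * eta) <= (#|Y'|%:R + 1) * (C * eta).
    apply: ler_wpM2r; first by rewrite mulr_ge0 // ltW.
    by rewrite /C; move: h1; lra.
  apply: le_trans h4; move: h3; lra.
have [[S [S1 S2 S3]]|[S [S1 S2 S3]]] :=
  ramsey_threshold e_sym e_irr (introT andP (conj eta0 eta1)) hbig; last first.
  by have := hom S (or_introl S2); rewrite ltnNge S3.
have [y0 y0S] : exists y0, y0 \in S by apply/card_gt0P; apply: leq_trans S3.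
have y0Y' := subsetP S1 _ y0S.
pose I' := [set i in I | ~~ e y0 i].
have SI : [disjoint S & I'].
  apply/pred0P => y /=; apply/negP => /andP[/(subsetP S1)/(subsetP Y'Y)].
  by rewrite !inE => /andP[/negbTE ->].
have hI' : (#|I| <= #|I'| + k0)%N.
  rewrite -(cardsID [set i | e y0 i] I) addnC; apply: leq_add.
    by apply: subset_leq_card; apply/subsetP => i; rewrite !inE => /andP[-> ->].
  have := tk y0 (subsetP Y'Y _ y0Y'); rewrite -sum1_count big_enum_cond.
  rewrite -sum1_card => /(leq_trans _); apply.
  by rewrite (eq_bigl (fun i => (i \in I) && e y0 i)) // => i; rewrite !inE.
have SY' y : y \in S -> y \in Y' by apply: subsetP.
have crossSI y i : y \in S -> i \in I' -> ~~ e y i.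
  move=> yS; rewrite inE => /andP[iI].
  by rewrite (htr y y0) ?SY' // mem_enum.
have : (#|S :|: I'| <= #|I|)%N.
  apply: Imax; apply/andP; split.
    apply/indP => x y; rewrite !in_setU => /orP[xS|xI] /orP[yS|yI].
    - exact: S2.
    - exact: crossSI.
    - by rewrite e_sym crossSI.
    - by move: xI yI; rewrite !inE => /andP[xI _] /andP[yI _]; apply: Iind.
  rewrite subUset; apply/andP; split; last first.
    by apply: subset_trans IX'; apply/subsetP => i; rewrite inE => /andP[].
  apply: subset_trans S1 _; apply: subset_trans Y'Y _.
  by rewrite /Y; apply: subset_trans (subsetDl _ _) (subsetDl _ _).
have := (leq_card_setU S I').2; rewrite SI => /eqP -> hle.
have := leq_trans (leq_add S3 (leqnn #|I'|)) hle.
by rewrite addSn addnC ltnNge hI'.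
Qed.
End Density.

(** * Sets where almost all vertices have many neighbours and non-neighbours *)
Section Rich.
Variable R : realType.

Definition nbrs (T : finType) (f : rel T) (x : T) (A : {set T}) : nat :=
  #|[set y in A | f x y]|.

Lemma nbrsU (T : finType) (f : rel T) x (A B : {set T}) : [disjoint A & B] ->
  nbrs f x (A :|: B) = (nbrs f x A + nbrs f x B)%N.
Proof.
move=> dAB; rewrite /nbrs.
have -> : [set y in A :|: B | f x y] = [set y in A | f x y] :|: [set y in B | f x y].
  by apply/setP => y; rewrite !inE andb_orl.
apply/eqP; rewrite (leq_card_setU _ _).2; apply: disjointWl (disjointWr _ dAB).
  by apply/subsetP => y; rewrite inE => /andP[].
by apply/subsetP => y; rewrite inE => /andP[].
Qed.

Lemma nbrs_le (T : finType) (f : rel T) x (A : {set T}) : (nbrs f x A <= #|A|)%N.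
Proof. by apply: subset_leq_card; apply/subsetP => y; rewrite inE => /andP[]. Qed.

Lemma expn_le m n k : (m <= n -> m ^ k <= n ^ k)%N.
Proof. by move=> h; case: k => // k; rewrite leq_exp2r. Qed.

Lemma exists_subset_card (T : finType) (A : {set T}) m : (m <= #|A|)%N ->
  exists2 Y : {set T}, Y \subset A & #|Y| = m.
Proof.
move=> hm; exists [set y in take m (enum A)].
  by apply/subsetP => y; rewrite inE => /mem_take; rewrite mem_enum.
rewrite cardsE; have /card_uniqP -> : uniq (take m (enum A)) by apply/take_uniq/enum_uniq.
by rewrite size_takel // -cardE.
Qed.

(** [A] consists of [p] batches of [r] vertices with few [f]-edges between them;
    the term [p * r ^ 2] is the trivial bound for the edges inside batches. *)
Definition thin_core (T : finType) (f : rel T) (eps : R) (p r : nat) (X A : {set T}) :=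
  [/\ [disjoint X & A], #|A| = (p * r)%N,
      {in X, forall w, (nbrs f w A)%:R <= 2 * eps * #|A|%:R} &
      (\sum_(x in A) nbrs f x A)%N%:R <= p%:R * r%:R ^+ 2 + 2 * eps * #|A|%:R ^+ 2].

Lemma thin_core_sub (T : finType) (f : rel T) eps p r (X X' A : {set T}) :
  X' \subset X -> thin_core f eps p r X A -> thin_core f eps p r X' A.
Proof.
move=> s [h1 h2 h3 h4]; split => //; first exact: disjointWl h1.
by move=> w /(subsetP s); apply: h3.
Qed.

(** The batch [Y] sends few edges to [W], so by Markov's inequality at least
    half of the vertices of [W] have few neighbours in [Y]; only those are kept. *)
Lemma thin_core_step (T : finType) (f : rel T) (eps : R) p r (X A Y W : {set T}) :
  symmetric f -> 0 < eps -> thin_core f eps p r X A ->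
  Y \subset X -> #|Y| = r -> W \subset X ->
  {in Y, forall y, (nbrs f y W)%:R < eps * #|W|%:R} ->
  exists X' : {set T}, [/\ X' \subset X,
    #|W|%:R / 2 - r%:R <= #|X'|%:R :> R & thin_core f eps p.+1 r X' (A :|: Y)].
Proof.
move=> f_sym eps0 [dXA cA hA eA] YX cY WX hY.
pose hv := [set w in W | 2 * eps * r%:R < (nbrs f w Y)%:R].
have dAY : [disjoint A & Y].
  by rewrite disjoint_sym; apply: disjointWl dXA.
have hhv : 2 * #|hv|%:R <= #|W|%:R :> R.
  have hs : (\sum_(w in W) nbrs f w Y)%N%:R <= r%:R * (eps * #|W|%:R).
    rewrite /nbrs sum_card_adj // natr_sum.
    have -> : r%:R * (eps * #|W|%:R) = \sum_(y in Y) (eps * #|W|%:R).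
      by rewrite sumr_const cY mulr_natl.
    by apply: ler_sum => y yY; apply: ltW; apply: hY.
  have := card_markov (2 * eps * r%:R) hs; rewrite -/hv.
  have [r0|r0] := posnP r.
    move=> _; have -> : #|hv| = 0%N; last by rewrite mulr0.
    apply: eq_card0 => w; rewrite !inE r0 mulr0.
    have := nbrs_le f w Y; rewrite cY r0 leqn0 => /eqP ->.
    by rewrite ltxx andbF.
  have er : 0 < eps * r%:R by rewrite mulr_gt0 // ltr0n.
  move=> h; rewrite -(ler_pM2l er); move: h; lra.
exists ((W :\: hv) :\: Y); split.
- by apply: subset_trans (subsetDl _ _) (subset_trans (subsetDl _ _) WX).
- have : (#|W| <= #|hv| + #|Y| + #|(W :\: hv) :\: Y|)%N.
    have sub : W \subset hv :|: Y :|: ((W :\: hv) :\: Y).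
      apply/subsetP => x xW; rewrite !inE xW /=.
      by case: (_ < _); case: (x \in Y).
    apply: leq_trans (subset_leq_card sub) _.
    by do 2 (apply: leq_trans (leq_card_setU _ _) _; rewrite leq_add2r).
  rewrite -(ler_nat R) !natrD cY; lra.
have cAY : #|A :|: Y| = (p.+1 * r)%N.
  have := (leq_card_setU A Y).2; rewrite dAY => /eqP ->.
  by rewrite cA cY mulSn addnC.
have cAr : (#|A|%:R : R) = p%:R * r%:R by rewrite cA natrM.
have cAYr : (#|A :|: Y|%:R : R) = p%:R * r%:R + r%:R.
  by rewrite cAY mulSn natrD natrM addrC.
have p0 : (0 : R) <= p%:R by []. have r0 : (0 : R) <= r%:R by [].
split => //.
- apply/pred0P => w /=; apply/negP; rewrite !inE => /andP[/andP[wY /andP[_ wW]] /orP[wA|]];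
    last by rewrite (negbTE wY).
  by have /pred0P /(_ w) /= := dXA; rewrite wA (subsetP WX _ wW).
- move=> w; rewrite !inE => /andP[_ /andP[hw wW]].
  rewrite nbrsU // natrD cAYr.
  have h1 := hA w (subsetP WX _ wW).
  have h2 : (nbrs f w Y)%:R <= 2 * eps * r%:R by move: hw; rewrite wW /= -leNgt.
  rewrite cAr in h1; lra.
- have dsum (g : T -> nat) : (\sum_(x in A :|: Y) g x = \sum_(x in A) g x + \sum_(x in Y) g x)%N.
    rewrite -bigU //; apply: eq_bigl => x; exact: in_setU.
  rewrite dsum.
  have -> : (\sum_(x in A) nbrs f x (A :|: Y) = \sum_(x in A) nbrs f x A + \sum_(x in Y) nbrs f x A)%N.
    rewrite -[X in (_ + X)%N](sum_card_adj A Y f_sym) -big_split /=.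
    by apply: eq_bigr => x _; rewrite nbrsU.
  have -> : (\sum_(x in Y) nbrs f x (A :|: Y) = \sum_(x in Y) nbrs f x A + \sum_(x in Y) nbrs f x Y)%N.
    by rewrite -big_split /=; apply: eq_bigr => x _; rewrite nbrsU.
  have hYA : (\sum_(x in Y) nbrs f x A)%N%:R <= r%:R * (2 * eps * #|A|%:R).
    rewrite natr_sum.
    have -> : r%:R * (2 * eps * #|A|%:R) = \sum_(y in Y) (2 * eps * #|A|%:R).
      by rewrite sumr_const cY mulr_natl.
    by apply: ler_sum => y yY; apply: hA; apply: (subsetP YX).
  have hYY : ((\sum_(x in Y) nbrs f x Y)%N%:R : R) <= r%:R * r%:R.
    rewrite -natrM ler_nat -[X in (_ <= X * _)%N]cY -sum_nat_const.
    by apply: leq_sum => y _; rewrite -cY nbrs_le.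
  rewrite !natrD cAYr -natr1; rewrite cAr in eA hYA.
  have er2 : 0 <= eps * r%:R ^+ 2 by rewrite mulr_ge0 ?sqr_ge0 // ltW.
  move: eA hYA hYY; set a := (\sum_(x in A) _)%N%:R; set bb := (\sum_(x in Y) nbrs f x A)%N%:R.
  set c := (\sum_(x in Y) nbrs f x Y)%N%:R; lra.
Qed.

(** If [X] fails for some [W], then [s + 1] vertices of [X] have few neighbours,
    or few non-neighbours, in [W]; put them aside as a batch and pass to [W].
    When all sets of size [c * #|T|] fail, this goes on for [2 * k] rounds, and
    then the batches put aside for one of the two reasons form a set, of size at
    least [s], on which the graph or its complement is too sparse for
    [sparse_density]. *)
Lemma rich_subset (K : nat) : exists2 eps : R, 0 < eps <= 1 &
  forall del : R, 0 < del <= 1 -> exists2 c : R, 0 < c & exists s0 : nat,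
  forall (T : finType) (e : rel T) (b s : nat),
  symmetric e -> irreflexive e ->
  (forall S : {set T}, homogeneous e S -> (#|S| < b)%N) ->
  (2 ^ b <= #|T| ^ K)%N -> (#|T| <= s ^ 8)%N -> (s * s <= #|T|)%N -> (s0 <= s)%N ->
  exists2 X : {set T}, c * #|T|%:R <= #|X|%:R &
  forall W : {set T}, W \subset X -> del * #|X|%:R <= #|W|%:R ->
    (#|[set v in X | ((nbrs e v W)%:R < eps * #|W|%:R)%R]| <= s)%N /\
    (#|[set v in X | ((nbrs (fun x y => ~~ e x y) v W)%:R < eps * #|W|%:R)%R]| <= s)%N.
Proof.
have [ep0 ep0_gt0 [m0 ES]] := sparse_density R (8 * K).
pose eps := Num.min 1 (ep0 / 8).
have eps0 : 0 < eps by rewrite lt_min ltr01 divr_gt0.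
have eps1 : eps <= 1 by rewrite ge_min lexx.
have epsE : eps <= ep0 / 8 by rewrite ge_min lexx orbT.
exists eps; first by rewrite eps0.
move=> del /andP[del0 del1].
pose k := (Num.truncn (2 / ep0)).+1.
have hk : 2 / ep0 <= k%:R by apply: ltW; apply: truncnS_gt.
pose c := (del / 4) ^+ (2 * k)%N.
have d40 : 0 < del / 4 by rewrite divr_gt0.
have c0 : 0 < c by rewrite exprn_gt0.
exists c => //.
pose s0 := maxn (maxn m0 1) (Num.truncn (8 / (del * c))).+1.
exists s0 => T e b s e_sym e_irr hom h2b hTs hsT hs.
have sm0 : (m0 <= s)%N by move: hs; rewrite /s0; lia.
have s1 : (1 <= s)%N by move: hs; rewrite /s0; lia.
have sbig : 8 / (del * c) <= s%:R.
  apply: le_trans (ltW (truncnS_gt _)) _; rewrite ler_nat.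
  by apply: leq_trans hs; rewrite /s0 leq_maxr.
pose good (X : {set T}) := forall W : {set T}, W \subset X -> del * #|X|%:R <= #|W|%:R ->
    (#|[set v in X | ((nbrs e v W)%:R < eps * #|W|%:R)%R]| <= s)%N /\
    (#|[set v in X | ((nbrs (fun x y => ~~ e x y) v W)%:R < eps * #|W|%:R)%R]| <= s)%N.
apply: contrapT => hno.
have nogood (X : {set T}) : c * #|T|%:R <= #|X|%:R -> ~ good X.
  by move=> h1 h2; apply: hno; exists X.
pose ne := (fun x y : T => ~~ e x y).
have ne_sym : symmetric ne by move=> x y; rewrite /ne e_sym.
have core0 (f : rel T) : thin_core f eps 0 s.+1 setT set0.
  split; rewrite ?cards0 ?mul0n ?big_set0 ?mul0r ?expr0n ?mulr0 ?addr0 //.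
    by rewrite -setI_eq0 setI0.
  by move=> w _; have := nbrs_le f w set0; rewrite cards0 leqn0 => /eqP ->.
have state j : (j <= 2 * k)%N -> exists (X A B : {set T}) (p q : nat),
  [/\ (p + q)%N = j, (del / 4) ^+ j * #|T|%:R <= #|X|%:R,
      thin_core e eps p s.+1 X A & thin_core ne eps q s.+1 X B].
  elim: j => [|j IH] hj.
    by exists setT, set0, set0, 0%N, 0%N; split; rewrite ?expr0 ?mul1r ?cardsT.
  have [|X [A [B [p [q [hpq hX hA hB]]]]]] := IH; first exact: ltnW.
  have cX : c * #|T|%:R <= #|X|%:R.
    apply: le_trans hX; rewrite ler_wpM2r // /c ler_wiXn2l //; [exact: ltW | by clear -del1; lra | exact: ltnW].
  have [W [WX cW hW]] : exists W : {set T}, [/\ W \subset X, del * #|X|%:R <= #|W|%:R &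
     (s < #|[set v in X | ((nbrs e v W)%:R < eps * #|W|%:R)%R]|)%N \/
     (s < #|[set v in X | ((nbrs ne v W)%:R < eps * #|W|%:R)%R]|)%N].
    apply: contrapT => hn; apply: (nogood X cX) => W WX cW.
    split; rewrite leqNgt; apply/negP => h; apply: hn; exists W; split => //; [by left|by right].
  have W4 : s.+1%:R <= #|W|%:R / 4 :> R.
    have hT : s%:R * s%:R <= (#|T|%:R : R) by rewrite -natrM ler_nat.
    have hdc : 0 < del * c by rewrite mulr_gt0.
    rewrite ler_pdivrMr // in sbig.
    have s1' : (1 : R) <= s%:R by rewrite ler1n.
    have h1 : del * (c * #|T|%:R) <= #|W|%:R by apply: le_trans cW; rewrite ler_pM2l.
    have h2 : 8 * s%:R <= (del * c) * (s%:R * s%:R) by nra.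
    have h3 : (del * c) * (s%:R * s%:R) <= (del * c) * #|T|%:R by rewrite ler_pM2l.
    rewrite -natr1; lra.
  have W4' : (del / 4) ^+ j.+1 * #|T|%:R <= #|W|%:R / 2 - s.+1%:R.
    rewrite exprS; have : del * ((del / 4) ^+ j * #|T|%:R) <= del * #|X|%:R by rewrite ler_pM2l.
    move: cW W4; lra.
  have pick (f : rel T) : (s < #|[set v in X | ((nbrs f v W)%:R < eps * #|W|%:R)%R]|)%N ->
     exists Y : {set T}, [/\ Y \subset X, #|Y| = s.+1 &
       {in Y, forall y, (nbrs f y W)%:R < eps * #|W|%:R}].
    move=> /exists_subset_card[Y YS cY]; exists Y; split => //.
      by apply: subset_trans YS _; apply/subsetP => v; rewrite inE => /andP[].
    by move=> y /(subsetP YS); rewrite inE => /andP[].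
  case: hW => /pick[Y [YX cY hY]].
    have [X' [h1 h2 h3]] := thin_core_step e_sym eps0 hA YX cY WX hY.
    exists X', (A :|: Y), B, p.+1, q; split => //.
    - by rewrite addSn hpq.
    - exact: le_trans h2.
    - exact: thin_core_sub hB.
  have [X' [h1 h2 h3]] := thin_core_step ne_sym eps0 hB YX cY WX hY.
  exists X', A, (B :|: Y), p, q.+1; split => //.
  - by rewrite addnS hpq.
  - exact: le_trans h2.
  - exact: thin_core_sub hA.
have final (f f' : rel T) p (X A : {set T}) : (k <= p)%N -> thin_core f eps p s.+1 X A ->
   symmetric f' -> irreflexive f' -> (forall x y, f' x y -> f x y) ->
   (forall S : {set T}, homogeneous f' S -> (#|S| < b)%N) -> False.
  move=> kp [_ cA _ hA] f'_sym f'_irr ff hom'.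
  have p1 : (0 < p)%N by apply: leq_trans kp.
  have As : (s <= #|A|)%N by rewrite cA; apply: leq_trans (leqnSn s) _; rewrite leq_pmull.
  have h1 := ES T f' b A f'_sym f'_irr hom' _ (leq_trans sm0 As).
  have {}h1 : ep0 * #|A|%:R ^+ 2 <= (\sum_(x in A) #|[set y in A | f' x y]|)%N%:R.
    apply: h1; apply: leq_trans h2b _; apply: leq_trans (_ : (s ^ 8) ^ K <= _)%N.
      exact: expn_le.
    by rewrite -expnM; apply: expn_le.
  have h2 : (\sum_(x in A) #|[set y in A | f' x y]| <= \sum_(x in A) nbrs f x A)%N.
    apply: leq_sum => x _; apply: subset_leq_card; apply/subsetP => y.
    by rewrite !inE => /andP[-> /ff ->].
  have h3 : ep0 * #|A|%:R ^+ 2 <= p%:R * s.+1%:R ^+ 2 + 2 * eps * #|A|%:R ^+ 2.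
    by apply: le_trans h1 (le_trans _ hA); rewrite ler_nat.
  have r0 : (0 : R) < s.+1%:R ^+ 2 by rewrite exprn_gt0 // ltr0n.
  have pk : (k%:R : R) <= p%:R by rewrite ler_nat.
  have p1' : (0 : R) < p%:R by rewrite ltr0n.
  move: h3; rewrite cA natrM exprMn; set r2 := s.+1%:R ^+ 2 in r0 *.
  have hp : 2 <= ep0 * p%:R.
    by rewrite mulrC -ler_pdivrMr //; apply: le_trans pk.
  have h4 : 2 * eps * (p%:R ^+ 2 * r2) <= ep0 / 4 * (p%:R ^+ 2 * r2).
    rewrite ler_wpM2r ?mulr_ge0 ?sqr_ge0 ?(ltW r0) //; lra.
  have h5 : 2 * (p%:R * r2) <= ep0 * p%:R * (p%:R * r2).
    by rewrite ler_wpM2r // mulr_ge0 // ltW.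
  have h6 : 0 < p%:R * r2 by rewrite mulr_gt0.
  move: h4 h5; lra.
have [X [A [B [p [q [hpq hX hA hB]]]]]] := state (2 * k)%N (leqnn _).
have [kp|kq] : (k <= p)%N \/ (k <= q)%N by move: hpq; clear; lia.
  exact: (final e e p X A kp hA).
apply: (final ne (fun x y => (x != y) && ~~ e x y) q X B kq hB) => //.
- by move=> x y; rewrite eq_sym e_sym.
- by move=> x; rewrite eqxx.
- by move=> x y /andP[].
- move=> S [hS|hS]; apply: hom.
    by right=> x y xS yS; have [->|/hS] := eqVneq x y; rewrite ?e_irr // => /(_ xS yS) /andP[].
  left=> x y xS yS xy; have := hS x y xS yS; by rewrite xy negbK.
Qed.
End Rich.

(** * Pairs of vertices whose exchange changes many degrees *)
Section Pairs.
Variables (R : realType) (T : finType) (e : rel T).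
Hypotheses (e_sym : symmetric e) (e_irr : irreflexive e).
Local Notation adj := (@adj R T e).

(** [eps ^+ 3 / 256 * u] is the least size of the sets [W] for which this is
    needed; they consist of the second entries of the pairs that a given vertex,
    or two given vertices, tell apart. *)
Definition rich (eps : R) (s u : nat) (X : {set T}) : Prop :=
  forall W A : seq T, uniq W -> uniq A -> {subset W <= X} -> {subset A <= X} ->
  eps ^+ 3 / 256 * u%:R <= (size W)%:R ->
  (count (fun v => (count (e v) W)%:R < eps * (size W)%:R)%R A <= s)%N /\
  (count (fun v => (count (fun y => ~~ e v y) W)%:R < eps * (size W)%:R)%R A <= s)%N.

(** In the double count of [r], an element of [A] contributes at most [size P],
    and less than [t] unless it is counted on the right. *)
Lemma heavy_count (I J : eqType) (A : seq I) (P : seq J) (r : I -> J -> bool) (a t : R) :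
  0 <= t -> {in P, forall p, a <= (count (r^~ p) A)%:R} ->
  (size P)%:R * a <=
    (count (fun v => t <= (count (r v) P)%:R)%R A)%:R * (size P)%:R + (size A)%:R * t.
Proof.
move=> t0 h.
have h1 : (size P)%:R * a <= \sum_(p <- P) (count (r^~ p) A)%:R.
  have -> : (size P)%:R * a = \sum_(p <- P) a.
    by rewrite big_const_seq count_predT iter_addr_0 mulr_natl.
  by rewrite big_seq [leRHS]big_seq; apply: ler_sum => p /h.
apply: le_trans h1 _.
have -> : \sum_(p <- P) (count (r^~ p) A)%:R = \sum_(v <- A) (count (r v) P)%:R :> R.
  rewrite -!natr_sum; congr _%:R.
  under eq_bigr do rewrite -sum1_count big_mkcond.
  by rewrite exchange_big /=; apply: eq_bigr => v _; rewrite -sum1_count [RHS]big_mkcond.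
elim: A {h} => [|v A IH]; first by rewrite big_nil /= !mul0r addr0.
rewrite big_cons /= natrD -natr1 !mulrDl mul1r.
have hc : (count (r v) P)%:R <= (size P)%:R :> R by rewrite ler_nat count_size.
case: (lerP t) => ht; [rewrite mul1r | rewrite mul0r]; lra.
Qed.

(* For a graph on n vertices, [q] is about n^(1/2), [s] about n^(1/4), and [u] is
   of order n, hence between [rho * q ^ 2] and [q ^ 2]. *)
Variables (eps rho : R) (s u q : nat) (X : {set T}).
Hypotheses (eps0 : 0 < eps) (eps1 : eps <= 1) (rho0 : 0 < rho) (rho1 : rho <= 1).
Hypotheses (hrich : rich eps s u X) (q0 : (0 < q)%N) (u0 : (0 < u)%N).
Hypotheses (rhou : rho * q%:R ^+ 2 <= u%:R) (uq : (u <= q ^ 2)%N).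

Let q0' : (0 : R) < q%:R. Proof. by rewrite ltr0n. Qed.
Let u0' : (0 : R) < u%:R. Proof. by rewrite ltr0n. Qed.

Definition bucket (x : R) : nat := Num.truncn (x / q%:R).

Lemma bucket_lt x B : 0 <= x <= B%:R * q%:R ^+ 2 -> (bucket x < (B * q).+1)%N.
Proof.
move=> /andP[h0 h1]; rewrite ltnS /bucket -(ler_nat R).
have h2 : 0 <= x / q%:R by rewrite divr_ge0.
have /andP[h3 _] := truncn_itv h2; apply: le_trans h3 _.
by rewrite ler_pdivrMr // natrM -mulrA -expr2.
Qed.

Lemma bucket_itv x : 0 <= x -> (bucket x)%:R * q%:R <= x <= (bucket x)%:R * q%:R + q%:R.
Proof.
move=> hx; have hx1 : 0 <= x / q%:R by rewrite divr_ge0.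
have /andP[a1 a2] := truncn_itv hx1.
move: a1 a2; rewrite -/(bucket x) -natr1 !ler_pdivlMr // !ltr_pdivrMr // mulrDl mul1r.
by move=> -> /ltW ->.
Qed.

Lemma bucket_eq x y : 0 <= x -> 0 <= y -> bucket x = bucket y -> `|x - y| <= q%:R.
Proof.
move=> /bucket_itv/andP[a1 a2] /bucket_itv/andP[b1 b2] h; rewrite h in a1 a2.
by rewrite ler_norml; apply/andP; split; lra.
Qed.

Definition splits (v : T) (p : T * T) : bool := ~~ e v p.1 && e v p.2.

(** A vertex [x] has [u] neighbours or [u] non-neighbours in [V].  By richness,
    all but [s] vertices [y] differ from [x] on an [eps]-fraction of them, so
    that the pair of [x] and [y], in one of its orders, splits [eps * u] vertices
    of [V].  Grouping by [D] makes the two values of [D] close. *)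
Lemma oriented_pairs (A V : seq T) (D : T -> R) k :
  uniq A -> {subset A <= X} -> uniq V -> {subset V <= X} -> size V = u.*2 ->
  {in A, forall v, 0 <= D v <= 8 * q%:R ^+ 2} ->
  ((8 * q).+1 * s.+1 + k.*2 <= size A)%N ->
  exists ps rest, [/\ size ps = k, perm_eq A (ends ps ++ rest) &
    {in ps, forall p, `|D p.1 - D p.2| <= q%:R /\
                      eps * u%:R <= (count (splits^~ p) V)%:R}].
Proof.
move=> uA AX uV VX sV hD hA.
pose good x y := eps * u%:R <= (count (splits^~ (x, y)) V)%:R.
have [||ps [rest [h1 h2 h3]]] := @extract_pairs _ A (fun v => bucket (D v)) good k (8 * q).+1 s uA _ _ hA.
- by move=> v /hD; apply: (@bucket_lt (D v) 8).
- move=> x xA.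
  have hsz : ((size [seq v <- V | ~~ e x v])%:R + (size [seq v <- V | e x v])%:R : R) = 2 * u%:R.
    rewrite -natrD !size_filter addnC (count_predC (e x) V) sV -mul2n natrM //.
  have del1 : eps ^+ 3 / 256 <= 1.
    have : eps ^+ 3 <= 1 by apply: exprn_ile1 => //; apply: ltW.
    lra.
  have use (W : seq T) : u%:R <= (size W)%:R :> R -> eps ^+ 3 / 256 * u%:R <= (size W)%:R.
    by move=> h; apply: le_trans h; rewrite ler_piMl.
  have [h|h] := lerP u%:R ((size [seq v <- V | ~~ e x v])%:R : R).
    have [h1 _] := hrich (filter_uniq _ uV) uA
      (fun v hv => VX v (mem_subseq (filter_subseq _ V) hv)) AX (use _ h).
    apply: leq_trans h1; apply: sub_count => y; rewrite negb_or => /andP[+ _].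
    rewrite /good -ltNge; apply: contraTT; rewrite -!leNgt => h2.
    apply: le_trans (le_trans h2 _); first by rewrite ler_pM2l.
    rewrite ler_nat count_filter; apply: sub_count => v /=.
    by rewrite /splits /= (e_sym v x) (e_sym y v) andbC.
  have h' : u%:R <= (size [seq v <- V | e x v])%:R :> R by lra.
  have [_ h1] := hrich (filter_uniq _ uV) uA
      (fun v hv => VX v (mem_subseq (filter_subseq _ V) hv)) AX (use _ h').
  apply: leq_trans h1; apply: sub_count => y; rewrite negb_or => /andP[_].
  rewrite /good -ltNge; apply: contraTT; rewrite -!leNgt => h2.
  apply: le_trans (le_trans h2 _); first by rewrite ler_pM2l.
  rewrite ler_nat count_filter; apply: sub_count => v /=.
  by rewrite /splits /= (e_sym v x) (e_sym y v).
exists ps, rest; split => // p pp; have [h4 h5] := h3 p pp; split; last first.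
  by move: h4; rewrite /good /splits; case: (p).
have pin v : v \in ends ps -> v \in A by move=> hv; rewrite (perm_mem h2) mem_cat hv.
have [p1 p2] := ends_mem pp.
have /andP[d1 _] := hD _ (pin _ p1); have /andP[d2 _] := hD _ (pin _ p2).
exact: bucket_eq.
Qed.

Lemma perm_uniq_ends (A : seq T) ps rest : uniq A -> perm_eq A (ends ps ++ rest) ->
  [/\ uniq (ends ps), uniq rest & {subset rest <= A}].
Proof.
move=> uA h; move: uA; rewrite (perm_uniq h) cat_uniq => /and3P[h1 _ h3]; split => //.
by move=> v hv; rewrite (perm_mem h) mem_cat hv orbT.
Qed.

Lemma uniq_snd ps (P : pred (T * T)) : uniq (ends ps) ->
  uniq [seq p.2 | p <- ps & P p].
Proof.
elim: ps => //= p ps IH; rewrite inE negb_or => /and3P[_ h2 /IH h3].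
case: (P p) => //=; rewrite h3 andbT; apply: contra h2 => /mapP[p' + ->].
by rewrite mem_filter => /andP[_ /ends_mem[]].
Qed.

(** [I] is the source of randomness and [B] what it influences.  Many vertices
    [x] split a proportion of order [eps] of the pairs of [I]; for such an [x],
    almost all [y] are non-adjacent to an [eps]-fraction of the second entries
    of the pairs that it splits, and for those the
    difference of adjacencies to [y] and to [x] varies along the pair.  The
    vertices left over are paired in [L] in the order of [D]. *)
Lemma responsive_pairs (A : seq T) (D : T -> R) k :
  eps * u%:R / 32 <= k%:R -> k%:R <= eps * u%:R / 16 ->
  (((8 * q).+1 * s.+1)%N%:R <= eps * u%:R / 8) ->
  uniq A -> {subset A <= X} -> size A = u.*2 ->
  {in A, forall v, 0 <= D v <= 8 * q%:R ^+ 2} ->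
  exists I B L : seq (T * T),
   [/\ perm_eq A (ends I ++ ends B ++ ends L), size I = k /\ size B = k,
      {in I ++ B, forall p, `|D p.1 - D p.2| <= q%:R},
      \sum_(p <- L) (D p.1 - D p.2) ^+ 2 <= (8 * q%:R ^+ 2) ^+ 2 &
      {in B, forall b, eps ^+ 2 * k%:R / 4 <=
        (count (fun p => adj b.2 p.1 - adj b.1 p.1 != adj b.2 p.2 - adj b.1 p.2)%R I)%:R}].
Proof.
move=> k_lo k_hi hbig uA AX sA hD.
have eu : eps * u%:R <= u%:R by rewrite ler_piMl.
have eu0 : 0 < eps * u%:R by rewrite mulr_gt0.
have [|I [rest [sI pI hI]]] := @oriented_pairs A A D k uA AX uA AX sA hD.
  rewrite sA -(ler_nat R) natrD -!mul2n !natrM; move: hbig; rewrite natrM; lra.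
have [uI ur rA] := perm_uniq_ends uA pI.
have k0 : 0 < k%:R :> R by apply: lt_le_trans k_lo; rewrite divr_gt0.
pose t : R := eps * k%:R / 4.
have t0 : 0 <= t by rewrite divr_ge0 // mulr_ge0 // ltW.
pose resp v := t <= (count (splits v) I)%:R.
have hresp : eps * u%:R / 2 <= (count resp A)%:R.
  have := @heavy_count _ _ A I splits (eps * u%:R) t t0 (fun p hp => (hI p hp).2).
  rewrite -/resp sI sA -mul2n natrM => h.
  rewrite -(ler_pM2r k0); move: h; rewrite /t; lra.
pose A2 := filter resp rest.
have uA2 : uniq A2 by apply: filter_uniq.
have sA2 : {subset A2 <= A} by move=> v; rewrite mem_filter => /andP[_ /rA].
have A2big : eps * u%:R * 3 / 8 <= (size A2)%:R.
  have : (count resp A <= k.*2 + size A2)%N.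
    rewrite (permP pI) count_cat size_filter leq_add2r -sI -size_ends; exact: count_size.
  rewrite -(ler_nat R) natrD -mul2n natrM; lra.
pose good x y := eps ^+ 2 * k%:R / 4 <=
  (count (fun p => adj y p.1 - adj x p.1 != adj y p.2 - adj x p.2)%R I)%:R.
have [|||B [rest2 [sB pB hB]]] := @extract_pairs _ A2 (fun v => bucket (D v)) good k (8 * q).+1 s uA2.
- by move=> v /sA2/hD; apply: (@bucket_lt (D v) 8).
- move=> x; rewrite mem_filter => /andP[rx _].
  pose W := [seq p.2 | p <- I & splits x p].
  have sW : (size W)%:R = (count (splits x) I)%:R :> R by rewrite size_map size_filter.
  have WX : {subset W <= X}.
    move=> v /mapP[p]; rewrite mem_filter => /andP[_ /ends_mem[_ pI2]] ->.
    by apply: AX; rewrite (perm_mem pI) mem_cat pI2.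
  have hW : eps ^+ 3 / 256 * u%:R <= (size W)%:R.
    rewrite sW; apply: le_trans rx; rewrite /t.
    have e2 : eps ^+ 2 <= 1 by apply: exprn_ile1 => //; exact: ltW.
    have h1 : eps * (eps * u%:R / 32) <= eps * k%:R by rewrite ler_pM2l.
    have h2 : eps ^+ 3 * u%:R <= eps ^+ 2 * u%:R.
      by rewrite ler_pM2r // exprS ler_piMl // exprn_ge0 // ltW.
    have h3 : 0 <= eps ^+ 3 * u%:R by rewrite mulr_ge0 // exprn_ge0 // ltW.
    move: h1 h2 h3; lra.
  have [_ h1] := hrich (uniq_snd _ uI) uA2 WX (fun v hv => AX v (sA2 v hv)) hW.
  apply: leq_trans h1; apply: sub_count => y; rewrite negb_or => /andP[+ _].
  rewrite /good -ltNge; apply: contraTT; rewrite -!leNgt => h2.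
  apply: le_trans (le_trans h2 _).
    by move: rx; rewrite sW /resp /t => h; rewrite expr2 -!mulrA ler_pM2l // mulrA.
  rewrite ler_nat count_map count_filter; apply: sub_count => p /=.
  rewrite /splits /adj => /andP[/negbTE -> /andP[/negbTE -> ->]].
  by apply/eqP; case: (e y p.1) => /=; lra.
- rewrite -(ler_nat R) natrD -mul2n (natrM _ 2 k); move: hbig A2big k_hi; lra.
have [uB ur2 r2A] := perm_uniq_ends uA2 pB.
have pA2 : exists rest3, perm_eq rest (A2 ++ rest3).
  by exists (filter (predC resp) rest); rewrite perm_sym perm_filterC.
have [rest3 p3] := pA2.
pose Lf := rest2 ++ rest3.
have pAll : perm_eq A (ends I ++ ends B ++ Lf).
  apply: perm_trans pI _; rewrite perm_cat2l; apply: perm_trans p3 _.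
  by rewrite /Lf catA perm_cat2r.
have sL : size Lf = (u - k - k).*2.
  move: (perm_size pAll); rewrite !size_cat !size_ends sA sI sB -size_cat -/Lf.
  by move: (size Lf) => z; clear; lia.
have LA : {subset Lf <= A}.
  by move=> v hv; rewrite (perm_mem pAll) mem_cat mem_cat hv !orbT.
have [|L pL hL] := @sorted_pairs R T Lf D (u - k - k)%N 0 (8 * q%:R ^+ 2) sL _ (fun v hv => hD v (LA v hv)).
  by rewrite mulr_ge0 // exprn_ge0.
exists I, B, L; split => //.
- by apply: perm_trans pAll _; rewrite !perm_cat2l.
- move=> p; rewrite mem_cat => /orP[/hI[] //|pB'].
  have [_ hb] := hB p pB'; have [p1 p2] := ends_mem pB'.
  have inA v : v \in ends B -> v \in A.
    by move=> hv; rewrite (perm_mem pAll) !mem_cat hv orbT.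
  have /andP[d1 _] := hD _ (inA _ p1); have /andP[d2 _] := hD _ (inA _ p2).
  exact: bucket_eq.
- by move: hL; rewrite subr0.
- by move=> b /hB[].
Qed.
End Pairs.

(** * Sweeping a long interval of edge counts by bounded steps *)
Section Coarse.
Variables (R : realType) (T : finType) (e : rel T).
Hypotheses (e_sym : symmetric e) (e_irr : irreflexive e).
Local Notation adj := (@adj R T e).
Local Notation deg := (@deg R T e).
Local Notation en := (@en R T e).

Lemma Ex_attained_le (U : eqType) (ps : seq (U * U)) (f : seq U -> R) :
  exists2 l, sel ps l & f l <= Ex ps f.
Proof.
have [l h1 h2] := Ex_attained ps (fun l => - f l).
by exists l => //; move: h2; rewrite ExN lerN2.
Qed.

Lemma int_gap (z : int) : `|z| <= 4 ->
  exists2 n : nat, (n <= 4)%N & `|z%:~R| = n%:R :> R.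
Proof. by move=> h; exists (absz z); [lia | rewrite -intr_norm -abszE]. Qed.

Lemma adj_int x y : adj x y = ((e x y)%:Z)%:~R.
Proof. by []. Qed.

(** The gain from replacing [b.1] by [b.2] is a sum over the chosen vertices,
    with integral terms whose differences are at most 4. *)
Lemma gain_anticoncentration (I : seq (T * T)) (b : T * T) (a r y : R) :
  0 <= r -> 0 < y ->
  4 * y ^+ 2 <=
    (count (fun p => adj b.2 p.1 - adj b.1 p.1 != adj b.2 p.2 - adj b.1 p.2)%R I)%:R ->
  Ex I (fun l => (`|a + (deg l b.2 - deg l b.1)| < r)%R%:R) <= (2 * r + 1) / y.
Proof.
move=> r0 y0 hc.
have -> : Ex I (fun l => (`|a + (deg l b.2 - deg l b.1)| < r)%R%:R) =
  Ex I (fun l => (`|a + \sum_(v <- l) (adj b.2 v - adj b.1 v)| < r)%R%:R) :> R.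
  by apply: eq_Ex => l _; rewrite /deg -sumrB.
apply: anticoncentration => // p _.
rewrite !adj_int -!intrB; apply: int_gap.
by case: (e b.2 p.1); case: (e b.1 p.1); case: (e b.2 p.2); case: (e b.1 p.2).
Qed.

(** The edges between [l1] and [l2] add the same amount to both degree sums, so
    the difference of two quadratic quantities becomes linear. *)
Lemma en_opposite (w : T -> R) (l1 l2 E : seq T) : perm_eq (l1 ++ l2) E ->
  en w l1 - en w l2 = \sum_(v <- l1) (w v + deg E v / 2) - \sum_(v <- l2) (w v + deg E v / 2).
Proof.
move=> h.
have hE v : deg E v = deg l1 v + deg l2 v by rewrite -(deg_perm R e v h) deg_cat.
rewrite /en !(eq_bigr _ (fun v _ => congr1 (fun x => w v + x / 2) (hE v))).
rewrite !big_split /= -!mulr_suml !big_split /= (deg_sumC R e_sym l1 l2); lra.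
Qed.

Lemma sel_map (B : seq (T * T)) (g : T * T -> T) :
  {in B, forall p, g p = p.1 \/ g p = p.2} -> sel B (map g B).
Proof.
elim: B => //= p B IH h; rewrite sel_cons IH ?andbT.
  by case: (h p (mem_head _ _)) => ->; rewrite eqxx ?orbT.
by move=> p' hp; apply: h; rewrite inE hp orbT.
Qed.

Lemma perm_choice_ends (B : seq (T * T)) (c : T * T -> bool) :
  perm_eq (map (fun b => if c b then b.2 else b.1) B ++
           map (fun b => if c b then b.1 else b.2) B) (ends B).
Proof.
apply/permP => P; elim: B => //= p B <-; rewrite !count_cat /=.
by case: (c p); lia.
Qed.

Definition interp (g0 g1 : T * T -> T) (B : seq (T * T)) (k : nat) : seq T :=
  map g1 (take k B) ++ map g0 (drop k B).

Lemma sel_interp g0 g1 B k :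
  {in B, forall p, g0 p = p.1 \/ g0 p = p.2} ->
  {in B, forall p, g1 p = p.1 \/ g1 p = p.2} -> sel B (interp g0 g1 B k).
Proof.
move=> h0 h1; rewrite -[X in sel X _](cat_take_drop k B); apply: sel_cat; apply: sel_map => p hp.
  by apply: h1; apply: mem_take hp.
by apply: h0; apply: mem_drop hp.
Qed.

Lemma interp_step g0 g1 B k x0 : (k < size B)%N ->
  perm_eq (g0 (nth x0 B k) :: interp g0 g1 B k.+1) (g1 (nth x0 B k) :: interp g0 g1 B k).
Proof.
move=> hk; rewrite /interp (take_nth x0 hk) (drop_nth x0 hk) map_rcons /=.
rewrite cat_rcons; set a := g1 _; set b := g0 _; set l := map _ _; set l' := map _ _.
by apply/permP => P; rewrite /= !count_cat /=; ring.
Qed.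

Variables (eps rho : R) (s u q : nat) (X : {set T}).
Hypotheses (eps0 : 0 < eps) (eps1 : eps <= 1) (rho0 : 0 < rho) (rho1 : rho <= 1).
Hypotheses (hrich : rich e eps s u X) (q0 : (0 < q)%N) (u0 : (0 < u)%N).
Hypotheses (rhou : rho * q%:R ^+ 2 <= u%:R) (uq : (u <= q ^ 2)%N).
Hypothesis hbig : ((8 * q).+1 * s.+1)%N%:R <= eps * u%:R / 8.
Variable kk : nat.
Hypotheses (k_lo : eps * u%:R / 32 <= kk%:R) (k_hi : kk%:R <= eps * u%:R / 16).

Let lam : R := eps ^+ 2 * rho / 32.
Hypothesis lamq : 8 <= lam * q%:R.

Let q0' : (0 : R) < q%:R. Proof. by rewrite ltr0n. Qed.
Let u0' : (0 : R) < u%:R. Proof. by rewrite ltr0n. Qed.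
Let lam0 : 0 < lam. Proof. by rewrite divr_gt0 // mulr_gt0 // exprn_gt0. Qed.

(** So [y = lam * q] is admissible in [anticoncentration] when [I] comes from
    [responsive_pairs], or from the weaker count of pairs told apart by two
    vertices of [V]. *)
Lemma lam_count_weak (n : R) : eps ^+ 4 * u%:R / 256 <= n -> 4 * (lam * q%:R) ^+ 2 <= n.
Proof.
move=> h; apply: le_trans h.
have h1 : eps ^+ 4 * (rho * (rho * q%:R ^+ 2)) <= eps ^+ 4 * u%:R.
  rewrite ler_pM2l ?exprn_gt0 //; apply: le_trans rhou.
  by rewrite ler_piMl // mulr_ge0 ?exprn_ge0 // ltW.
have -> : 4 * (lam * q%:R) ^+ 2 = eps ^+ 4 * (rho * (rho * q%:R ^+ 2)) / 256.
  by rewrite /lam; field.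
lra.
Qed.

Lemma lam_count (n : R) : eps ^+ 2 * kk%:R / 4 <= n -> 4 * (lam * q%:R) ^+ 2 <= n.
Proof.
move=> h; apply: lam_count_weak; apply: le_trans h.
have h1 : eps ^+ 2 * (eps * u%:R / 32) <= eps ^+ 2 * kk%:R by rewrite ler_pM2l // exprn_gt0.
have h2 : eps ^+ 4 * u%:R <= eps ^+ 3 * u%:R.
  by rewrite ler_pM2r // (exprS eps 3) ler_piMl // exprn_ge0 // ltW.
have h3 : 0 < eps ^+ 3 * u%:R by rewrite mulr_gt0 // exprn_gt0.
have h4 : eps ^+ 2 * (eps * u%:R / 32) = eps ^+ 3 * u%:R / 32 by ring.
rewrite h4 in h1; lra.
Qed.

(** By anticoncentration, some choice in [I] makes the difference of [W] of order
    [q] along half of the pairs of [B].  Taking everywhere in [B] the entry with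
    the larger [W], or everywhere the other one, gives edge counts that differ by
    the sum of these differences ([en_opposite]), which is of order [q ^ 3];
    [Z] passes from the second to the first one pair at a time. *)
Lemma coarse_path (A : seq T) (w : T -> R) :
  uniq A -> {subset A <= X} -> size A = u.*2 -> (forall v, 0 <= w v <= 4 * q%:R ^+ 2) ->
  exists (m : nat) (Z : nat -> seq T),
   [/\ forall k, [/\ uniq (Z k), size (Z k) = u & {subset Z k <= A}],
       forall k, (k < m)%N -> `|en w (Z k.+1) - en w (Z k)| <= 6 * q%:R ^+ 2 &
       eps * rho * lam / 1024 * q%:R ^+ 3 <= en w (Z m) - en w (Z 0%N)].
Proof.
move=> uA AX sA hw.
have h0 : {in A, forall v, 0 <= (fun=> 0 : R) v <= 8 * q%:R ^+ 2}.
  by move=> v _; rewrite lexx mulr_ge0 // exprn_ge0.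
have [I [B [L [pA [sI sB] _ _ hB]]]] :=
  responsive_pairs e_sym eps0 eps1 hrich q0 u0 k_lo k_hi hbig uA AX sA h0.
pose fL := map fst L.
pose W l v := w v + deg (l ++ fL) v + deg (ends B) v / 2.
pose r := lam / 16 * q%:R.
have r0 : 0 <= r by rewrite mulr_ge0 // ltW // divr_gt0.
have k0 : 0 < kk%:R :> R by apply: lt_le_trans k_lo; rewrite divr_gt0 // mulr_gt0.
have [l0 sl0 hl0] := Ex_attained_le I (fun l => \sum_(b <- B) (`|W l b.2 - W l b.1| < r)%R%:R).
have {}hl0 : \sum_(b <- B) (`|W l0 b.2 - W l0 b.1| < r)%R%:R <= kk%:R / 2 :> R.
  apply: (le_trans hl0); rewrite Ex_sum.
  have -> : kk%:R / 2 = \sum_(b <- B) (2^-1 : R).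
    by rewrite big_const_seq count_predT iter_addr_0 sB mulr_natl.
  rewrite big_seq [leRHS]big_seq; apply: ler_sum => b bB.
  pose a := w b.2 + deg fL b.2 + deg (ends B) b.2 / 2 - (w b.1 + deg fL b.1 + deg (ends B) b.1 / 2).
  have -> : Ex I (fun l => (`|W l b.2 - W l b.1| < r)%R%:R) =
     Ex I (fun l => (`|a + (deg l b.2 - deg l b.1)| < r)%R%:R) :> R.
    apply: eq_Ex => l _; congr ((`|_| < r)%R%:R).
    by rewrite /W /a !deg_cat; lra.
  have y0 : 0 < lam * q%:R by rewrite mulr_gt0.
  apply: le_trans (gain_anticoncentration _ r0 y0 (lam_count (hB b bB))) _.
  rewrite ler_pdivrMr // /r; move: lamq; lra.
pose hi (b : T * T) := if W l0 b.1 <= W l0 b.2 then b.2 else b.1.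
pose lo (b : T * T) := if W l0 b.1 <= W l0 b.2 then b.1 else b.2.
have hi12 b : hi b = b.1 \/ hi b = b.2 by rewrite /hi; case: ifP; [right|left].
have lo12 b : lo b = b.1 \/ lo b = b.2 by rewrite /lo; case: ifP; [left|right].
have hilo b : W l0 (hi b) - W l0 (lo b) = `|W l0 b.2 - W l0 b.1|.
  rewrite /hi /lo; case: ifP => h; first by rewrite ger0_norm // subr_ge0.
  by rewrite ltr0_norm ?opprB // subr_lt0 ltNge h.
have bigsum : kk%:R / 2 * r <= \sum_(b <- B) (W l0 (hi b) - W l0 (lo b)).
  have h1 : \sum_(b <- B) (r - r * (`|W l0 b.2 - W l0 b.1| < r)%R%:R)
     <= \sum_(b <- B) (W l0 (hi b) - W l0 (lo b)).
    apply: ler_sum => b _; rewrite hilo; case: ltP => h; first by rewrite mulr1 subrr.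
    by rewrite mulr0 subr0.
  apply: le_trans h1.
  have -> : \sum_(b <- B) (r - r * (`|W l0 b.2 - W l0 b.1| < r)%R%:R) =
      kk%:R * r - r * \sum_(b <- B) (`|W l0 b.2 - W l0 b.1| < r)%R%:R.
    by rewrite sumrB mulr_sumr big_const_seq count_predT iter_addr_0 sB mulr_natl.
  have := ler_wpM2l r0 hl0; lra.
pose Z k := (l0 ++ fL) ++ interp lo hi B k.
have selZ k : sel (I ++ L ++ B) (Z k).
  rewrite /Z -catA; apply: sel_cat => //; apply: sel_cat.
    by apply: sel_map => p _; left.
  by apply: sel_interp => p _.
have sZ k : size (Z k) = u.
  rewrite (sel_size (selZ k)) !size_cat.
  by move: (perm_size pA); rewrite !size_cat !size_ends sA; move: (size L); clear; lia.
have pA' : perm_eq A (ends (I ++ L ++ B)).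
  apply: perm_trans pA _; rewrite !ends_cat perm_cat2l perm_catC; exact: perm_refl.
exists kk, Z; split.
- move=> k; split => //.
    by apply: (subseq_uniq (sel_subseq (selZ k))); rewrite -(perm_uniq pA').
  by move=> v /(mem_subseq (sel_subseq (selZ k))); rewrite (perm_mem pA').
- move=> k hk; have [x0 _] : exists x0 : T * T, x0 \in B.
    case: B sB hk {hB pA selZ pA' hl0 bigsum W fL hi lo hi12 lo12 hilo Z sZ} => [<- //|b B' _ _].
    by exists b; rewrite mem_head.
  rewrite -sB in hk.
  have hp : perm_eq (lo (nth x0 B k) :: Z k.+1) (hi (nth x0 B k) :: Z k).
    apply/permP => P; rewrite /Z /= !(count_cat P (l0 ++ fL)) addnCA [RHS]addnCA.
    by congr (_ + _)%N; have /permP /(_ P) := interp_step lo hi x0 hk.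
  have := en_swap e_sym e_irr w hp.
  set x := lo _; set y := hi _ => ->.
  have /andP[w1 w2] := hw x; have /andP[w3 w4] := hw y.
  have d1 := deg_ge0 R e (Z k) x; have d2 := deg_ge0 R e (Z k) y.
  have d3 := deg_le R e (Z k) x; have d4 := deg_le R e (Z k) y.
  have a1 := adj_ge0 R e x y; have a2 := adj_le1 R e x y.
  have uq' : u%:R <= q%:R ^+ 2 :> R by rewrite -natrX ler_nat.
  have q1 : 1 <= q%:R ^+ 2 :> R by rewrite exprn_ege1 // ler1n.
  rewrite sZ in d3 d4; rewrite ler_norml; apply/andP; split; lra.
- have base f : en w (Z f) = en w (l0 ++ fL) + en (fun v => w v + deg (l0 ++ fL) v) (interp lo hi B f).
    by rewrite /Z en_cat.
  rewrite !base opprD addrACA subrr add0r.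
  have pE : perm_eq (map hi B ++ map lo B) (ends B) by apply: perm_choice_ends.
  have -> : interp lo hi B kk = map hi B by rewrite /interp -sB take_size drop_size cats0.
  have -> : interp lo hi B 0 = map lo B by rewrite /interp take0 drop0.
  rewrite (en_opposite _ pE) !big_map -sumrB -/(W l0).
  apply: le_trans (_ : kk%:R / 2 * r <= _); last exact: bigsum.
  have h1 : eps * (rho * q%:R ^+ 2) <= eps * u%:R by rewrite ler_pM2l.
  have h2 : 0 <= lam * q%:R by rewrite mulr_ge0 // ltW.
  have h3 : eps * (rho * q%:R ^+ 2) / 32 * (lam * q%:R) <= kk%:R * (lam * q%:R).
    by apply: ler_wpM2r => //; move: k_lo; lra.
  rewrite /r; move: h3; lra.
Qed.
End Coarse.

(** * Climbing by steps of the order of the square root *)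
Section Selections.
Variables (R : realType) (T : eqType).
Implicit Types ps : seq (T * T).

Lemma count_ends (P : pred T) ps : count P (ends ps) = (\sum_(p <- ps) (P p.1 + P p.2))%N.
Proof. by elim: ps => [|p ps IH]; rewrite ?big_nil //= big_cons IH addnA. Qed.

Lemma perm_ends ps ps' : perm_eq ps ps' -> perm_eq (ends ps) (ends ps').
Proof. by move=> h; apply/permP => P; rewrite !count_ends; apply: perm_big. Qed.

Lemma uniq_ends ps : uniq (ends ps) -> uniq ps.
Proof.
elim: ps => //= p ps IH; rewrite inE negb_or => /and3P[/andP[_ h1] _ /IH ->].
by rewrite andbT; apply: contra h1 => /ends_mem[].
Qed.

Definition chosen (l : seq T) (p : T * T) : T := if p.1 \in l then p.1 else p.2.
Definition other (l : seq T) (p : T * T) : T := if p.1 \in l then p.2 else p.1.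

Lemma sel_chosen ps l : uniq (ends ps) -> sel ps l -> l = map (chosen l) ps.
Proof.
elim: ps l => [|p ps IH] [|v l] //= /and3P[h1 h2 h3]; rewrite sel_cons => /andP[hv hl].
move: h1; rewrite inE negb_or => /andP[h0 h1].
have hsub x : x \in l -> x \in ends ps by apply: mem_subseq; apply: sel_subseq.
congr cons.
  rewrite /chosen inE; case/orP: hv => /eqP ->; first by rewrite eqxx.
  by rewrite (negbTE h0) /=; case: (boolP (p.1 \in l)) => // /hsub; rewrite (negbTE h1).
rewrite {1}(IH l h3 hl); apply/eq_in_map => p' hp'; rewrite /chosen inE.
have [h4 _] := ends_mem hp'.
suff -> : (p'.1 == v) = false by [].
by apply/eqP => hE; move: h4; rewrite hE; case/orP: hv => /eqP ->; rewrite ?(negbTE h1) ?(negbTE h2).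
Qed.

Lemma perm_split_subseq ps F : uniq ps -> subseq F ps ->
  exists rest, perm_eq ps (F ++ rest).
Proof.
move=> ups hF; exists (filter (predC (mem F)) ps).
have h : perm_eq (filter (mem F) ps ++ filter (predC (mem F)) ps) ps by rewrite perm_filterC.
rewrite perm_sym; apply: (perm_trans _ h).
rewrite perm_cat2r; apply: uniq_perm; rewrite ?filter_uniq ?(subseq_uniq hF) //.
by move=> x; rewrite mem_filter /=; case: (boolP (x \in F)) => //= /(mem_subseq hF).
Qed.
End Selections.

Section Climb.
Variables (R : realType) (T : finType) (e : rel T).
Hypotheses (e_sym : symmetric e) (e_irr : irreflexive e).
Local Notation adj := (@adj R T e).
Local Notation deg := (@deg R T e).
Local Notation en := (@en R T e).
Local Notation avg := (@avg R T e).

Lemma avg_perm w (A B : seq T) : perm_eq A B -> avg w A = avg w B.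
Proof.
move=> h; rewrite /avg (perm_big _ h) /= (perm_big _ h) /=.
by congr (_ + _ / 8); apply: eq_bigr => v _; apply: deg_perm.
Qed.

Lemma deg_interp g0 g1 (F : seq (T * T)) k v :
  `|deg (interp g0 g1 F k) v - deg (map g0 F) v| <= k%:R.
Proof.
have -> : deg (map g0 F) v = deg (map g0 (take k F)) v + deg (map g0 (drop k F)) v.
  by rewrite -deg_cat -map_cat cat_take_drop.
rewrite /interp deg_cat opprD addrACA subrr addr0.
have h (g : T * T -> T) : 0 <= deg (map g (take k F)) v <= k%:R.
  rewrite deg_ge0; apply: le_trans (deg_le _ _ _ _) _.
  by rewrite ler_nat size_map size_take; case: ltnP => // /ltnW.
have /andP[h1 h2] := h g0; have /andP[h3 h4] := h g1.
by rewrite ler_norml; apply/andP; split; lra.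
Qed.

Lemma Ex_gain2 (ps : seq (T * T)) (b : T * T) (a d : R) :
  `|a + (deg (ends ps) b.2 - deg (ends ps) b.1) / 2| <= d ->
  Ex ps (fun l => (a + (deg l b.2 - deg l b.1)) ^+ 2) <= d ^+ 2 + (size ps)%:R.
Proof.
move=> hd.
have -> : Ex ps (fun l => (a + (deg l b.2 - deg l b.1)) ^+ 2) =
  Ex ps (fun l => (a + \sum_(v <- l) (adj b.2 v - adj b.1 v)) ^+ 2).
  by apply: eq_Ex => l _; rewrite /deg -sumrB.
rewrite Ex_linear2 sumrB -/(deg _ _); apply: lerD.
  by rewrite -real_normK ?num_real // ler_pXn2r ?nnegrE // (le_trans _ hd).
rewrite ler_pdivrMr // -sum1_size natr_sum mulr_suml; apply: ler_sum => p _.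
have h : -2 <= adj b.2 p.1 - adj b.1 p.1 - (adj b.2 p.2 - adj b.1 p.2) <= 2.
  have := (adj_ge0 R e b.2 p.1, adj_ge0 R e b.1 p.1, adj_ge0 R e b.2 p.2, adj_ge0 R e b.1 p.2,
    adj_le1 R e b.2 p.1, adj_le1 R e b.1 p.1, adj_le1 R e b.2 p.2, adj_le1 R e b.1 p.2).
  by move=> [[[[[[[? ?] ?] ?] ?] ?] ?] ?]; apply/andP; split; lra.
move: h; set z := _ - _; move=> /andP[h1 h2]; rewrite mul1r; nra.
Qed.

Variables (eps rho : R) (s u q : nat) (X : {set T}).
Hypotheses (eps0 : 0 < eps) (eps1 : eps <= 1) (rho0 : 0 < rho) (rho1 : rho <= 1).
Hypotheses (hrich : rich e eps s u X) (q0 : (0 < q)%N) (u0 : (0 < u)%N).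
Hypotheses (rhou : rho * q%:R ^+ 2 <= u%:R) (uq : (u <= q ^ 2)%N).
Hypothesis hbig : ((8 * q).+1 * s.+1)%N%:R <= eps * u%:R / 8.
Variable kk : nat.
Hypotheses (k_lo : eps * u%:R / 32 <= kk%:R) (k_hi : kk%:R <= eps * u%:R / 16).

Let lam : R := eps ^+ 2 * rho / 32.
Hypothesis lamq : 64 <= lam * q%:R.

Let q0' : (0 : R) < q%:R. Proof. by rewrite ltr0n. Qed.
Let u0' : (0 : R) < u%:R. Proof. by rewrite ltr0n. Qed.
Let lam0 : 0 < lam. Proof. by rewrite divr_gt0 // mulr_gt0 // exprn_gt0. Qed.

Lemma lam_le1 : lam <= 1 / 32.
Proof.
have : eps ^+ 2 * rho <= 1 by rewrite mulr_ile1 ?exprn_ge0 ?exprn_ile1 // ltW.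
rewrite /lam; lra.
Qed.

(** For a random selection three things are likely: the gain from an exchange in
    a pair of [B] is not below [r] (anticoncentration); it is not above [4 * q]
    (second moment, as [D] is almost constant on the pair); the number of edges
    is within [O(q ^ 2)] of its mean ([Ex_en2]).  One potential measures all
    three. *)
Lemma good_selection (A : seq T) (w : T -> R) (m : nat) :
  uniq A -> {subset A <= X} -> size A = u.*2 -> (forall v, 0 <= w v <= 4 * q%:R ^+ 2) ->
  (0 < m)%N -> (4 * m <= kk)%N ->
  exists (ps : seq (T * T)) (l : seq T) (F : seq (T * T)),
   [/\ perm_eq A (ends ps), sel ps l,
       `|en w l - avg w A| <= 10 * q%:R ^+ 2,
       subseq F ps /\ (2 * m <= size F)%N &
       {in F, forall b, lam / 16 * q%:R <= `|w b.2 - w b.1 + (deg l b.2 - deg l b.1)| <= 4 * q%:R}].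
Proof.
move=> uA AX sA hw m0 hm.
pose D v := w v + deg A v / 2.
have uq' : u%:R <= q%:R ^+ 2 :> R by rewrite -natrX ler_nat.
have hD : {in A, forall v, 0 <= D v <= 8 * q%:R ^+ 2}.
  move=> v _; rewrite /D; have /andP[h1 h2] := hw v.
  have h3 := deg_ge0 R e A v; have h4 := deg_le R e A v.
  by rewrite sA -mul2n natrM in h4; apply/andP; split; lra.
have [I [B [L [pA [sI sB] hIB hL hB]]]] :=
  responsive_pairs e_sym eps0 eps1 hrich q0 u0 k_lo k_hi hbig uA AX sA hD.
pose B0 := take (4 * m) B.
have sB0 : size B0 = (4 * m)%N by rewrite size_takel // sB.
pose pre := B ++ L.
pose ps := pre ++ I.
have pAps : perm_eq A (ends ps).
  by apply: perm_trans pA _; rewrite /ps /pre !ends_cat perm_catC.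
have sps : size ps = u.
  by apply: double_inj; rewrite -size_ends -(perm_size pAps) sA.
pose g (b : T * T) (l : seq T) := w b.2 - w b.1 + (deg l b.2 - deg l b.1).
pose r := lam / 16 * q%:R.
have r0 : 0 <= r by rewrite mulr_ge0 // ltW // divr_gt0.
pose E := Ex ps (fun l => en w l).
pose M : R := (4 * m)%:R.
have M0 : 0 < M by rewrite ltr0n muln_gt0.
(* If [pot l <= M / 2], then at most half of [B0] has a gain outside
   [[r, 4 * q]], and [en w l] is within [9 * q ^ 2] of [E]. *)
pose pot l := \sum_(b <- B0) ((`|g b l| < r)%R%:R + (16 * q%:R ^+ 2)^-1 * g b l ^+ 2)
   + M * (144 * q%:R ^+ 4)^-1 * (- E + en w l) ^+ 2.
have q4 : (0 : R) < q%:R ^+ 4 by rewrite exprn_gt0.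
have q2 : (0 : R) < q%:R ^+ 2 by rewrite exprn_gt0.
have q42 : q%:R ^+ 4 = q%:R ^+ 2 * q%:R ^+ 2 :> R by rewrite -exprD.
have ExA b : b \in B0 -> Ex ps (fun l => (`|g b l| < r)%R%:R) <= 1 / 4 :> R.
  move=> bB0; have bB : b \in B by apply: mem_take bB0.
  rewrite /ps Ex_cat -[leRHS](ExC pre); apply: le_Ex => l1 _.
  have -> : Ex I (fun l2 => (`|g b (l1 ++ l2)| < r)%R%:R) =
     Ex I (fun l2 => (`|(w b.2 - w b.1 + (deg l1 b.2 - deg l1 b.1)) + (deg l2 b.2 - deg l2 b.1)| < r)%R%:R) :> R.
    apply: eq_Ex => l2 _; congr ((`|_| < r)%R%:R).
    by rewrite /g !deg_cat; lra.
  have y0 : 0 < lam * q%:R by rewrite mulr_gt0.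
  apply: le_trans (gain_anticoncentration _ r0 y0 _) _.
    exact: (lam_count eps0 eps1 rho0 rho1 u0 rhou k_lo (hB b bB)).
  rewrite ler_pdivrMr // /r; move: lamq; lra.
have dA v : deg (ends ps) v = deg A v by apply: deg_perm; rewrite perm_sym.
have ExB b : b \in B0 -> Ex ps (fun l => g b l ^+ 2) <= 2 * q%:R ^+ 2.
  move=> bB0; have bB : b \in B by apply: mem_take bB0.
  apply: le_trans (Ex_gain2 (d := q%:R) _) _; last by rewrite sps; lra.
  rewrite !dA; have := hIB b; rewrite mem_cat bB orbT => /(_ isT).
  by rewrite distrC /D; congr (`|_| <= _); lra.
have ExC' : Ex ps (fun l => (- E + en w l) ^+ 2) <= 17 * q%:R ^+ 4.
  apply: le_trans (Ex_en2 e_sym e_irr w ps (- E)) _.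
  rewrite -/E addNr expr0n add0r sps.
  have -> : \sum_(p <- ps) (w p.1 + deg (ends ps) p.1 / 2 - (w p.2 + deg (ends ps) p.2 / 2)) ^+ 2
     = \sum_(p <- ps) (D p.1 - D p.2) ^+ 2.
    by apply: eq_bigr => p _; rewrite !dA.
  have small (P : seq (T * T)) : {subset P <= I ++ B} ->
      \sum_(p <- P) (D p.1 - D p.2) ^+ 2 <= (size P)%:R * q%:R ^+ 2.
    move=> hP; rewrite -sum1_size natr_sum mulr_suml big_seq [leRHS]big_seq.
    apply: ler_sum => p /hP/hIB hp; rewrite mul1r -real_normK ?num_real //.
    by rewrite ler_pXn2r ?nnegrE.
  rewrite /ps /pre !big_cat /=.
  have hI := small I (fun x hx => mem_subseq (prefix_subseq I B) hx).
  have hBs := small B (fun x hx => mem_subseq (suffix_subseq I B) hx).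
  rewrite sI in hI; rewrite sB in hBs.
  have ku : kk%:R * q%:R ^+ 2 <= u%:R * q%:R ^+ 2 :> R.
    rewrite ler_pM2r //; apply: le_trans k_hi _.
    have : eps * u%:R <= u%:R by rewrite ler_piMl.
    by move: u0'; lra.
  have uu : u%:R * q%:R ^+ 2 <= q%:R ^+ 2 * q%:R ^+ 2 :> R by rewrite ler_pM2r.
  have u2 : u%:R ^+ 2 <= q%:R ^+ 2 * q%:R ^+ 2 :> R by rewrite expr2; apply: ler_pM.
  move: hL hI hBs; rewrite q42 exprMn -natrX expr2; lra.
have Expot : Ex ps pot <= M / 2.
  rewrite /pot ExD Ex_sum ExZ.
  have h1 : \sum_(b <- B0) Ex ps (fun l => (`|g b l| < r)%R%:R + (16 * q%:R ^+ 2)^-1 * g b l ^+ 2)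
      <= \sum_(b <- B0) (3 / 8).
    rewrite big_seq [leRHS]big_seq; apply: ler_sum => b bB0; rewrite ExD ExZ.
    have i0 : 0 <= (16 * q%:R ^+ 2)^-1 :> R by rewrite invr_ge0 mulr_ge0 // ltW.
    have := ler_wpM2l i0 (ExB b bB0).
    rewrite (_ : (16 * q%:R ^+ 2)^-1 * (2 * q%:R ^+ 2) = 1 / 8).
      by have := ExA b bB0; lra.
    by field; rewrite gt_eqF.
  rewrite big_const_seq count_predT iter_addr_0 sB0 -[_ *+ (4 * m)]mulr_natr -/M in h1.
  have h2 : M * (144 * q%:R ^+ 4)^-1 * Ex ps (fun l => (- E + en w l) ^+ 2) <= M * (1 / 8).
    rewrite -mulrA ler_pM2l //.
    apply: le_trans (_ : (144 * q%:R ^+ 4)^-1 * (17 * q%:R ^+ 4) <= _).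
      by rewrite ler_pM2l // invr_gt0 mulr_gt0.
    rewrite (_ : _ * _ = 17 / 144); first by lra.
    by field; rewrite gt_eqF.
  by apply: (le_trans (lerD h1 h2)); lra.
have [l sl hl] := Ex_attained_le ps pot.
have {}hl : pot l <= M / 2 by apply: le_trans hl Expot.
have t1 : 0 <= \sum_(b <- B0) ((`|g b l| < r)%R%:R + (16 * q%:R ^+ 2)^-1 * g b l ^+ 2).
  apply: sumr_ge0 => b _; rewrite addr_ge0 // mulr_ge0 ?sqr_ge0 // invr_ge0 mulr_ge0 //; exact: ltW.
have t2 : 0 <= M * (144 * q%:R ^+ 4)^-1 * (- E + en w l) ^+ 2.
  apply: mulr_ge0 (sqr_ge0 _); apply: mulr_ge0; first exact: ltW.
  by rewrite invr_ge0 mulr_ge0 // ltW.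
have hanchor : `|en w l - E| <= 9 * q%:R ^+ 2.
  have h1 : M * ((144 * q%:R ^+ 4)^-1 * (- E + en w l) ^+ 2) <= M * (1 / 2).
    rewrite [leLHS]mulrA; move: hl t1; rewrite /pot; set X1 := \sum_(_ <- _) _; set X2 := _ * _ ^+ 2; lra.
  rewrite ler_pM2l // mulrC ler_pdivrMr ?mulr_gt0 // in h1.
  rewrite -(@ler_pXn2r _ 2) ?nnegrE ?mulr_ge0 ?exprn_ge0 // real_normK ?num_real //.
  by rewrite addrC; apply: le_trans h1 _; rewrite q42; nra.
pose ok b := (r <= `|g b l| <= 4 * q%:R).
have hbad : (count (predC ok) B0)%:R <= M / 2.
  apply: le_trans (_ : \sum_(b <- B0) ((`|g b l| < r)%R%:R + (16 * q%:R ^+ 2)^-1 * g b l ^+ 2) <= _);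
    last by move: hl; rewrite /pot; lra.
  rewrite -sum1_count natr_sum big_mkcond /=; apply: ler_sum => b _.
  have gg : 0 <= (16 * q%:R ^+ 2)^-1 * g b l ^+ 2.
    by rewrite mulr_ge0 ?sqr_ge0 // invr_ge0 mulr_ge0 // ltW.
  rewrite /ok negb_and -!ltNge; case: ltP => h /=; first by rewrite lerDl.
  case: ltP => h' /=; last by rewrite add0r.
  rewrite add0r mulrC ler_pdivlMr ?mulr_gt0 // mul1r.
  have -> : 16 * q%:R ^+ 2 = (4 * q%:R) ^+ 2 :> R by ring.
  rewrite -[leRHS]real_normK ?num_real // ler_pXn2r ?nnegrE ?mulr_ge0 //; exact: ltW.
exists ps, l, (filter ok B0); split => //.
- have hE : E = avg w A - (\sum_(p <- ps) adj p.1 p.2) / 4.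
    by rewrite /E Ex_en // (avg_perm w pAps).
  have h1 : 0 <= \sum_(p <- ps) adj p.1 p.2 <= u%:R.
    apply/andP; split; first by apply: sumr_ge0 => p _; apply: adj_ge0.
    by rewrite -sps -sum1_size natr_sum; apply: ler_sum => p _; apply: adj_le1.
  move: h1 hanchor => /andP[h1 h2]; rewrite hE !ler_norml => /andP[h3 h4].
  by apply/andP; split; lra.
- split.
    apply: subseq_trans (filter_subseq _ _) _; rewrite /ps /pre -catA.
    by apply: subseq_trans (prefix_subseq _ _); apply: take_subseq.
  move: hbad; rewrite size_filter => hbad.
  have : (size B0)%:R = (count ok B0)%:R + (count (predC ok) B0)%:R :> R.
    by rewrite -natrD count_predC.
  rewrite sB0 -/M => hs.
  have : (2 * m)%:R <= (count ok B0)%:R :> R.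
    have MM : M = 2 * (2 * m)%:R by rewrite /M !natrM; lra.
    lra.
  by rewrite ler_nat.
- by move=> b; rewrite mem_filter => /andP[].
Qed.

(** Of the [2 * m] pairs with a gain of order [q], some [m] have gains of one
    sign.  Exchange them in turn: a gain is altered by the earlier exchanges by
    at most [m], which is small compared with [lam * q].  If the gains are
    negative, the path is followed backwards. *)
Lemma local_climb (A : seq T) (w : T -> R) (m : nat) :
  uniq A -> {subset A <= X} -> size A = u.*2 -> (forall v, 0 <= w v <= 4 * q%:R ^+ 2) ->
  (0 < m)%N -> (4 * m <= kk)%N -> m%:R <= lam / 128 * q%:R ->
  exists S : nat -> seq T,
   [/\ forall k, (k <= m)%N -> [/\ uniq (S k), size (S k) = u & {subset S k <= A}],
       forall k, (k < m)%N -> exists x y, perm_eq (x :: S k.+1) (y :: S k),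
       forall k, (k < m)%N ->
         lam / 32 * q%:R <= en w (S k.+1) - en w (S k) <= 6 * q%:R &
       `|en w (S 0%N) - avg w A| <= 16 * q%:R ^+ 2].
Proof.
move=> uA AX sA hw m0 hm hmq.
have [ps [l [F0 [pA sl hanc [F0ps F0s] hF0]]]] := good_selection uA AX sA hw m0 hm.
have uends : uniq (ends ps) by rewrite -(perm_uniq pA).
have lE := sel_chosen uends sl.
pose c := chosen l; pose o := other l.
pose sg b := w (o b) - w (c b) + (deg l (o b) - deg l (c b)).
pose r := lam / 16 * q%:R.
have sgE b : b \in F0 -> r <= sg b <= 4 * q%:R \/ r <= - sg b <= 4 * q%:R.
  move=> /hF0; rewrite -/r.
  have [->|->] : sg b = w b.2 - w b.1 + (deg l b.2 - deg l b.1) \/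
     sg b = - (w b.2 - w b.1 + (deg l b.2 - deg l b.1)).
  - by rewrite /sg /o /c /other /chosen; case: ifP => _; [left|right]; lra.
  - by set z := _ + _; case: (ger0P z) => _; [left|right].
  - by set z := _ + _; rewrite opprK; case: (ger0P z) => _; [right|left].
have [sgn [F [Fs FF0 hF]]] : exists (sgn : bool) (F : seq (T * T)),
    [/\ size F = m, subseq F F0 & {in F, forall b, r <= (-1) ^+ sgn * sg b <= 4 * q%:R}].
  pose P b := r <= sg b <= 4 * q%:R.
  have [h|h] := leqP m (count P F0).
    exists false, (take m (filter P F0)); split.
    - by rewrite size_takel // size_filter.
    - exact: subseq_trans (take_subseq _ _) (filter_subseq _ _).
    - by move=> b /mem_take; rewrite mem_filter expr0 mul1r => /andP[].
  exists true, (take m (filter (predC P) F0)); split.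
  - rewrite size_takel // size_filter; move: h F0s; rewrite -(count_predC P F0).
    by move: (count P F0) (count (predC P) F0); clear; lia.
  - exact: subseq_trans (take_subseq _ _) (filter_subseq _ _).
  - move=> b /mem_take; rewrite mem_filter expr1 mulN1r => /andP[/negP hP /sgE[]//].
have [rest prest] := perm_split_subseq (uniq_ends uends) (subseq_trans FF0 F0ps).
pose S k := interp c o F k ++ map c rest.
have c12 b : c b = b.1 \/ c b = b.2 by rewrite /c /chosen; case: ifP; [left|right].
have o12 b : o b = b.1 \/ o b = b.2 by rewrite /o /other; case: ifP; [right|left].
have selS k : sel (F ++ rest) (S k).
  by apply: sel_cat; [apply: sel_interp => b _ | apply: sel_map => b _].
have pends := perm_ends prest.
have pA' : perm_eq A (ends (F ++ rest)) := perm_trans pA pends.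
have SP k : [/\ uniq (S k), size (S k) = u & {subset S k <= A}].
  split.
  - by apply: (subseq_uniq (sel_subseq (selS k))); rewrite -(perm_uniq pA').
  - by rewrite (sel_size (selS k)); apply: double_inj; rewrite -size_ends -(perm_size pA') sA.
  - by move=> v /(mem_subseq (sel_subseq (selS k))); rewrite (perm_mem pA').
have pS0 : perm_eq l (S 0%N).
  by rewrite lE /S /interp take0 drop0 /= -map_cat perm_map.
have x0 : T * T.
  case: F Fs {hF FF0 prest S selS pends pA' SP pS0} => [m0'|b _ _]; last exact: b.
  by move: m0; rewrite -m0'.
have hperm k : (k < m)%N -> perm_eq (c (nth x0 F k) :: S k.+1) (o (nth x0 F k) :: S k).
  move=> hk; rewrite /S -!cat_cons perm_cat2r; apply: interp_step; by rewrite Fs.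
have lq : lam * q%:R <= q%:R / 32 by have := ler_wpM2r (ltW q0') lam_le1; lra.
have mq : m%:R <= q%:R :> R by move: hmq lq q0'; lra.
have hdeg k v : (k <= m)%N -> `|deg (S k) v - deg l v| <= m%:R.
  move=> hk; rewrite (deg_perm R e v pS0) /S (deg_cat R e (interp c o F k)).
  rewrite (deg_cat R e (interp c o F 0)) opprD addrACA subrr addr0.
  have -> : interp c o F 0 = map c F by rewrite /interp take0 drop0.
  by apply: le_trans (deg_interp _ _ _ _ _) _; rewrite ler_nat.
have hstep k : (k < m)%N ->
    lam / 32 * q%:R <= (-1) ^+ sgn * (en w (S k.+1) - en w (S k)) <= 6 * q%:R.
  move=> hk; rewrite (en_swap e_sym e_irr w (hperm k hk)).
  set b := nth x0 F k; have bF : b \in F by apply: mem_nth; rewrite Fs.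
  have := hdeg k (o b) (ltnW hk); have := hdeg k (c b) (ltnW hk).
  rewrite !ler_norml => /andP[h1 h2] /andP[h3 h4].
  have := hF b bF; rewrite /sg => /andP[h5 h6].
  have a1 := adj_ge0 R e (c b) (o b); have a2 := adj_le1 R e (c b) (o b).
  have q1 : 1 <= q%:R :> R by rewrite ler1n.
  move: h5 h6 lamq hmq; rewrite /r.
  case: (sgn); rewrite ?expr1 ?expr0 ?mulN1r ?mul1r => h5 h6 h7 h8; apply/andP; split; lra.
have hS0 : `|en w (S 0%N) - avg w A| <= 10 * q%:R ^+ 2.
  by rewrite -(en_perm e w pS0).
have q1 : 1 <= q%:R :> R by rewrite ler1n.
case: sgn hF hstep => hF hstep; last first.
  exists S; split => //.
  - by move=> k hk; exists (c (nth x0 F k)), (o (nth x0 F k)); apply: hperm.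
  - by move=> k /hstep; rewrite expr0 mul1r.
  - by apply: le_trans hS0 _; nra.
exists (fun k => S (m - k)%N); split => //.
- move=> k hk; have hk' : (m - k.+1 < m)%N by move: hk; clear; lia.
  have := hperm _ hk'; rewrite (_ : (m - k.+1).+1 = (m - k)%N); last by move: hk; clear; lia.
  by rewrite perm_sym; eexists; eexists; eassumption.
- move=> k hk; have hk' : (m - k.+1 < m)%N by move: hk; clear; lia.
  have := hstep _ hk'; rewrite (_ : (m - k.+1).+1 = (m - k)%N); last by move: hk; clear; lia.
  by rewrite expr1 mulN1r opprB.
- rewrite subn0.
  have htot k : (k <= m)%N -> `|en w (S k) - en w (S 0%N)| <= k%:R * (6 * q%:R).
    elim: k => [|k IH] hk; first by rewrite subrr normr0 mul0r.
    have /andP[h1 h2] := hstep k hk; have := IH (ltnW hk).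
    rewrite expr1 mulN1r in h1 h2; rewrite -natr1 !ler_norml => /andP[h3 h4].
    have lq0 : 0 <= lam * q%:R by rewrite mulr_ge0 // ltW.
    by apply/andP; split; lra.
  have := htot m (leqnn m); have := hS0; rewrite !ler_norml => /andP[h1 h2] /andP[h3 h4].
  have mqq : m%:R * q%:R <= q%:R ^+ 2 :> R by rewrite expr2 ler_pM2r.
  by apply/andP; split; lra.
Qed.
End Climb.

(** * Pairs of additional vertices told apart by a random selection *)
Section FinePairs.
Variables (R : realType) (T : finType) (e : rel T).
Hypotheses (e_sym : symmetric e) (e_irr : irreflexive e).
Local Notation adj := (@adj R T e).
Local Notation deg := (@deg R T e).

Lemma count_allpairs (a b : pred T) (V W : seq T) :
  count (fun pi : T * T => a pi.1 && b pi.2) [seq (x, y) | x <- V, y <- W] =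
  (count a V * count b W)%N.
Proof.
elim: V => //= x V IH; rewrite count_cat count_map IH mulnDl; congr (_ + _)%N.
rewrite (eq_count (a2 := fun y => a x && b y)) //.
by case: (a x) => /=; rewrite ?mul1n ?mul0n //; apply: count_pred0.
Qed.

Lemma count_diag (V : seq T) : uniq V ->
  (count (fun pi : T * T => pi.1 == pi.2) [seq (x, y) | x <- V, y <- V] <= size V)%N.
Proof.
move=> uV; have h (W : seq T) :
   (count (fun pi : T * T => pi.1 == pi.2) [seq (x, y) | x <- W, y <- V] <= size W)%N.
  elim: W => //= x W IH; rewrite count_cat count_map -add1n leq_add //.
  rewrite (eq_count (a2 := pred1 x)); last by move=> y /=; rewrite eq_sym.
  by rewrite count_uniq_mem // leq_b1.
exact: h.
Qed.

Definition pair_adj (pi : T * T) (v : T) : R := adj pi.1 v + adj pi.2 v.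

Variables (eps rho : R) (s u q : nat) (X : {set T}).
Hypotheses (eps0 : 0 < eps) (eps1 : eps <= 1) (rho0 : 0 < rho) (rho1 : rho <= 1).
Hypotheses (hrich : rich e eps s u X) (q0 : (0 < q)%N) (u0 : (0 < u)%N).
Hypotheses (rhou : rho * q%:R ^+ 2 <= u%:R) (uq : (u <= q ^ 2)%N).
Hypothesis hbig : ((8 * q).+1 * s.+1)%N%:R <= eps * u%:R / 8.
Variable kk : nat.
Hypotheses (k_lo : eps * u%:R / 32 <= kk%:R) (k_hi : kk%:R <= eps * u%:R / 16).
Hypothesis sq : (s * s <= q)%N.

Let lam : R := eps ^+ 2 * rho / 32.
Hypothesis hq : 200 <= eps ^+ 2 * rho ^+ 2 * q%:R.

Let q0' : (0 : R) < q%:R. Proof. by rewrite ltr0n. Qed.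
Let u0' : (0 : R) < u%:R. Proof. by rewrite ltr0n. Qed.

(** Enough variation for the combined degrees of [pi] and [pi'] into a random
    selection from [I] to be equal with probability [O(1 / q)] only. *)
Definition separated (I : seq (T * T)) (pi pi' : T * T) : bool :=
  4 * (lam * q%:R) ^+ 2 <=
  (count (fun p => pair_adj pi p.1 - pair_adj pi' p.1 != pair_adj pi p.2 - pair_adj pi' p.2)%R I)%:R.

(** By double counting, a positive proportion of the pairs in [V * V] is such
    that both entries split many common pairs of [I]; by the pigeonhole
    principle [g * (s * s).+1] of them have [D pi.1 + D pi.2] in one window of
    length [q].  Such a [pi] fails to be separated from [pi'] only if both
    entries of [pi'] are exceptional, in the sense of richness, for the second
    entries of the pairs that [pi] splits.  So each [pi] conflicts with at most
    [s * s] others, and [g] pairs can be chosen greedily. *)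
Lemma fine_pairs (A V : seq T) (D : T -> R) (g : nat) :
  uniq A -> {subset A <= X} -> size A = u.*2 ->
  uniq V -> {subset V <= X} -> size V = u.*2 ->
  (forall v, 0 <= D v <= 5 * q%:R ^+ 2) -> g%:R <= q%:R :> R ->
  exists (I L Pi : seq (T * T)) (theta : R),
   [/\ perm_eq A (ends (L ++ I)),
      \sum_(p <- L ++ I) (D p.1 - D p.2) ^+ 2 <= 65 * q%:R ^+ 4,
      0 <= theta <= 10 * q%:R ^+ 2,
      [/\ size Pi = g, uniq Pi & pairwise (separated I) Pi] &
      {in Pi, forall pi, [/\ pi.1 \in V, pi.2 \in V, pi.1 != pi.2 &
                            theta <= D pi.1 + D pi.2 <= theta + q%:R]}].
Proof.
move=> uA AX sA uV VX sV hD gq.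
have eu : eps * u%:R <= u%:R by rewrite ler_piMl // ltW.
have eu0 : 0 < eps * u%:R by rewrite mulr_gt0.
have k0 : 0 < kk%:R :> R by apply: lt_le_trans k_lo; rewrite divr_gt0.
have uq' : u%:R <= q%:R ^+ 2 :> R by rewrite -natrX ler_nat.
have q1 : 1 <= q%:R :> R by rewrite ler1n.
have hD8 : {in A, forall v, 0 <= D v <= 8 * q%:R ^+ 2}.
  move=> v _; have /andP[-> h] := hD v; apply: le_trans h _.
  by rewrite ler_pM2r ?exprn_gt0 //; lra.
have hA : ((8 * q).+1 * s.+1 + kk.*2 <= size A)%N.
  rewrite sA -(ler_nat R) natrD -!mul2n (natrM _ 2 kk) (natrM _ 2 u).
  by move: hbig k_hi eu u0'; lra.
have [I [rest [sI pI hI]]] := oriented_pairs e_sym eps0 eps1 hrich q0 uA AX uV VX sV hD8 hA.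
have [uI ur rA] := perm_uniq_ends uA pI.
have srest : size rest = (u - kk).*2.
  move: (perm_size pI); rewrite size_cat size_ends sA sI; clear; lia.
have qq0 : (0 : R) <= 8 * q%:R ^+ 2 by rewrite mulr_ge0 ?exprn_ge0.
have [L pL hL] := sorted_pairs srest qq0 (fun v hv => hD8 v (rA v hv)).
pose VV := [seq (x, y) | x <- V, y <- V].
have uVV : uniq VV by apply: allpairs_uniq => // -[? ?] [? ?] _ _ [-> ->].
pose both (pi p : T * T) := splits e pi.1 p && splits e pi.2 p.
pose t : R := kk%:R * eps ^+ 2 / 8.
have t0 : 0 <= t by rewrite divr_ge0 // mulr_ge0 // exprn_ge0 // ltW.
pose heavy pi := t <= (count (both pi) I)%:R.
have hheavy : eps ^+ 2 * u%:R ^+ 2 / 2 <= (count heavy VV)%:R.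
  have hc : {in I, forall p, (eps * u%:R) ^+ 2 <= (count (both^~ p) VV)%:R}.
    move=> p /hI[_ hp]; rewrite (count_allpairs (splits e ^~ p) (splits e ^~ p)) natrM expr2; apply: ler_pM => //; exact: ltW.
  have := @heavy_count R _ _ VV I both ((eps * u%:R) ^+ 2) t t0 hc.
  rewrite -/heavy sI size_allpairs sV -mul2n !natrM => h'.
  rewrite -(ler_pM2r k0); move: h'; rewrite /t exprMn; lra.
pose P1 := [seq pi <- VV | heavy pi && (pi.1 != pi.2)].
have hP1 : eps ^+ 2 * u%:R ^+ 2 / 2 - 2 * u%:R <= (size P1)%:R.
  have : (count heavy VV <= size P1 + size V)%N.
    rewrite size_filter; apply: leq_trans (leq_add (leqnn _) (count_diag uV)).
    rewrite -/VV; elim: (VV) => //= pi W IH; move: IH.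
    by case: (heavy pi); case: (_ == _) => /=; clear; lia.
  rewrite -(ler_nat R) natrD sV -mul2n natrM; move: hheavy; lra.
have uP1 : uniq P1 by apply: filter_uniq.
pose D2 (pi : T * T) := D pi.1 + D pi.2.
have hD2 pi : 0 <= D2 pi <= 10%:R * q%:R ^+ 2.
  by have /andP[? ?] := hD pi.1; have /andP[? ?] := hD pi.2; rewrite /D2; apply/andP; split; lra.
pose M := (g * (s * s).+1)%N.
have hM : ((10 * q).+1 * M < size P1)%N.
  rewrite -(ltr_nat R); apply: lt_le_trans hP1.
  have h1 : (((10 * q).+1 * M)%N%:R : R) <= 11 * q%:R * (q%:R * (2 * q%:R)).
    rewrite natrM; apply: ler_pM => //.
      by rewrite -natr1 natrM; lra.
    rewrite /M natrM; apply: ler_pM => //.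
    have : (s * s)%:R <= q%:R :> R by rewrite ler_nat.
    by rewrite -natr1; lra.
  apply: le_lt_trans h1 _.
  have h2 : eps ^+ 2 * (rho * q%:R ^+ 2) ^+ 2 <= eps ^+ 2 * u%:R ^+ 2.
    rewrite ler_pM2l ?exprn_gt0 // ler_pXn2r ?nnegrE // ?mulr_ge0 ?exprn_ge0 // ltW //.
  have h3 : 200 * q%:R ^+ 3 <= eps ^+ 2 * (rho * q%:R ^+ 2) ^+ 2.
    have -> : eps ^+ 2 * (rho * q%:R ^+ 2) ^+ 2 = eps ^+ 2 * rho ^+ 2 * q%:R * q%:R ^+ 3 by ring.
    by rewrite ler_pM2r // exprn_gt0.
  have h4 : q%:R ^+ 2 <= q%:R ^+ 3 :> R by rewrite ler_weXn2l.
  have h5 : 0 < q%:R ^+ 3 :> R by rewrite exprn_gt0.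
  have -> : 11 * q%:R * (q%:R * (2 * q%:R)) = 22 * q%:R ^+ 3 :> R by ring.
  lra.
have [j hj] : exists j, (M < count (fun pi => bucket q (D2 pi) == j) P1)%N.
  by apply: pigeonhole hM => pi _; apply: (@bucket_lt R q q0 (D2 pi) 10).
pose P2 := [seq pi <- P1 | bucket q (D2 pi) == j].
have uP2 : uniq P2 by apply: filter_uniq.
have memP2 pi : pi \in P2 -> [/\ pi.1 \in V, pi.2 \in V, pi.1 != pi.2, heavy pi & bucket q (D2 pi) = j].
  rewrite !mem_filter => /and3P[/eqP h1 /andP[h2 h3] /allpairsP[[x y] [/= hx hy hxy]]].
  by rewrite hxy in h1 h2 h3 *.
have hconf : {in P2, forall pi, (count (fun pi' => ~~ separated I pi pi') P2 <= s * s)%N}.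
  move=> pi /memP2[v1 v2 _ hv _].
  pose W := [seq p.2 | p <- I & both pi p].
  have sW : (size W)%:R = (count (both pi) I)%:R :> R by rewrite size_map size_filter.
  have WX : {subset W <= X}.
    move=> v /mapP[p]; rewrite mem_filter => /andP[_ /ends_mem[_ pI2]] ->.
    by apply: AX; rewrite (perm_mem pI) mem_cat pI2.
  have e3u : eps ^+ 3 * u%:R / 256 <= t.
    have : eps ^+ 2 * (eps * u%:R / 32) <= eps ^+ 2 * kk%:R by rewrite ler_pM2l // exprn_gt0.
    have -> : eps ^+ 2 * (eps * u%:R / 32) = eps ^+ 3 * u%:R / 32 by ring.
    rewrite /t; lra.
  have hW : eps ^+ 3 / 256 * u%:R <= (size W)%:R.
    by rewrite sW mulrAC; apply: le_trans hv.
  have [_ h1] := hrich (uniq_snd _ uI) uV WX VX hW.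
  pose Exc := [seq y <- V | ((count (fun z => ~~ e y z) W)%:R < eps * (size W)%:R)%R].
  have sExc : (size Exc <= s)%N by rewrite size_filter.
  have key pi' y : y = pi'.1 \/ y = pi'.2 -> y \in V -> y \notin Exc -> separated I pi pi'.
    move=> hy yV; rewrite mem_filter yV andbT -leNgt => h2.
    apply: (lam_count_weak eps0 rho0 rho1 rhou).
    apply: le_trans (le_trans _ h2) _.
      rewrite -mulrA; have -> : eps ^+ 4 * (u%:R / 256) = eps * (eps ^+ 3 / 256 * u%:R) by ring.
      by rewrite ler_pM2l.
    rewrite ler_nat count_map count_filter; apply: sub_count => p /= /andP[h3].
    rewrite /both /splits => /andP[/andP[/negbTE a1 a2] /andP[/negbTE a3 a4]].
    have yp : adj y p.2 = 0 by rewrite /adj (negbTE h3).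
    apply/negbT/lt_eqF; rewrite /pair_adj.
    have -> : adj pi.1 p.1 = 0 by rewrite /adj a1.
    have -> : adj pi.2 p.1 = 0 by rewrite /adj a3.
    have -> : adj pi.1 p.2 = 1 by rewrite /adj a2.
    have -> : adj pi.2 p.2 = 1 by rewrite /adj a4.
    have b1 := adj_ge0 R e pi'.1 p.1; have b2 := adj_ge0 R e pi'.2 p.1.
    have b3 := adj_le1 R e pi'.1 p.2; have b4 := adj_le1 R e pi'.2 p.2.
    by case: hy yp => ->; move: b1 b2 b3 b4; rewrite -/adj; lra.
  rewrite -size_filter.
  apply: leq_trans (_ : size [seq (x, y) | x <- Exc, y <- Exc] <= _)%N; last first.
    by rewrite size_allpairs leq_mul.
  apply: uniq_leq_size; first exact: filter_uniq.
  move=> [x y]; rewrite mem_filter => /andP[hns /memP2[/= xV yV _ _ _]].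
  apply: allpairs_f; apply: contraR hns => hE.
    exact: (key (x, y) x (or_introl erefl)).
  exact: (key (x, y) y (or_intror erefl)).
have hsP2 : (g * (s * s).+1 <= size P2)%N by rewrite size_filter ltnW.
have [Pi [sPi uPi PiP2 hPi]] := greedy_indep uP2 hconf hsP2.
exists I, L, Pi, (j%:R * q%:R); split.
- apply: perm_trans pI _; rewrite ends_cat perm_catC; by rewrite perm_cat2r.
- rewrite big_cat /=.
  have h1 : \sum_(p <- I) (D p.1 - D p.2) ^+ 2 <= kk%:R * q%:R ^+ 2.
    rewrite -sI -sum1_size natr_sum mulr_suml big_seq [leRHS]big_seq.
    apply: ler_sum => p /hI[hp _]; rewrite mul1r -real_normK ?num_real //.
    by rewrite ler_pXn2r ?nnegrE.
  have h2 : kk%:R * q%:R ^+ 2 <= q%:R ^+ 2 * q%:R ^+ 2 :> R.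
    by rewrite ler_pM2r ?exprn_gt0 //; move: k_hi eu uq'; lra.
  have h3 : q%:R ^+ 4 = q%:R ^+ 2 * q%:R ^+ 2 :> R by rewrite -exprD.
  move: hL; rewrite subr0 exprMn h3; move: h1 h2; rewrite -natrX; lra.
- have /hasP[pi _ /eqP hpi] : has (fun pi => bucket q (D2 pi) == j) P1.
    by rewrite has_count; apply: leq_ltn_trans hj.
  have /andP[d1 d2] := hD2 pi; have /andP[d3 _] := bucket_itv q0 d1.
  rewrite hpi in d3; rewrite mulr_ge0 //=; exact: le_trans d3 d2.
- split => //; by move: hPi; apply: sub_pairwise => x y; rewrite negbK.
- move=> pi /PiP2/memP2[h1 h2 h3 _ h4]; split => //.
  by rewrite -h4; apply: bucket_itv => //; have /andP[] := hD2 pi.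
Qed.
End FinePairs.

(** * Many edge counts along a climb *)
Lemma floor_near (R : realType) (a b : R) : `|a - b| <= 1 ->
  `|Num.floor a - Num.floor b| <= 1.
Proof.
have ha := floor_le_tmp a; have hb := floor_le_tmp b.
have ha' := floorD1_gt a; have hb' := floorD1_gt b.
rewrite !ler_norml => /andP[h1 h2]; move: ha' hb'; rewrite !intrD => ha' hb'.
have k1 : (Num.floor a)%:~R < (Num.floor b)%:~R + 2 :> R by lra.
have k2 : (Num.floor b)%:~R < (Num.floor a)%:~R + 2 :> R by lra.
have e2 : 2 = 2%:~R :> R by [].
by rewrite e2 -!intrD !ltr_int in k1 k2; lia.
Qed.

Lemma Ex_collisions (R : realType) (T U : eqType) (ps : seq (T * T))
    (val : seq T -> U -> R) (r : rel U) (Pi : seq U) (P : R) :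
  0 <= P -> pairwise r Pi ->
  (forall x y, r x y -> Ex ps (fun l => (val l x == val l y)%:R) <= P) ->
  Ex ps (fun l => collisions (val l) Pi) <= (size Pi)%:R ^+ 2 * P.
Proof.
move=> P0 hr h; elim: Pi hr => [|x Pi IH] /=.
  by move=> _; rewrite ExC mulr_ge0 ?sqr_ge0.
move=> /andP[/allP hx /IH {}IH]; rewrite ExD Ex_sum.
have h1 : \sum_(y <- Pi) Ex ps (fun l => (val l x == val l y)%:R) <= (size Pi)%:R * P.
  rewrite -sum1_size natr_sum mulr_suml big_seq [leRHS]big_seq.
  by apply: ler_sum => y /hx/h; rewrite mul1r.
have sP : 0 <= (size Pi)%:R * P by rewrite mulr_ge0.
rewrite -[(size Pi).+1%:R]natr1; lra.
Qed.

Section FineValues.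
Variables (R : realType) (T : finType) (e : rel T).
Hypotheses (e_sym : symmetric e) (e_irr : irreflexive e).
Local Notation adj := (@adj R T e).
Local Notation deg := (@deg R T e).
Local Notation en := (@en R T e).
Local Notation avg := (@avg R T e).
Variables (eps rho : R) (s u q : nat) (X : {set T}).
Hypotheses (eps0 : 0 < eps) (eps1 : eps <= 1) (rho0 : 0 < rho) (rho1 : rho <= 1).
Hypotheses (hrich : rich e eps s u X) (q0 : (0 < q)%N) (u0 : (0 < u)%N).
Hypotheses (rhou : rho * q%:R ^+ 2 <= u%:R) (uq : (u <= q ^ 2)%N).
Hypothesis hbig : ((8 * q).+1 * s.+1)%N%:R <= eps * u%:R / 8.
Variable kk : nat.
Hypotheses (k_lo : eps * u%:R / 32 <= kk%:R) (k_hi : kk%:R <= eps * u%:R / 16).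
Hypothesis sq : (s * s <= q)%N.
Hypothesis hq : 200 <= eps ^+ 2 * rho ^+ 2 * q%:R.

Let lam : R := eps ^+ 2 * rho / 32.
Let i0 : R := lam / 32.
Let K1 : R := 296 / i0.
Let kap0 : R := lam * i0 ^+ 2 / (48 * 296).
Let K2 : R := 280 * K1 / i0.

Let q0' : (0 : R) < q%:R. Proof. by rewrite ltr0n. Qed.
Let lam0 : 0 < lam. Proof. by rewrite divr_gt0 // mulr_gt0 // exprn_gt0. Qed.
Let i00 : 0 < i0. Proof. by rewrite divr_gt0. Qed.
Let K10 : 0 < K1. Proof. by rewrite divr_gt0. Qed.
Let K20 : 0 < K2. Proof. by rewrite divr_gt0 // mulr_gt0. Qed.
Let i01 : i0 <= 1.
Proof. by have := lam_le1 eps0 eps1 rho0 rho1; rewrite -/lam /i0; lra. Qed.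
Let K2_ge1 : 1 <= K2.
Proof.
rewrite /K2 ler_pdivlMr // mul1r; apply: le_trans i01 _.
have : 1 <= K1 by rewrite /K1 ler_pdivlMr // mul1r; move: i01; lra.
lra.
Qed.

Lemma deg_path (Y : nat -> seq T) m v :
  (forall k, (k < m)%N -> exists x y, perm_eq (x :: Y k.+1) (y :: Y k)) ->
  forall k, (k <= m)%N -> `|deg (Y k) v - deg (Y 0%N) v| <= k%:R.
Proof.
move=> hY; elim=> [|k IH] hk; first by rewrite subrr normr0.
have [x [y hp]] := hY k hk.
have := deg_perm R e v hp; rewrite !deg_cons.
have := IH (ltnW hk); rewrite -natr1 !ler_norml => /andP[h1 h2] h3.
have := (adj_ge0 R e v x, adj_ge0 R e v y, adj_le1 R e v x, adj_le1 R e v y).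
by move=> [[[h4 h5] h6] h7]; apply/andP; split; lra.
Qed.

Section Potential.
Variables (A V : seq T) (Y : nat -> seq T) (m g : nat).
Hypotheses (g0 : (0 < g)%N) (gq : (2 * g)%:R <= kap0 * q%:R).
Hypotheses (m0 : (0 < m)%N) (mq : (m <= q)%N).
Hypothesis hY : forall k, (k < m)%N -> exists x y, perm_eq (x :: Y k.+1) (y :: Y k).
Let wA v : R := deg A v / 2.
Let w0 : T -> R := fun=> 0.
Hypothesis hinc : forall k, (k < m)%N ->
  i0 * q%:R <= en wA (Y k.+1) - en wA (Y k) <= 6 * q%:R.
Variables (I L Pi : seq (T * T)) (theta : R).
Let ps := L ++ I.
Hypothesis pA : perm_eq A (ends (L ++ I)).
Hypothesis sA : size A = u.*2.
Let D v := deg (Y 0%N) v + deg A v / 2.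
Hypothesis hDs : \sum_(p <- L ++ I) (D p.1 - D p.2) ^+ 2 <= 65 * q%:R ^+ 4.
Hypotheses (sPi : size Pi = (2 * g)%N) (hPi : pairwise (@separated R T e eps rho q I) Pi).
Hypothesis hPiD : {in Pi, forall pi, theta <= D pi.1 + D pi.2 <= theta + q%:R}.

(* [f l k] counts the edges at the [k]-th step of the climb when [l] is chosen
   from the pairs [ps], and [Ef k] is its mean; two further vertices bring it to
   [val k l pi], an increase by [theta + dev k l pi]. *)
Let f (l : seq T) k := en w0 (Y k ++ l).
Let c0 : R := (\sum_(p <- ps) adj p.1 p.2) / 4.
Let Ef k := en wA (Y k) + avg w0 A - c0.
Let val k l (pi : T * T) := en w0 (pi.1 :: pi.2 :: Y k ++ l).
Let dev k l pi := val k l pi - f l k - theta.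

Let sps : size ps = u.
Proof. by apply: double_inj; rewrite -size_ends -(perm_size pA) sA. Qed.
Let dA v : deg (ends ps) v = deg A v.
Proof. by apply: deg_perm; rewrite perm_sym. Qed.
Let uq' : u%:R <= q%:R ^+ 2 :> R. Proof. by rewrite -natrX ler_nat. Qed.
Let q1 : 1 <= q%:R :> R. Proof. by rewrite ler1n. Qed.

Lemma value_split k l pi :
  val k l pi = f l k + (deg (Y k) pi.1 + deg (Y k) pi.2 + adj pi.1 pi.2)
     + \sum_(v <- l) pair_adj R e pi v.
Proof.
rewrite /val /f !en_cons' // /w0 !deg_cons !deg_cat /pair_adj big_split /=.
by rewrite -/(deg l pi.1) -/(deg l pi.2); lra.
Qed.

Lemma f_split l k : f l k = en w0 (Y k) + en (fun v => w0 v + deg (Y k) v) l.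
Proof. by rewrite /f en_cat. Qed.

Lemma Ex_f k : Ex ps (fun l => f l k) = Ef k.
Proof.
under eq_Ex do rewrite f_split.
rewrite ExcD Ex_en // /Ef -(avg_perm e _ pA) /avg /c0.
rewrite !big_split /= (deg_sumC R e_sym A (Y k)) /en /wA -mulr_suml.
rewrite /w0 !big1_eq; lra.
Qed.

(** [Y k] arises from [Y 0] by at most [q] exchanges, so the expected
    contributions still differ by [O(q)] more than [D] does. *)
Lemma Ex_f2 k : (k <= m)%N -> Ex ps (fun l => (f l k - Ef k) ^+ 2) <= 35 * q%:R ^+ 4.
Proof.
move=> hk.
have -> : Ex ps (fun l => (f l k - Ef k) ^+ 2) =
   Ex ps (fun l => (en w0 (Y k) - Ef k + en (fun v => w0 v + deg (Y k) v) l) ^+ 2).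
  by apply: eq_Ex => l _; rewrite f_split addrAC.
apply: le_trans (Ex_en2 e_sym e_irr _ _ _) _.
have -> : en w0 (Y k) - Ef k + Ex ps (fun l => en (fun v => w0 v + deg (Y k) v) l) = 0.
  rewrite -Ex_f; under [X in _ - X + _]eq_Ex do rewrite f_split.
  by rewrite ExcD; lra.
rewrite expr0n add0r sps.
have hD p : (w0 p.1 + deg (Y k) p.1 + deg (ends ps) p.1 / 2 -
   (w0 p.2 + deg (Y k) p.2 + deg (ends ps) p.2 / 2)) ^+ 2 <=
   2 * (D p.1 - D p.2) ^+ 2 + 8 * q%:R ^+ 2.
  have h1 := deg_path p.1 hY hk; have h2 := deg_path p.2 hY hk.
  have kq : k%:R <= q%:R :> R by rewrite ler_nat (leq_trans hk).
  rewrite !dA /D /w0 !add0r; set a := deg (Y k) p.1 in h1 *; set b := deg (Y k) p.2 in h2 *.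
  set a0 := deg (Y 0%N) p.1 in h1 *; set b0 := deg (Y 0%N) p.2 in h2 *.
  set z := a0 + deg A p.1 / 2 - (b0 + deg A p.2 / 2).
  have -> : a + deg A p.1 / 2 - (b + deg A p.2 / 2) = z + ((a - a0) - (b - b0)).
    by rewrite /z; lra.
  move: h1 h2; rewrite !ler_norml => /andP[h1 h2] /andP[h3 h4].
  set y := (a - a0) - (b - b0).
  have hy : -(2 * q%:R) <= y <= 2 * q%:R by rewrite /y; apply/andP; split; lra.
  have hy2 : y ^+ 2 <= 4 * q%:R ^+ 2 by move/andP: hy => [? ?]; nra.
  have := sqr_ge0 (z - y); lra.
have hs : \sum_(p <- ps) (w0 p.1 + deg (Y k) p.1 + deg (ends ps) p.1 / 2 -
   (w0 p.2 + deg (Y k) p.2 + deg (ends ps) p.2 / 2)) ^+ 2 <= 138 * q%:R ^+ 4.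
  apply: le_trans (ler_sum _ (fun p _ => hD p)) _.
  rewrite big_split /= -mulr_sumr.
  have -> : \sum_(p <- ps) 8 * q%:R ^+ 2 = u%:R * (8 * q%:R ^+ 2) :> R.
    by rewrite big_const_seq count_predT iter_addr_0 sps [RHS]mulr_natl.
  have h1 : u%:R * q%:R ^+ 2 <= q%:R ^+ 2 * q%:R ^+ 2 :> R by rewrite ler_pM2r ?exprn_gt0.
  have h2 : q%:R ^+ 4 = q%:R ^+ 2 * q%:R ^+ 2 :> R by rewrite -exprD.
  move: hDs; rewrite -/ps h2; lra.
have u2 : u%:R ^+ 2 <= q%:R ^+ 4 :> R.
  by rewrite (exprM _ 2 2) ler_pXn2r ?nnegrE ?exprn_ge0.
have q40 : (0 : R) <= q%:R ^+ 4 by rewrite exprn_ge0.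
apply: (@le_trans _ _ ((138 * q%:R ^+ 4 + q%:R ^+ 4) / 4)); last by lra.
by rewrite ler_pM2r ?invr_gt0 //; apply: lerD hs u2.
Qed.

Lemma Ex_step2 k : (k < m)%N ->
  Ex ps (fun l => (f l k.+1 - f l k) ^+ 2) <= 37 * q%:R ^+ 2.
Proof.
move=> hk; have [x [y hp]] := hY hk.
have hl l : f l k.+1 - f l k = deg (Y k) y - deg (Y k) x - adj x y + (deg l y - deg l x).
  have hp' : perm_eq (x :: (Y k.+1 ++ l)) (y :: (Y k ++ l)).
    by rewrite -!cat_cons perm_cat2r.
  by rewrite /f (en_swap e_sym e_irr w0 hp') /w0 !deg_cat; lra.
have -> : Ex ps (fun l => (f l k.+1 - f l k) ^+ 2) =
  Ex ps (fun l => (deg (Y k) y - deg (Y k) x - adj x y + (deg l (x, y).2 - deg l (x, y).1)) ^+ 2).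
  by apply: eq_Ex => l _; rewrite hl.
apply: le_trans (Ex_gain2 (d := 6 * q%:R) _) _.
  have := hinc hk; rewrite (en_swap e_sym e_irr wA hp) /wA !dA /=.
  have := mulr_gt0 i00 q0'; move=> h0 /andP[h1 h2].
  by rewrite ler_norml; apply/andP; split; lra.
by rewrite sps exprMn -natrX; move: uq'; lra.
Qed.

Lemma Ex_dev2 k pi : (k <= m)%N -> pi \in Pi ->
  Ex ps (fun l => dev k l pi ^+ 2) <= 17 * q%:R ^+ 2.
Proof.
move=> hk /hPiD /andP[hp1 hp2].
pose a := deg (Y k) pi.1 + deg (Y k) pi.2 + adj pi.1 pi.2 - theta.
have -> : Ex ps (fun l => dev k l pi ^+ 2) =
  Ex ps (fun l => (a + \sum_(v <- l) pair_adj R e pi v) ^+ 2).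
  by apply: eq_Ex => l _; rewrite /dev value_split /a; congr (_ ^+ 2); lra.
rewrite Ex_linear2.
have -> : \sum_(v <- ends ps) pair_adj R e pi v = deg A pi.1 + deg A pi.2.
  by rewrite big_split /= -/(deg _ _) -/(deg _ _) !dA.
have h1 := deg_path pi.1 hY hk; have h2 := deg_path pi.2 hY hk.
have kq : k%:R <= q%:R :> R by rewrite ler_nat (leq_trans hk).
have ha := adj_ge0 R e pi.1 pi.2; have ha' := adj_le1 R e pi.1 pi.2.
have hm2 : (a + (deg A pi.1 + deg A pi.2) / 2) ^+ 2 <= 16 * q%:R ^+ 2.
  have -> : 16 * q%:R ^+ 2 = (4 * q%:R) ^+ 2 :> R by ring.
  rewrite -real_normK ?num_real // ler_pXn2r ?nnegrE ?mulr_ge0 //.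
  move: q1 kq ha ha' h1 h2 hp1 hp2; rewrite /a /D !ler_norml => ? ? ? ? /andP[h1 h2] /andP[h3 h4] h5 h6.
  by apply/andP; split; lra.
have hv : (\sum_(p <- ps) (pair_adj R e pi p.1 - pair_adj R e pi p.2) ^+ 2) / 4 <= u%:R.
  rewrite ler_pdivrMr // -sps -sum1_size natr_sum mulr_suml; apply: ler_sum => p _.
  rewrite /pair_adj.
  have := (adj_ge0 R e pi.1 p.1, adj_ge0 R e pi.2 p.1, adj_ge0 R e pi.1 p.2, adj_ge0 R e pi.2 p.2,
    adj_le1 R e pi.1 p.1, adj_le1 R e pi.2 p.1, adj_le1 R e pi.1 p.2, adj_le1 R e pi.2 p.2).
  move=> [[[[[[[? ?] ?] ?] ?] ?] ?] ?].
  set z := _ - _; have /andP[z1 z2] : -2 <= z <= 2 by rewrite /z; apply/andP; split; lra.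
  by rewrite mul1r; nra.
move: hm2 hv uq'; lra.
Qed.

(** Two values agree only if a sum over the selection takes one prescribed
    value. *)
Lemma Ex_coll k : Ex ps (fun l => collisions (val k l) Pi) <=
   (2 * g)%:R ^+ 2 * (3 / (lam * q%:R)).
Proof.
have y0 : 0 < lam * q%:R by rewrite mulr_gt0.
rewrite -sPi; apply: (Ex_collisions _ hPi); first by rewrite divr_ge0 // ltW.
move=> x y hxy; rewrite /ps Ex_cat -[leRHS](ExC L); apply: le_Ex => l1 _.
pose a := (deg (Y k) x.1 + deg (Y k) x.2 + adj x.1 x.2) - (deg (Y k) y.1 + deg (Y k) y.2 + adj y.1 y.2)
   + \sum_(v <- l1) (pair_adj R e x v - pair_adj R e y v).
pose w v := pair_adj R e x v - pair_adj R e y v.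
apply: le_trans (_ : Ex I (fun l2 => (`|a + \sum_(v <- l2) w v| < 1)%R%:R) <= _).
  apply: le_Ex => l2 _; case: eqP => [hv|_] //.
  suff -> : a + \sum_(v <- l2) w v = 0 by rewrite normr0 ltr01.
  have := hv; rewrite !value_split !big_cat /= /a /w !sumrB; lra.
apply: le_trans (anticoncentration _ ler01 y0 _ hxy) _.
  move=> p _; rewrite /w /pair_adj !adj_int -!intrD -!intrB; apply: int_gap.
  by case: (e x.1 p.1); case: (e x.2 p.1); case: (e y.1 p.1); case: (e y.2 p.1);
     case: (e x.1 p.2); case: (e x.2 p.2); case: (e y.1 p.2); case: (e y.2 p.2).
by rewrite ler_pM2r ?invr_gt0 //; lra.
Qed.

(* [gain l] is, up to one, a lower bound for the number of cells of mesh [w] that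
   [f l] visits, given by [cells_lower] and reduced by one for each step [k] at which fewer than
   [g] distinct values [val k l pi] lie within [w] of [f l k + theta], or at
   which [f l k] is far from its mean; [cost l k >= 1] at such steps. *)
Let w : R := K1 * q%:R.
Let w_gt0 : 0 < w. Proof. exact: mulr_gt0 K10 q0'. Qed.
Let defect k l : R := (\sum_(pi <- Pi) dev k l pi ^+ 2) / w ^+ 2 + collisions (val k l) Pi.
Let cost l k : R :=
  defect k l / g%:R + (f l k - Ef k) ^+ 2 / (K2 * q%:R ^+ 4).
Let gain l : R := (f l m - f l 0%N) / w - (\sum_(k < m) (f l k.+1 - f l k) ^+ 2) / w ^+ 2
   - \sum_(k <- iota 0 m.+1) cost l k.

Lemma Ex_cost k : (k <= m)%N -> Ex ps (fun l => cost l k) <= 3 * i0 / (8 * K1).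
Proof.
move=> hk; rewrite /cost ExD.
have g0' : (0 : R) < g%:R by rewrite ltr0n.
have q4 : (0 : R) < q%:R ^+ 4 by rewrite exprn_gt0.
have h1 : Ex ps (fun l => (f l k - Ef k) ^+ 2 / (K2 * q%:R ^+ 4)) <= i0 / (8 * K1).
  under eq_Ex do rewrite mulrC.
  have Kq4 : 0 < K2 * q%:R ^+ 4 by apply: mulr_gt0 K20 q4.
  rewrite ExZ [leLHS]mulrC ler_pdivrMr //; apply: le_trans (Ex_f2 hk) _.
  rewrite (_ : i0 / (8 * K1) * (K2 * q%:R ^+ 4) = 35 * q%:R ^+ 4) //.
  by rewrite /K2; field; rewrite ?gt_eqF.
have hcoll : Ex ps (fun l => collisions (val k l) Pi) <= g%:R * (i0 / (8 * K1)).
  apply: le_trans (Ex_coll k) _; have lq : 0 < lam * q%:R by rewrite mulr_gt0.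
  rewrite mulrA ler_pdivrMr // natrM expr2.
  have h2 : (2 * g%:R) * (6 * g%:R) <= (kap0 * q%:R) * (6 * g%:R).
    by rewrite ler_pM2r ?mulr_gt0 // -natrM.
  have -> : g%:R * (i0 / (8 * K1)) * (lam * q%:R) = kap0 * q%:R * (6 * g%:R).
    by rewrite /K1 /kap0; field; rewrite ?gt_eqF.
  by move: h2; lra.
have hdev : Ex ps (fun l => (\sum_(pi <- Pi) dev k l pi ^+ 2) / w ^+ 2) <= g%:R * (i0 / (8 * K1)).
  under eq_Ex do rewrite mulrC.
  rewrite ExZ Ex_sum [leLHS]mulrC ler_pdivrMr ?exprn_gt0 //.
  apply: le_trans (_ : \sum_(pi <- Pi) 17 * q%:R ^+ 2 <= _).
    by rewrite big_seq [leRHS]big_seq; apply: ler_sum => pi; apply: Ex_dev2.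
  rewrite big_const_seq count_predT iter_addr_0 sPi -[leLHS]mulr_natl natrM.
  have -> : g%:R * (i0 / (8 * K1)) * w ^+ 2 = 37 * g%:R * q%:R ^+ 2.
    by rewrite /w /K1; field; rewrite gt_eqF.
  have : 0 <= g%:R * q%:R ^+ 2 :> R by rewrite mulr_ge0 ?exprn_ge0.
  lra.
have h2 : Ex ps (fun l => defect k l / g%:R) <= i0 / (8 * K1) + i0 / (8 * K1).
  under eq_Ex do rewrite mulrC.
  rewrite ExZ [leLHS]mulrC ler_pdivrMr // /defect ExD; move: hcoll hdev; lra.
move: h1 h2; lra.
Qed.

(** The mean climbs by at least [m * i0 * q], that is [m * i0 / K1] cells; the
    jumps take away at most one eighth of this and the costs three quarters. *)
Lemma Ex_gain : m%:R * i0 / (8 * K1) <= Ex ps gain.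
Proof.
have m0' : 1 <= m%:R :> R by rewrite ler1n.
rewrite /gain ExD ExN ExD ExN Ex_sum.
have -> : Ex ps (fun l => (f l m - f l 0%N) / w) = (Ef m - Ef 0%N) / w.
  under eq_Ex do rewrite mulrC mulrBr.
  by rewrite ExD ExN !ExZ !Ex_f; lra.
have htel : m%:R * (i0 * q%:R) <= Ef m - Ef 0%N.
  have key k : (k <= m)%N -> k%:R * (i0 * q%:R) <= Ef k - Ef 0%N.
    elim: k => [|k IH] hk; first by rewrite mul0r subrr.
    have /andP[h1 _] := hinc hk; have := IH (ltnW hk).
    move: h1; rewrite /Ef -natr1; lra.
  exact: key.
have h1 : m%:R * i0 / K1 <= (Ef m - Ef 0%N) / w.
  rewrite ler_pdivlMr // /w; apply: le_trans htel.
  by rewrite le_eqVlt; apply/orP; left; apply/eqP; field; rewrite gt_eqF.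
have h2 : Ex ps (fun l => (\sum_(k < m) (f l k.+1 - f l k) ^+ 2) / w ^+ 2) <= m%:R * i0 / (8 * K1).
  under eq_Ex do rewrite mulrC.
  rewrite ExZ Ex_sum [leLHS]mulrC ler_pdivrMr ?exprn_gt0 //.
  apply: le_trans (_ : \sum_(k < m) 37 * q%:R ^+ 2 <= _).
    by apply: ler_sum => k _; apply: Ex_step2.
  rewrite sumr_const card_ord -[leLHS]mulr_natl /w /K1.
  by rewrite le_eqVlt; apply/orP; left; apply/eqP; field; rewrite gt_eqF.
have h3 : \sum_(k <- iota 0 m.+1) Ex ps (cost^~ k) <= m.+1%:R * (3 * i0 / (8 * K1)).
  have -> : m.+1%:R * (3 * i0 / (8 * K1)) = \sum_(k <- iota 0 m.+1) (3 * i0 / (8 * K1)).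
    by rewrite big_const_seq count_predT iter_addr_0 size_iota mulr_natl.
  rewrite big_seq [leRHS]big_seq; apply: ler_sum => k; rewrite mem_iota => hk.
  by apply: Ex_cost; move: hk; clear; lia.
have iK : 0 < i0 / K1 by rewrite divr_gt0.
have e1 : m%:R * i0 / K1 = m%:R * (i0 / K1) by rewrite mulrA.
have e2 : m%:R * i0 / (8 * K1) = m%:R * (i0 / K1) / 8 by field; rewrite gt_eqF.
have e3 : 3 * i0 / (8 * K1) = 3 * (i0 / K1) / 8 by field; rewrite gt_eqF.
have hm : i0 / K1 <= m%:R * (i0 / K1) by rewrite ler_peMl // ltW.
move: h1 h2 h3 hm iK; rewrite e1 e2 e3 -[m.+1%:R]natr1; lra.
Qed.

Hypothesis mbig : 16 * K1 / i0 <= m%:R.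
Hypothesis theta0 : 0 <= theta <= 10 * q%:R ^+ 2.

(** For a selection whose gain is at least the mean, of order [m] cells are
    visited at good steps, and each brings [g] distinct values in or next to the
    cell; a value is counted at most three times. *)
Lemma many_values : exists2 l, sel ps l & exists vals : seq R,
  [/\ uniq vals,
      m%:R * i0 / (16 * K1) * g%:R <= 3 * (size vals)%:R &
      {in vals, forall x, `|x - (en wA (Y 0%N) + avg w0 A)| <= (K1 + K2 + 24) * q%:R ^+ 2 /\
         exists k pi, [/\ (k <= m)%N, pi \in Pi & x = val k l pi]}].
Proof.
have [l sl hl] := Ex_attained ps gain.
exists l => //.
have g0' : (0 : R) < g%:R by rewrite ltr0n.
have q4 : (0 : R) < q%:R ^+ 4 by rewrite exprn_gt0.
have Kq4 : 0 < K2 * q%:R ^+ 4 by apply: mulr_gt0 K20 q4.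
have w2 : 0 < w ^+ 2 by rewrite exprn_gt0.
pose good k := (defect k l <= g%:R) && ((f l k - Ef k) ^+ 2 <= K2 * q%:R ^+ 4).
pose ks := iota 0 m.+1.
have defect0 k : 0 <= defect k l.
  by rewrite addr_ge0 ?collisions_ge0 // divr_ge0 ?(ltW w2) // sumr_ge0 // => pi _; apply: sqr_ge0.
have hbad : (count (predC good) ks)%:R <= \sum_(k <- ks) cost l k.
  rewrite -sum1_count natr_sum big_mkcond /=; apply: ler_sum => k _.
  have h1 : 0 <= defect k l / g%:R by rewrite divr_ge0.
  have h2 : 0 <= (f l k - Ef k) ^+ 2 / (K2 * q%:R ^+ 4) by rewrite divr_ge0 ?sqr_ge0 // ltW.
  rewrite /good negb_and -!ltNge /cost; case: ltP => [h|_] /=.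
    have : 1 <= defect k l / g%:R by rewrite ler_pdivlMr // mul1r ltW.
    lra.
  case: ltP => [h|_] /=; last by rewrite addr_ge0.
  have : 1 <= (f l k - Ef k) ^+ 2 / (K2 * q%:R ^+ 4) by rewrite ler_pdivlMr // mul1r ltW.
  lra.
pose C := undup [seq Num.floor (f l k / w) | k <- ks & good k].
have hC : m%:R * i0 / (16 * K1) <= (size C)%:R.
  have h1 := cells_lower (f l) m w_gt0.
  have h2 : (size (cellsN w (f l) m))%:R <= (size C)%:R + (count (predC good) ks)%:R :> R.
    rewrite -natrD ler_nat.
    rewrite -(size_filter (predC good)) -(size_map (fun k => Num.floor (f l k / w)) (filter _ _)) -size_cat.
    apply: uniq_leq_size; first exact: undup_uniq.
    move=> z; rewrite mem_undup mem_cat mem_undup => /mapP[k hk ->].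
    by apply/orP; case hg : (good k); [left|right]; apply/mapP; exists k => //;
      rewrite mem_filter /= hg.
  have h3 : (f l m - f l 0%N) / w - 1 - (\sum_(k < m) (f l k.+1 - f l k) ^+ 2) / w ^+ 2
      <= (size (cellsN w (f l) m))%:R.
    rewrite -(ler_pM2l w_gt0); apply: le_trans h1.
    by rewrite le_eqVlt; apply/orP; left; apply/eqP; field; rewrite gt_eqF.
  have h4 := le_trans Ex_gain hl.
  have h5 : 1 <= m%:R * i0 / (16 * K1).
    have K16 : 0 < 16 * K1 by apply: mulr_gt0.
    by rewrite ler_pdivlMr // mul1r -ler_pdivrMr.
  have e2 : m%:R * i0 / (8 * K1) = 2 * (m%:R * i0 / (16 * K1)) by field; rewrite gt_eqF.
  rewrite e2 in h4; move: h4; rewrite /gain -/ks; move: h2 h3 h5 hbad; lra.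
pose near k := [seq x <- undup (map (val k l) Pi) | `|x - f l k - theta| <= w].
have hnear k : good k -> (g <= size (near k))%N.
  move=> /andP[hd _].
  have h1 := distinct_lower (val k l) Pi; rewrite sPi in h1.
  have h2 : (count (predC (fun x => `|x - f l k - theta| <= w)) (undup (map (val k l) Pi)))%:R
     <= (\sum_(pi <- Pi) dev k l pi ^+ 2) / w ^+ 2.
    apply: le_trans (_ : (count (predC (fun x => `|x - f l k - theta| <= w)%R) (map (val k l) Pi))%:R <= _).
      by rewrite ler_nat; apply: leq_count_subseq; apply: undup_subseq.
    rewrite count_map -sum1_count natr_sum big_mkcond mulr_suml /=; apply: ler_sum => pi _.
    rewrite -/(dev k l pi) -ltNge; case: ltP => h; last by rewrite divr_ge0 ?sqr_ge0 // ltW.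
    rewrite ler_pdivlMr // mul1r -[leRHS]real_normK ?num_real //.
    by rewrite ler_pXn2r ?nnegrE ?(ltW w_gt0) ?(ltW h).
  have h3 : (size (undup (map (val k l) Pi)))%:R = (size (near k))%:R +
     (count (predC (fun x => `|x - f l k - theta| <= w)%R) (undup (map (val k l) Pi)))%:R :> R.
    by rewrite -natrD /near size_filter count_predC.
  rewrite -(ler_nat R); move: hd h1; rewrite /defect natrM h3; move: h2; lra.
pose U := undup (flatten [seq near k | k <- ks & good k]).
have memU x : x \in U -> exists k, [/\ k \in ks, good k & x \in near k].
  rewrite mem_undup => /flattenP[s' /mapP[k]]; rewrite mem_filter => /andP[h1 h2] -> h3.
  by exists k.
have hcount : (size C * g <= 3 * size U)%N.
  apply: (@cell_double_count _ C U (fun x => Num.floor ((x - theta) / w))).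
    exact: undup_uniq.
  move=> c; rewrite mem_undup => /mapP[k]; rewrite mem_filter => /andP[hg hk] ->.
  apply: leq_trans (hnear k hg) _; rewrite -[leqRHS]size_filter; apply: uniq_leq_size.
    by apply: filter_uniq; apply: undup_uniq.
  move=> x xk; rewrite mem_filter; apply/andP; split.
    apply: floor_near; rewrite -mulrBl normrM (gtr0_norm (x := w^-1)) ?invr_gt0 //.
    rewrite ler_pdivrMr // mul1r addrAC; by move: xk; rewrite mem_filter => /andP[].
  rewrite mem_undup; apply/flattenP; exists (near k) => //.
  by apply/mapP; exists k => //; rewrite mem_filter hg.
exists U; split.
- exact: undup_uniq.
- have : (size C)%:R * g%:R <= 3 * (size U)%:R :> R by rewrite -!natrM ler_nat.
  by apply: le_trans; rewrite ler_pM2r.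
- move=> x /memU[k [hk /andP[_ hf] hx]].
  have km : (k <= m)%N by move: hk; rewrite mem_iota; clear; lia.
  move: hx; rewrite mem_filter mem_undup => /andP[h1 /mapP[pi hpi xE]]; split; last by exists k, pi.
  have q2 : (0 : R) < q%:R ^+ 2 by rewrite exprn_gt0.
  have h2 : `|f l k - Ef k| <= K2 * q%:R ^+ 2.
    have Kq2 : 0 <= K2 * q%:R ^+ 2 by apply: ltW; apply: mulr_gt0 K20 q2.
    rewrite -(@ler_pXn2r _ 2) ?nnegrE // real_normK ?num_real //.
    apply: le_trans hf _; rewrite exprMn -exprM ler_pM2r // expr2.
    by rewrite ler_peMl // ltW.
  have h3 : `|Ef k - Ef 0%N| <= 6 * q%:R ^+ 2.
    have key j : (j <= m)%N -> 0 <= Ef j - Ef 0%N <= j%:R * (6 * q%:R).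
      elim: j => [|j IH] hj; first by rewrite mul0r subrr lexx.
      have /andP[a1 a2] := hinc hj; have /andP[a3 a4] := IH (ltnW hj).
      have := mulr_gt0 i00 q0'; rewrite -natr1 /Ef in a3 a4 *; move=> a5.
      by apply/andP; split; lra.
    have /andP[a1 a2] := key k km; rewrite ger0_norm //; apply: le_trans a2 _.
    have : k%:R * q%:R <= q%:R ^+ 2 :> R.
      by rewrite expr2 ler_pM2r // ler_nat (leq_trans km).
    lra.
  have h4 : 0 <= c0 <= q%:R ^+ 2.
    have s0 : 0 <= \sum_(p <- ps) adj p.1 p.2 by apply: sumr_ge0 => p _; apply: adj_ge0.
    rewrite /c0 divr_ge0 //= ler_pdivrMr //; apply: le_trans (_ : u%:R <= _); last by move: uq' q2; lra.
    by rewrite -sps -sum1_size natr_sum; apply: ler_sum => p _; apply: adj_le1.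
  have h5 : w <= K1 * q%:R ^+ 2 by rewrite /w ler_pM2l // expr2 ler_peMl // ltW.
  have hE : en wA (Y 0%N) + avg w0 A = Ef 0%N + c0 by rewrite /Ef; lra.
  rewrite hE; move: theta0 h1 h2 h3 h4; rewrite !ler_norml.
  move=> /andP[b1 b2] /andP[b3 b4] /andP[b5 b6] /andP[b7 b8] /andP[b9 b10].
  by apply/andP; split; lra.
Qed.
End Potential.
End FineValues.

(** * Edge counts for a fixed number of vertices *)
Lemma discrete_ivt (R : realType) (f : nat -> R) (m : nat) (y d : R) :
  0 <= d -> (forall k, (k < m)%N -> `|f k.+1 - f k| <= d) -> f 0%N <= y <= f m ->
  exists2 k, (k <= m)%N & y <= f k <= y + d.
Proof.
move=> d0 hf /andP[h0 hm]; elim: m hf hm => [|m IH] hf hm.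
  by exists 0%N => //; rewrite hm; move: h0 d0; lra.
have [h|h] := lerP y (f m).
  have [|k hk1 hk2] := IH _ h; first by move=> k hk; apply: hf; apply: ltnW.
  by exists k => //; apply: leqW.
exists m.+1 => //; rewrite hm /=.
by have := hf m (ltnSn m); rewrite ler_norml => /andP[_]; lra.
Qed.

Lemma uniq_cat_sub (T : eqType) (a b a' b' : seq T) : uniq (a ++ b) ->
  uniq a' -> uniq b' -> {subset a' <= a} -> {subset b' <= b} -> uniq (a' ++ b').
Proof.
rewrite !cat_uniq => /and3P[_ /hasPn h _] -> -> ha hb /=; rewrite andbT.
by apply/hasPn => v /hb/h /=; apply: contra => /ha.
Qed.

Section Level.
Variables (R : realType) (T : finType) (e : rel T).
Hypotheses (e_sym : symmetric e) (e_irr : irreflexive e).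
Local Notation adj := (@adj R T e).
Local Notation deg := (@deg R T e).
Local Notation en := (@en R T e).
Local Notation avg := (@avg R T e).
Variables (eps rho : R) (s u q : nat) (X : {set T}).
Hypotheses (eps0 : 0 < eps) (eps1 : eps <= 1) (rho0 : 0 < rho) (rho1 : rho <= 1).
Hypotheses (hrich : rich e eps s u X) (q0 : (0 < q)%N) (u0 : (0 < u)%N).
Hypotheses (rhou : rho * q%:R ^+ 2 <= u%:R) (uq : (u <= q ^ 2)%N).
Hypothesis hbig : ((8 * q).+1 * s.+1)%N%:R <= eps * u%:R / 8.
Variable kk : nat.
Hypotheses (k_lo : eps * u%:R / 32 <= kk%:R) (k_hi : kk%:R <= eps * u%:R / 16).
Hypothesis sq : (s * s <= q)%N.
Hypothesis hq : 200 <= eps ^+ 2 * rho ^+ 2 * q%:R.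

Let lam : R := eps ^+ 2 * rho / 32.
Let i0 : R := lam / 32.
Let K1 : R := 296 / i0.
Let kap0 : R := lam * i0 ^+ 2 / (48 * 296).
Let K2 : R := 280 * K1 / i0.
Let K3 : R := K1 + K2 + 24.
Let c1 : R := eps * rho * lam / 1024.
Hypothesis lamq : 64 <= lam * q%:R.

Let q0' : (0 : R) < q%:R. Proof. by rewrite ltr0n. Qed.
Let lam0 : 0 < lam. Proof. by rewrite divr_gt0 // mulr_gt0 // exprn_gt0. Qed.
Let i00 : 0 < i0. Proof. by rewrite divr_gt0. Qed.
Let K10 : 0 < K1. Proof. by rewrite divr_gt0. Qed.
Let K20 : 0 < K2. Proof. by rewrite divr_gt0 // mulr_gt0. Qed.
Let K30 : 0 < K3. Proof. by have := K10; have := K20; rewrite /K3; lra. Qed.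
Let uq' : u%:R <= q%:R ^+ 2 :> R. Proof. by rewrite -natrX ler_nat. Qed.

Variables (m g : nat).
Hypotheses (g0 : (0 < g)%N) (gq : (2 * g)%:R <= kap0 * q%:R).
Hypotheses (m0 : (0 < m)%N) (mk : (4 * m <= kk)%N) (mlam : m%:R <= lam / 128 * q%:R).
Hypothesis mbig : 16 * K1 / i0 <= m%:R.

Let mq : (m <= q)%N.
Proof.
rewrite -(ler_nat R); apply: le_trans mlam _.
have := ler_wpM2r (ltW q0') (lam_le1 eps0 eps1 rho0 rho1).
by move: q0'; rewrite -/lam; lra.
Qed.
Let gle : (2 * g)%:R <= q%:R :> R.
Proof.
apply: le_trans gq _; rewrite ler_piMl //.
have l1 : lam <= 1 / 32 := lam_le1 eps0 eps1 rho0 rho1.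
have i1 : i0 ^+ 2 <= 1.
  by apply: exprn_ile1; [exact: ltW | rewrite /i0; move: l1; lra].
have : lam * i0 ^+ 2 <= 1 * 1.
  by apply: ler_pM => //; [exact: ltW | exact: sqr_ge0 | move: l1; lra].
rewrite /kap0; lra.
Qed.

Lemma fine_values (A V : seq T) (Y : nat -> seq T) :
  uniq A -> {subset A <= X} -> size A = u.*2 ->
  uniq V -> {subset V <= X} -> size V = u.*2 -> (size (Y 0%N) <= 4 * q ^ 2)%N ->
  (forall k, (k < m)%N -> exists x y, perm_eq (x :: Y k.+1) (y :: Y k)) ->
  (forall k, (k < m)%N -> i0 * q%:R <=
     en (fun v => deg A v / 2) (Y k.+1) - en (fun v => deg A v / 2) (Y k) <= 6 * q%:R) ->
  exists l : seq T, [/\ uniq l, size l = u, {subset l <= A} &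
    exists vals : seq R, [/\ uniq vals,
      m%:R * i0 / (16 * K1) * g%:R <= 3 * (size vals)%:R &
      {in vals, forall x,
        `|x - (en (fun v => deg A v / 2) (Y 0%N) + avg (fun=> 0) A)| <= K3 * q%:R ^+ 2 /\
        exists k v1 v2, [/\ (k <= m)%N, v1 \in V, v2 \in V, v1 != v2 &
           x = en (fun=> 0) (v1 :: v2 :: Y k ++ l)]}]].
Proof.
move=> uA AX sA uV VX sV sY hY hinc.
have hD v : 0 <= deg (Y 0%N) v + deg A v / 2 <= 5 * q%:R ^+ 2.
  have h1 := deg_ge0 R e (Y 0%N) v; have h2 := deg_ge0 R e A v.
  have h3 := deg_le R e (Y 0%N) v; have h4 := deg_le R e A v.
  rewrite sA -mul2n natrM in h4.
  have h5 : (size (Y 0%N))%:R <= 4 * q%:R ^+ 2 :> R by rewrite -natrX -natrM ler_nat.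
  by move: uq' => h6; apply/andP; split; lra.
have [I [L [Pi [theta [pA hs hth [sPi uPi hPi] hPiD]]]]] :=
  fine_pairs e_sym eps0 eps1 rho0 rho1 hrich q0 u0 rhou uq hbig k_lo k_hi sq hq uA AX sA uV VX sV hD gle.
have hPiD' : {in Pi, forall pi, theta <= deg (Y 0%N) pi.1 + deg A pi.1 / 2 +
   (deg (Y 0%N) pi.2 + deg A pi.2 / 2) <= theta + q%:R}.
  by move=> pi /hPiD[].
have [l sl [vals [h1 h2 h3]]] := many_values e_sym e_irr eps0 eps1 rho0 rho1 q0 uq g0 gq m0 mq hY
   hinc pA sA hs sPi hPi hPiD' mbig hth.
exists l; split.
- by apply: (subseq_uniq (sel_subseq sl)); rewrite -(perm_uniq pA).
- by rewrite (sel_size sl); apply: double_inj; rewrite -size_ends -(perm_size pA) sA.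
- by move=> v /(mem_subseq (sel_subseq sl)); rewrite (perm_mem pA).
exists vals; split => // x /h3[hx [k [pi [hk hpi hE]]]]; split => //.
by have [p1 p2 p3 _] := hPiD pi hpi; exists k, pi.1, pi.2.
Qed.

Variables (Q P A1 A2 V : seq T).
Hypothesis huniq : uniq (Q ++ P ++ A1 ++ A2 ++ V).
Hypothesis hX : {subset Q ++ P ++ A1 ++ A2 ++ V <= X}.
Hypotheses (sQ : size Q = u.*2) (sP : size P = u.*2) (sA1 : size A1 = u.*2)
  (sA2 : size A2 = u.*2) (sV : size V = u.*2).

Variables (t J M : nat).
Hypothesis hJ : J%:R * (2 * K3 + 40) <= c1 * q%:R.
Hypothesis hM : 3 * M%:R <= m%:R * i0 / (16 * K1) * g%:R.
Hypothesis ht : (t <= u.*2)%N.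

(** The first [t] vertices of [P] determine the number of vertices.  For each [j]
    the coarse path in [Q] is stopped when its edge count enters the [j]-th
    window; the climb in [A1] and the choices in [A2] and [V] then give [M]
    values within [O(q ^ 2)] of a known number.  Windows are longer than this
    error, so values for different [j] are different. *)
Lemma many_values_at_level : exists vals : seq R,
  [/\ uniq vals, (J * M <= size vals)%N &
     {in vals, forall x, exists U : seq T,
        [/\ uniq U, size U = (t + 3 * u + 2)%N & x = en (fun=> 0) U]}].
Proof.
have q2 : (0 : R) < q%:R ^+ 2 by rewrite exprn_gt0.
have [uQ uP uA1 uA2 uV] : [/\ uniq Q, uniq P, uniq A1, uniq A2 & uniq V].
  by move: huniq; rewrite !cat_uniq => /and3P[-> _ /and3P[-> _ /and3P[-> _ /and3P[-> _ ->]]]].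
have QX : {subset Q <= X} by move=> v hv; apply: hX; rewrite !mem_cat hv.
have A1X : {subset A1 <= X} by move=> v hv; apply: hX; rewrite !mem_cat hv !orbT.
have A2X : {subset A2 <= X} by move=> v hv; apply: hX; rewrite !mem_cat hv !orbT.
have VX : {subset V <= X} by move=> v hv; apply: hX; rewrite !mem_cat hv !orbT.
pose Pt := take t P.
have sPt : size Pt = t by rewrite size_takel // sP.
have PtP : {subset Pt <= P} by move=> v /mem_take.
have uPt : uniq Pt by apply: take_uniq.
have dle (l : seq T) n v : (size l <= n)%N -> 0 <= deg l v <= n%:R.
  by move=> h; rewrite deg_ge0 /=; apply: le_trans (deg_le _ _ _ _) _; rewrite ler_nat.
have u2 : (u.*2)%:R = 2 * u%:R :> R by rewrite -mul2n natrM.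
have dP v : 0 <= deg Pt v <= 2 * u%:R by rewrite -u2; apply: dle; rewrite sPt.
have d1 v : 0 <= deg A1 v <= 2 * u%:R by rewrite -u2; apply: dle; rewrite sA1.
have d2 v : 0 <= deg A2 v <= 2 * u%:R by rewrite -u2; apply: dle; rewrite sA2.
pose om v := deg A2 v / 2 + deg A1 v / 2 + deg Pt v.
have hom v : 0 <= om v <= 4 * q%:R ^+ 2.
  move: (dP v) (d1 v) (d2 v) uq'; rewrite /om => /andP[? ?] /andP[? ?] /andP[? ?] ?.
  by apply/andP; split; lra.
have lamq8 : 8 <= lam * q%:R by move: lamq; lra.
have [m1 [Z [hZ hstep htot]]] :=
  coarse_path e_sym e_irr eps0 eps1 rho0 rho1 hrich q0 u0 rhou uq hbig k_lo k_hi lamq8 uQ QX sQ hom.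
(* Up to [O(q ^ 2)], the edge count to expect in the end is [B0] plus the value
   of [en om] where the coarse path is stopped. *)
pose B0 := en (fun v => deg A2 v / 2 + deg A1 v / 2) Pt + (\sum_(v <- A1) deg A2 v / 2) / 2
  + (\sum_(v <- A1) deg A1 v) / 8 + avg (fun=> 0) A2.
pose y (j : nat) := en om (Z 0%N) + j%:R * ((2 * K3 + 40) * q%:R ^+ 2).
pose Key (j : nat) (x : R) :=
  - (K3 + 16) * q%:R ^+ 2 <= x - B0 - y j <= (K3 + 22) * q%:R ^+ 2 /\
  exists U : seq T, [/\ uniq U, size U = (t + 3 * u + 2)%N & x = en (fun=> 0) U].
have keydisj j j' x : Key j x -> Key j' x -> j = j'.
  suff key i i' : (i < i')%N -> Key i x -> Key i' x -> False.
    by move=> h h'; case: (ltngtP j j') => // hj; [case: (key j j')|case: (key j' j)].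
  move=> hii [/andP[_ h1] _] [/andP[h2 _] _].
  have h3 : (i%:R + 1) * ((2 * K3 + 40) * q%:R ^+ 2) <= i'%:R * ((2 * K3 + 40) * q%:R ^+ 2).
    rewrite ler_wpM2r ?natr1 ?ler_nat // mulr_ge0 ?(ltW q2) //; move: K30; lra.
  have K3q : 0 < K3 * q%:R ^+ 2 by apply: mulr_gt0.
  move: h1 h2 h3 K3q q2; rewrite /y; lra.
have [j hj|vals [h1 h2 h3]] := @keyed_union _ J M Key keydisj; last first.
  by exists vals; split => // x /h3[j _ []].
have [k hk /andP[hk1 hk2]] : exists2 k, (k <= m1)%N & y j <= en om (Z k) <= y j + 6 * q%:R ^+ 2.
  apply: (@discrete_ivt R (fun k => en om (Z k))) => //; first by rewrite mulr_ge0 // ltW.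
  apply/andP; split.
    rewrite /y lerDl mulr_ge0 // mulr_ge0 ?(ltW q2) //; move: K30; lra.
  have : j%:R * ((2 * K3 + 40) * q%:R ^+ 2) <= c1 * q%:R ^+ 3.
    have -> : c1 * q%:R ^+ 3 = c1 * q%:R * q%:R ^+ 2 by ring.
    rewrite mulrA ler_pM2r //; apply: le_trans hJ; rewrite ler_wpM2r ?ler_nat 1?ltnW //.
    by move: K30; lra.
  by move: htot; rewrite /y -/lam -/c1; lra.
have [uZ sZ ZQ] := hZ k.
pose Y0 := Pt ++ Z k.
have sY0 : size Y0 = (t + u)%N by rewrite size_cat sPt sZ.
pose w1 v := deg A2 v / 2 + deg Y0 v.
have hw1 v : 0 <= w1 v <= 4 * q%:R ^+ 2.
  have : 0 <= deg Y0 v <= (u.*2 + u)%:R by apply: dle; rewrite sY0 leq_add2r.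
  rewrite natrD u2; move: (d2 v) uq'; rewrite /w1 => /andP[? ?] ? /andP[? ?].
  by apply/andP; split; lra.
have [S [hS hSp hSi hSa]] := local_climb e_sym e_irr eps0 eps1 rho0 rho1 hrich q0 u0 rhou uq hbig
  k_lo k_hi lamq uA1 A1X sA1 hw1 m0 mk mlam.
pose Y i := Y0 ++ S i.
have enY i : en (fun v => deg A2 v / 2) (Y i) = en (fun v => deg A2 v / 2) Y0 + en w1 (S i).
  by rewrite /Y en_cat.
have hYp i : (i < m)%N -> exists x z, perm_eq (x :: Y i.+1) (z :: Y i).
  move=> /hSp[x [z hp]]; exists x, z; rewrite /Y.
  apply/permP => p; rewrite /= !count_cat; have /permP /(_ p) /= := hp.
  by move: (count p Y0) (count p (S i.+1)) (count p (S i)) => a b c; clear; lia.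
have hYi i : (i < m)%N -> i0 * q%:R <=
   en (fun v => deg A2 v / 2) (Y i.+1) - en (fun v => deg A2 v / 2) (Y i) <= 6 * q%:R.
  move=> hi; rewrite !enY opprD addrACA subrr add0r; exact: hSi.
have sY : (size (Y 0%N) <= 4 * q ^ 2)%N.
  have [_ s0 _] := hS 0%N (leq0n m).
  rewrite /Y size_cat sY0 s0; apply: leq_trans (_ : 4 * u <= _)%N; last by rewrite leq_mul2l.
  by move: ht; clear; lia.
have [l [ul sl lA [vals [v1 v2 v3]]]] := fine_values uA2 A2X sA2 uV VX sV sY hYp hYi.
exists vals; split => //.
  rewrite -(ler_nat R) -(ler_pM2l (_ : (0 : R) < 3)) //; exact: le_trans hM v2.
move=> x /v3[hx [i [a [b [hi aV bV ab xE]]]]]; split; last first.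
  exists (a :: b :: Y i ++ l); split => //; last first.
    by have [_ si _] := hS i hi; rewrite /= !size_cat sPt sZ si sl; clear; lia.
  have [uSi _ SiA] := hS i hi.
  have sub : {subset Y i ++ l <= Q ++ P ++ A1 ++ A2}.
    move=> v; rewrite !mem_cat => /orP[/orP[/orP[/PtP ->|/ZQ ->]|/SiA ->]|/lA ->]; by rewrite ?orbT.
  have /and3P[huniq4 hVd _] : [&& uniq (Q ++ P ++ A1 ++ A2), ~~ has (mem (Q ++ P ++ A1 ++ A2)) V & uniq V].
    by rewrite -cat_uniq -!catA.
  have nV v : v \in V -> v \notin Y i ++ l.
    by move=> hv; apply/negP => /sub hv'; move/hasPn: hVd => /(_ v hv); rewrite /= hv'.
  have nVa : a \notin Y i ++ l by apply: nV.
  have nVb : b \notin Y i ++ l by apply: nV.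
  rewrite cons_uniq cons_uniq in_cons negb_or ab nVa nVb /=.
  have uPQ : uniq ((P ++ Q) ++ (A1 ++ A2)).
    by rewrite -catA uniq_catCA.
  have uPQ1 : uniq (P ++ Q) by move: uPQ; rewrite cat_uniq => /and3P[].
  have uA12 : uniq (A1 ++ A2) by move: uPQ; rewrite cat_uniq => /and3P[].
  rewrite /Y -catA; apply: (uniq_cat_sub uPQ).
  - exact: uniq_cat_sub uPQ1 uPt uZ PtP ZQ.
  - exact: uniq_cat_sub uA12 uSi ul SiA lA.
  - by move=> v; rewrite !mem_cat => /orP[/PtP ->|/ZQ ->]; rewrite ?orbT.
  - by move=> v; rewrite !mem_cat => /orP[/SiA ->|/lA ->]; rewrite ?orbT.
have hE : en (fun v => deg A2 v / 2) Y0 + avg w1 A1 + avg (fun=> 0) A2 = B0 + en om (Z k).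
  rewrite /Y0 en_cat // /avg /w1 !big_split /= (deg_sumC R e_sym A1 Y0) /Y0 big_cat /=.
  rewrite /B0 /om /avg.
  have -> : en (fun v => deg A2 v / 2 + deg A1 v / 2) Pt =
     en (fun v => deg A2 v / 2) Pt + (\sum_(v <- Pt) deg A1 v) / 2.
    by rewrite en_addw mulr_suml.
  have -> : en (fun v => deg A2 v / 2 + deg A1 v / 2 + deg Pt v) (Z k) =
     en (fun v => deg A2 v / 2 + deg Pt v) (Z k) + (\sum_(v <- Z k) deg A1 v) / 2.
    rewrite mulr_suml -en_addw; apply: eq_en => v; lra.
  lra.
move: hx hSa; rewrite enY !ler_norml => /andP[a1 a2] /andP[a3 a4].
by apply/andP; split; move: hE hk1 hk2; lra.
Qed.
End Level.

(** * Edge counts of lists as points of the set to be counted *)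

Lemma mem_induced_edges (T : finType) (e : rel T) (S : {set T}) (E : {set T}) :
  E \in induced_edges e S -> E \subset S.
Proof.
by case/imset2P => x y xS; rewrite inE => /andP[yS _] ->; rewrite subUset !sub1set xS.
Qed.

Lemma induced_edgesU1 (T : finType) (e : rel T) (S : {set T}) x :
  symmetric e -> irreflexive e -> induced_edges e (x |: S) =
  induced_edges e S :|: [set [set x; y] | y in [set y in S | e x y]].
Proof.
move=> e_sym e_irr; apply/setP => E; rewrite inE; apply/idP/orP.
  case/imset2P => a b /setU1P[->|aS]; rewrite inE => /andP[/setU1P[->|bS] eab] ->.
  - by rewrite e_irr in eab.
  - by right; apply: imset_f; rewrite inE bS.
  - by right; rewrite setUC; apply: imset_f; rewrite inE aS e_sym.
  - by left; apply: imset2_f => //; rewrite inE bS.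
case=> [/imset2P[a b aS]|/imsetP[y]]; rewrite inE => /andP[yS eay] ->.
  by apply: imset2_f; rewrite ?inE ?aS ?yS ?orbT.
by apply: imset2_f; rewrite ?inE ?yS ?eqxx ?orbT.
Qed.

Lemma card_induced_edgesU1 (T : finType) (e : rel T) (S : {set T}) x :
  symmetric e -> irreflexive e -> x \notin S ->
  #|induced_edges e (x |: S)| = (#|induced_edges e S| + #|[set y in S | e x y]|)%N.
Proof.
move=> e_sym e_irr xS; rewrite induced_edgesU1 // cardsU (_ : _ :&: _ = set0).
  rewrite cards0 subn0 card_in_imset // => y z.
  rewrite !inE => /andP[yS _] /andP[zS _] /setP /(_ y).
  rewrite !inE eqxx orbT => /esym /orP[/eqP yx|/eqP //].
  by rewrite yx (negbTE xS) in yS.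
apply/setP => E; rewrite !inE; apply/negP => /andP[/mem_induced_edges ES /imsetP[y _ EE]].
by move/subsetP: ES => /(_ x); rewrite EE !inE eqxx (negbTE xS) => /(_ isT).
Qed.

Lemma en_induced (R : realType) (T : finType) (e : rel T) (l : seq T) :
  symmetric e -> irreflexive e -> uniq l ->
  en e (fun=> 0) l = #|induced_edges e [set x in l]|%:R :> R.
Proof.
move=> e_sym e_irr; elim: l => [|x l IH] /=.
  rewrite /en !big_nil mul0r addr0 (_ : induced_edges _ _ = set0) ?cards0 //.
  by apply/setP => E; rewrite inE; apply/negP => /imset2P[a b]; rewrite inE.
case/andP=> xl ul; rewrite en_cons' // IH // add0r set_cons card_induced_edgesU1 ?inE //.
rewrite natrD addrC deg_count; congr (_ + _%:R).
rewrite -size_filter -(card_uniqP (filter_uniq _ ul)).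
by apply: eq_card => y; rewrite !inE mem_filter andbC.
Qed.

Lemma nat_between (R : realType) (x : R) : 1 <= x ->
  exists n : nat, [/\ (0 < n)%N, x / 2 <= n%:R & n%:R <= x].
Proof.
move=> x1; have /truncn_itv /andP[h1 h2] : 0 <= x by lra.
have n0 : (0 < Num.truncn x)%N by rewrite truncn_gt0.
exists (Num.truncn x); split => //; rewrite -natr1 in h2.
by move: h2; rewrite -(ler_nat R) in n0; lra.
Qed.

Lemma eventually_large (R : realType) (cs : seq R) : all (fun c => 0 < c) cs ->
  exists2 s0 : nat, (0 < s0)%N &
    forall n : nat, (s0 <= n)%N -> all (fun c => 1 <= c * n%:R) cs.
Proof.
elim: cs => [_|c cs IH /= /andP[c0 /IH[s1 s10 h]]]; first by exists 1%N.
have /truncn_itv /andP[_ hc] : 0 <= c^-1 by rewrite invr_ge0 ltW.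
exists (maxn s1 (Num.truncn c^-1).+1) => [|n]; first by rewrite leq_max s10.
rewrite geq_max => /andP[n1 n2]; rewrite (h n n1) andbT.
rewrite -(ler_pM2l (_ : 0 < c^-1)) ?invr_gt0 // mulr1 mulrA mulVf ?mul1r ?gt_eqF //.
by apply: le_trans (ltW hc) _; rewrite ler_nat.
Qed.

Lemma mem_Psi (T : finType) (e : rel T) (S : {set T}) :
  (#|S|, #|induced_edges e S|) \in Psi e.
Proof. by apply/imfsetP; exists S; rewrite ?inE. Qed.

(** Points for different [t] differ in their first coordinate. *)
Lemma card_Psi_ge (R : realType) (T : finType) (e : rel T) (a N M : nat) :
  symmetric e -> irreflexive e ->
  (forall t, (t < N)%N -> exists vals : seq R, [/\ uniq vals, (M <= size vals)%N &
     {in vals, forall x, exists U : seq T,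
        [/\ uniq U, size U = (t + a)%N & x = en e (fun=> 0) U]}]) ->
  (N * M <= #|` Psi e|)%N.
Proof.
move=> e_sym e_irr h.
have [||F [uF sF hF]] := @keyed_union (nat * nat)%type N M
  (fun t p => p.1 = (t + a)%N /\ p \in Psi e).
- by move=> j j' p [-> _] [/eqP + _]; rewrite eqn_add2r => /eqP.
- move=> t /h[vals [uv sv hv]].
  exists [seq ((t + a)%N, Num.truncn x) | x <- vals]; split.
  + rewrite map_inj_in_uniq // => x y /hv[U [uU _ ->]] /hv[V [uV _ ->]].
    by rewrite !en_induced // !natrK => -[->].
  + by rewrite size_map.
  + move=> p /mapP[x /hv[U [uU sU ->]] ->]; split => //.
    rewrite en_induced // natrK -sU -(card_uniqP uU).
    by rewrite -(cardsE (mem U)); apply: mem_Psi.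
by apply: leq_trans sF (uniq_leq_size uF _) => p /hF[t _ []].
Qed.

Lemma split_block (T : Type) (l : seq T) (k r : nat) : (k + r <= size l)%N ->
  exists a b, [/\ l = a ++ b, size a = k & (r <= size b)%N].
Proof.
move=> h; exists (take k l), (drop k l); rewrite cat_take_drop; split => //.
  by rewrite size_takel //; apply: leq_trans h; rewrite leq_addr.
by rewrite size_drop leq_subRL //; apply: leq_trans h; rewrite leq_addr.
Qed.

Lemma five_blocks (T : finType) (X : {set T}) (u : nat) : (10 * u <= #|X|)%N ->
  exists Q P A1 A2 V : seq T, [/\ uniq (Q ++ P ++ A1 ++ A2 ++ V),
    {subset Q ++ P ++ A1 ++ A2 ++ V <= X} &
    [/\ size Q = u.*2, size P = u.*2, size A1 = u.*2, size A2 = u.*2 & size V = u.*2]].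
Proof.
move=> hX; have h5 : (u.*2 + (u.*2 + (u.*2 + (u.*2 + (u.*2 + 0)))) <= size (enum X))%N.
  by rewrite -cardE; apply: leq_trans hX; clear; lia.
have [Q [r1 [e1 sQ h4]]] := split_block h5.
have [P [r2 [e2 sP h3]]] := split_block h4.
have [A1 [r3 [e3 sA1 h2]]] := split_block h3.
have [A2 [r4 [e4 sA2 h1]]] := split_block h2.
have [V [r5 [e5 sV _]]] := split_block h1.
have eX : enum X = (Q ++ P ++ A1 ++ A2 ++ V) ++ r5.
  by rewrite e1 e2 e3 e4 e5 -!catA.
exists Q, P, A1, A2, V; split => //.
  by have := enum_uniq X; rewrite eX cat_uniq => /and3P[].
by move=> v hv; rewrite -mem_enum eX mem_cat hv.
Qed.

(** The numbers [m], [g] and [J] are taken proportional to [q], so that [M] is of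
    order [q ^ 2] and [u.*2 * (J * M)] of order [q ^ 5]. *)
Lemma card_Psi_of_rich (R : realType) (eps rho : R) :
  0 < eps -> eps <= 1 -> 0 < rho -> rho <= 1 ->
  exists2 c : R, 0 < c & exists s0 : nat,
  forall (T : finType) (e : rel T) (s q u : nat) (X : {set T}),
  symmetric e -> irreflexive e -> rich e eps s u X -> (10 * u <= #|X|)%N ->
  rho * q%:R ^+ 2 <= u%:R -> (u <= q ^ 2)%N -> (s * s <= q)%N -> (s0 <= s)%N ->
  c * q%:R ^+ 5 <= (#|` Psi e|)%:R.
Proof.
move=> eps0 eps1 rho0 rho1.
pose lam : R := eps ^+ 2 * rho / 32.
pose i0 : R := lam / 32.
pose K1 : R := 296 / i0.
pose kap0 : R := lam * i0 ^+ 2 / (48 * 296).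
pose K2 : R := 280 * K1 / i0.
pose K3 : R := K1 + K2 + 24.
pose c1 : R := eps * rho * lam / 1024.
have eps20 : 0 < eps ^+ 2 by rewrite exprn_gt0.
have rho20 : 0 < rho ^+ 2 by rewrite exprn_gt0.
have er0 : 0 < eps * rho by rewrite mulr_gt0.
have lam0 : 0 < lam by rewrite divr_gt0 // mulr_gt0.
have i00 : 0 < i0 by rewrite divr_gt0.
have K10 : 0 < K1 by rewrite divr_gt0.
have kap00 : 0 < kap0 by apply: divr_gt0 => //; apply: mulr_gt0 => //; exact: exprn_gt0.
have K20 : 0 < K2 by apply: divr_gt0 => //; apply: mulr_gt0.
have K30 : 0 < 2 * K3 + 40 by rewrite /K3; lra.
have c10 : 0 < c1 by apply: divr_gt0 => //; exact: mulr_gt0.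
pose a4 := lam * i0 / (256 * 48 * K1).
have a40 : 0 < a4.
  by apply: divr_gt0; [exact: mulr_gt0|apply: mulr_gt0 => //; exact: mulr_gt0].
pose a6 := c1 / (2 * K3 + 40).
have a60 : 0 < a6 by exact: divr_gt0.
(* In turn: the exceptional vertices are few compared with [u]; the pairs of [V]
   are many compared with their conflicts; [m], [M], [g] and [J] are positive. *)
have [|s0 s00 large] := @eventually_large R
  [:: eps * rho / 144; eps ^+ 2 * rho ^+ 2 / 200; lam / 128; a4; kap0 / 2; a6].
  by apply/and5P; split; rewrite ?a40 ?a60 ?andbT //; apply: divr_gt0 => //; exact: mulr_gt0.
exists (rho * a6 * (lam / 256 * i0 * kap0 / (4 * 96 * K1))).
  apply: mulr_gt0; first exact: mulr_gt0.
  apply: divr_gt0; last by do 2!apply: mulr_gt0 => //.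
  by do 2!apply: mulr_gt0 => //; apply: divr_gt0.
exists s0 => T e s q u X e_sym e_irr hrich hX rhou uq ssq s0s.
have s_gt0 : (0 < s)%N by apply: leq_trans s00 s0s.
have sq : (s <= q)%N by apply: leq_trans ssq; rewrite leq_pmulr.
have q_gt0 : (0 < q)%N by apply: leq_trans sq.
have /= /and5P[b1 _ _ _ _] := large s s0s.
have /= /and5P[_ b2 b3 b4 /and3P[b5 b6 _]] := large q (leq_trans s0s sq).
have q1 : 1 <= q%:R :> R by rewrite ler1n.
have qpos : 0 < q%:R :> R by lra.
have s1 : 1 <= s%:R :> R by rewrite ler1n.
have ssq' : s%:R * s%:R <= q%:R :> R by rewrite -natrM ler_nat.
have u0 : (0 < u)%N.
  rewrite -(ltr_nat R); apply: lt_le_trans rhou; apply: mulr_gt0 rho0 _; exact: exprn_gt0.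
have rq : rho * q%:R <= u%:R.
  by apply: le_trans rhou; rewrite ler_pM2l // expr2 ler_peMr // ltW.
have hbig : ((8 * q).+1 * s.+1)%N%:R <= eps * u%:R / 8.
  apply: (@le_trans _ _ (eps * (rho * q%:R ^+ 2) / 8)); last first.
    by rewrite ler_pM2r ?invr_gt0 // ler_pM2l.
  apply: (@le_trans _ _ (18 * q%:R * s%:R)).
    rewrite natrM; apply: (@le_trans _ _ ((9 * q%:R) * (2 * s%:R))); last by rewrite le_eqVlt; apply/orP; left; apply/eqP; ring.
    by apply: ler_pM => //; rewrite -natr1 ?natrM; clear -q1 s1; lra.
  have -> : eps * (rho * q%:R ^+ 2) / 8 = 18 * q%:R * (eps * rho / 144 * q%:R) by field.
  rewrite ler_pM2l; last by rewrite mulr_gt0.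
  apply: (@le_trans _ _ (eps * rho / 144 * (s%:R * s%:R))).
    by rewrite mulrA ler_peMl //; lra.
  by rewrite ler_pM2l // divr_gt0.
have K1n : K1 != 0 by rewrite gt_eqF.
have i0n : i0 != 0 by rewrite gt_eqF.
have [|kk [_ k_lo' k_hi]] := @nat_between R (eps * u%:R / 16).
  have : 2%:R <= ((8 * q).+1 * s.+1)%N%:R :> R.
    by rewrite ler_nat; apply: (@leq_mul 1 2 _ s.+1) => //; rewrite ltnS.
  by move: hbig; lra.
have k_lo : eps * u%:R / 32 <= kk%:R by move: k_lo'; lra.
have [|m [m0 m_lo m_hi]] := @nat_between R (lam / 128 * q%:R) => //.
have [|g [g0 g_lo g_hi]] := @nat_between R (kap0 / 2 * q%:R) => //.
have [|J [J0 J_lo J_hi]] := @nat_between R (a6 * q%:R) => //.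
have K48 : 0 < 48 * K1 by apply: mulr_gt0.
have m_big : 48 * K1 / i0 <= m%:R.
  have hp : 0 < 48 * K1 / i0 by apply: divr_gt0.
  apply: (@le_trans _ _ (48 * K1 / i0 * (a4 * q%:R))).
    by rewrite ler_peMr // ltW.
  have -> : 48 * K1 / i0 * (a4 * q%:R) = lam / 128 * q%:R / 2 by rewrite /a4; field; rewrite K1n i0n.
  exact: m_lo.
have [|M [M0 M_lo M_hi]] := @nat_between R (m%:R * i0 / (48 * K1) * g%:R).
  have h1 : 1 <= m%:R * i0 / (48 * K1) by rewrite ler_pdivlMr // mul1r -ler_pdivrMr.
  have h2 : 1 <= g%:R :> R by rewrite ler1n.
  by rewrite -[leLHS]mulr1; apply: ler_pM.
have mk : (4 * m <= kk)%N.
  rewrite -(ler_nat R) natrM; apply: le_trans k_lo.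
  have h1 : eps * (eps * (rho * q%:R)) <= eps * u%:R.
    rewrite ler_pM2l //; apply: le_trans rq.
    by rewrite ler_piMl // mulr_ge0 // ltW.
  have h2 : lam / 128 * q%:R = eps * (eps * (rho * q%:R)) / 4096 by rewrite /lam; field.
  rewrite h2 in m_hi; have eu0 : 0 < eps * u%:R by rewrite mulr_gt0 // ltr0n.
  by clear -m_hi h1 eu0; lra.
have [Q [P [A1 [A2 [V [huniq hsub [sQ sP sA1 sA2 sV]]]]]]] := five_blocks hX.
have hPsi : (u.*2 * (J * M) <= #|` Psi e|)%N.
  apply: (@card_Psi_ge R T e (3 * u + 2)) => // t tu.
  have := @many_values_at_level R T e e_sym e_irr eps rho s u q X eps0 eps1 rho0 rho1 hrich
    q_gt0 u0 rhou uq hbig kk k_lo k_hi ssq.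
  move=> /(_ _ _ m g g0 _ m0 mk m_hi _ Q P A1 A2 V huniq hsub sQ sP sA1 sA2 sV t J M).
  rewrite addnA; apply.
  - by clear -b2; lra.
  - by rewrite -/lam; clear -b3; lra.
  - by rewrite natrM -/lam -/i0 -/kap0; clear -g_hi; lra.
  - rewrite -/lam -/i0 -/K1; apply: le_trans m_big; rewrite ler_pM2r ?invr_gt0 // ler_pM2r //; clear -R; lra.
  - rewrite -/lam -/i0 -/K1 -/K2 -/K3 -/c1 -ler_pdivlMr //.
    by apply: le_trans J_hi _; rewrite /a6 mulrAC.
  - rewrite -/lam -/i0 -/K1.
    have -> : m%:R * i0 / (16 * K1) * g%:R = 3 * (m%:R * i0 / (48 * K1) * g%:R) by field.
    by rewrite ler_pM2l.
  - exact: ltnW.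
apply: (@le_trans _ _ (u.*2 * (J * M))%:R); last by rewrite ler_nat.
have lq0 : 0 <= (lam / 256 * q%:R) * i0 / (48 * K1).
  apply: ltW; apply: divr_gt0 => //; apply: mulr_gt0 => //; apply: mulr_gt0 => //.
  exact: divr_gt0.
have gq0 : 0 <= kap0 / 4 * q%:R by apply: ltW; apply: mulr_gt0 => //; exact: divr_gt0.
have aq0 : 0 <= a6 * q%:R / 2 by apply: ltW; apply: divr_gt0 => //; exact: mulr_gt0.
have rq0 : 0 <= rho * q%:R ^+ 2 by apply: ltW; apply: mulr_gt0 => //; exact: exprn_gt0.
have Mge : (lam / 256 * q%:R) * i0 / (48 * K1) * (kap0 / 4 * q%:R) / 2 <= M%:R.
  apply: le_trans M_lo; rewrite ler_pM2r ?invr_gt0 //.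
  apply: ler_pM => //; last by clear -g_lo; lra.
  rewrite ler_pM2r ?invr_gt0 // ler_pM2r //; clear -m_lo; lra.
have -> : rho * a6 * (lam / 256 * i0 * kap0 / (4 * 96 * K1)) * q%:R ^+ 5 =
  2 * (rho * q%:R ^+ 2) * ((a6 * q%:R / 2) * 
   ((lam / 256 * q%:R) * i0 / (48 * K1) * (kap0 / 4 * q%:R) / 2)) by field.
have M0' : 0 <= (lam / 256 * q%:R) * i0 / (48 * K1) * (kap0 / 4 * q%:R) / 2.
  by apply: divr_ge0 => //; exact: mulr_ge0.
rewrite -mul2n !natrM; apply: ler_pM.
- exact: mulr_ge0.
- exact: mulr_ge0.
- by rewrite ler_pM2l.
- exact: ler_pM.
Qed.

(** * From graphs with small homogeneous sets to rich sets *)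
Lemma count_card (T : finType) (p : pred T) (l : seq T) : uniq l ->
  count p l = #|[set y in [set x in l] | p y]|.
Proof.
move=> ul; rewrite -size_filter -(card_uniqP (filter_uniq p ul)).
by apply: eq_card => y; rewrite !inE mem_filter andbC.
Qed.

Lemma rich_of_sets (R : realType) (T : finType) (e : rel T) (eps : R) (s u : nat) (X : {set T}) :
  (forall W : {set T}, W \subset X -> eps ^+ 3 / 256 * u%:R <= #|W|%:R ->
    (#|[set v in X | ((nbrs e v W)%:R < eps * #|W|%:R)%R]| <= s)%N /\
    (#|[set v in X | ((nbrs (fun x y => ~~ e x y) v W)%:R < eps * #|W|%:R)%R]| <= s)%N) ->
  rich e eps s u X.
Proof.
move=> h W A uW uA WX AX hW.
have sW : size W = #|[set x in W]| by rewrite cardsE (card_uniqP uW).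
have [||h1 h2] := h [set x in W]; first by apply/subsetP => v; rewrite inE => /WX.
  by rewrite -sW.
have le_count (p q : pred T) : (forall v, p v -> q v) -> 
    (count p A <= #|[set v in X | q v]|)%N.
  move=> pq; rewrite count_card //; apply/subset_leq_card/subsetP => v.
  by rewrite !inE => /andP[/AX -> /pq].
by split; [apply: leq_trans h1|apply: leq_trans h2]; apply: le_count => v;
  rewrite /nbrs -sW -count_card.
Qed.

Lemma nat_sqrt n : exists q, (q * q <= n < q.+1 * q.+1)%N.
Proof.
elim: n => [|n [q /andP[h1 h2]]]; first by exists 0%N.
have [h|h] := ltnP n.+1 (q.+1 * q.+1); first by exists q; rewrite h (leqW h1).
by exists q.+1; rewrite h; move: h2; clear; lia.
Qed.

Lemma ramsey_bound (R : realType) (C : R) (T : finType) (e : rel T) (K : nat) :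
  0 < C -> C + 1 <= K%:R -> (1 < #|T|)%N -> ramsey C e ->
  exists2 b : nat, (forall S : {set T}, homogeneous e S -> (#|S| < b)%N) &
    (2 ^ b <= #|T| ^ K)%N.
Proof.
move=> C0 CK n2 hR; pose x := C * log2 (#|T|%:R : R).
have n0 : 0 < #|T|%:R :> R by rewrite ltr0n ltnW.
have ln20 : 0 < ln 2 :> R by apply: ln_gt0; rewrite ltr1n.
have lnn : ln 2 <= ln (#|T|%:R : R) by rewrite ler_ln ?posrE // ler_nat.
have x0 : 0 <= x by apply: mulr_ge0; [exact: ltW|apply: divr_ge0; lra].
have /truncn_itv /andP[h1 h2] := x0.
exists (Num.truncn x).+1 => [S hS|].
  rewrite -(ltr_nat R); apply: lt_trans h2; rewrite ltNge; apply/negP => hx.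
  by apply: hR; exists S.
rewrite -(ler_nat R) !natrX -ler_ln ?posrE ?exprn_gt0 // !lnXn //.
rewrite -[ln 2 *+ _]mulr_natl -[leRHS]mulr_natl -natr1.
apply: (@le_trans _ _ ((C + 1) * ln #|T|%:R)); last by rewrite ler_wpM2r //; lra.
have xE : x * ln 2 = C * ln #|T|%:R by rewrite /x /log2 mulrA divfK // gt_eqF.
have : (Num.truncn x)%:R * ln 2 <= x * ln 2 by rewrite ler_pM2r.
by rewrite xE; move: lnn; lra.
Qed.

Lemma powR_le_pow5 (R : realType) (n q : nat) : (n < q.+1 * q.+1)%N -> (0 < q)%N ->
  n%:R `^ (5 / 2) <= 32 * q%:R ^+ 5 :> R.
Proof.
move=> hn q0; have h : n%:R <= (2 * q%:R) `^ 2%:R :> R.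
  rewrite powR_mulrn ?mulr_ge0 // -natrM -natrX ler_nat.
  by apply: leq_trans (ltnW hn) _; rewrite -mulnn; apply: leq_mul; move: q0; clear; lia.
apply: le_trans (ge0_ler_powR _ _ _ h) _; rewrite ?nnegrE ?powR_ge0 ?ler0n ?divr_ge0 //.
rewrite -powRrM (_ : 2%:R * (5 / 2) = 5%:R) ?powR_mulrn ?mulr_ge0 //; last by field.
have -> : (2 * q%:R) ^+ 5 = 32 * q%:R ^+ 5 :> R by ring.
exact: lexx.
Qed.

Theorem theorem1p1 (R : realType) (C : R) (hC : 0 < C) :
  exists gamma : R, 0 < gamma /\
    forall (T : finType) (e : rel T),
      simple_graph e -> ramsey C e ->
      gamma * #|T|%:R `^ (5 / 2) <= #|` Psi e|%fset%:R.
Proof.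
pose K := (Num.truncn C).+2.
have CK : C + 1 <= K%:R.
  have /truncn_itv /andP[_ h] := ltW hC.
  by rewrite /K -natr1; lra.
have [eps /andP[eps0 eps1] hrich] := rich_subset R K.
have eps30 : 0 < eps ^+ 3 by rewrite exprn_gt0.
have eps31 : eps ^+ 3 <= 1 by rewrite exprn_ile1 // ltW.
(* [#|X| <= 20 * u] below, so sets of size [eps ^+ 3 / 256 * u] have proportion
   [del] in [X]. *)
pose del := eps ^+ 3 / (256 * 20).
have [|c c0 [s0 hs0]] := hrich del.
  by apply/andP; split; [apply: divr_gt0 => //; apply: mulr_gt0|rewrite /del; lra].
pose rho := Num.min 1 (c / 20).
have rho0 : 0 < rho by rewrite lt_min ltr01 divr_gt0.
have rho1 : rho <= 1 by rewrite ge_min lexx.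
have rhoc : rho <= c / 20 by rewrite ge_min lexx orbT.
have [c2 c20 [s1 hs1]] := card_Psi_of_rich eps0 eps1 rho0 rho1.
have [|s2 s20 hs2] := @eventually_large R [:: c / 10]; first by rewrite /= andbT divr_gt0.
pose S := maxn (maxn s0 s1) (maxn s2 2).
pose N := ((S * S).+1 * (S * S).+1)%N.
have N0 : 0 < (N%:R : R) `^ (5 / 2) by rewrite powR_gt0 // ltr0n.
exists (Num.min (c2 / 32) (N%:R `^ (5 / 2))^-1).
split; first by rewrite lt_min divr_gt0 // invr_gt0.
move=> T e [e_sym e_irr] hR.
have [q /andP[q1 q2]] := nat_sqrt #|T|.
have [s /andP[ss1 ss2]] := nat_sqrt q.
(* The finitely many small sizes are covered by the constant, since [Psi e]
   contains the point of the empty set. *)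
have [hs|hs] := leqP S s; last first.
  apply: (@le_trans _ _ ((N%:R `^ (5 / 2))^-1 * N%:R `^ (5 / 2))).
    apply: ler_pM; rewrite ?powR_ge0 ?ge_min ?lexx ?orbT //.
      by rewrite le_min divr_ge0 ?invr_ge0 // ltW.
    apply: ge0_ler_powR; rewrite ?nnegrE ?ler0n ?divr_ge0 // ler_nat.
    apply: leq_trans (ltnW q2) _; have : (q.+1 <= (S * S).+1)%N.
      by rewrite ltnS; apply: leq_trans (ltnW ss2) _; apply: leq_mul.
    by move=> h; apply: leq_mul.
  rewrite mulVf ?gt_eqF // ler1n cardfs_gt0.
  by apply/fset0Pn; exists (#|set0 : {set T}|, #|induced_edges e set0|); exact: mem_Psi.
move: hs; rewrite !geq_max => /andP[/andP[ss0 ss1'] /andP[ss2' s_ge2]].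
have /= := hs2 s ss2'; rewrite andbT => hcs.
have sq : (s <= q)%N by apply: leq_trans ss1; rewrite leq_pmulr // ltnW.
have q0 : (0 < q)%N by apply: leq_trans sq; apply: ltnW.
have qn : (q <= #|T|)%N by apply: leq_trans q1; rewrite leq_pmulr.
have n2 : (1 < #|T|)%N by apply: leq_trans qn; apply: leq_trans sq.
have [b hb hb2] := ramsey_bound hC CK n2 hR.
have n8 : (#|T| <= s ^ 8)%N.
  apply: leq_trans (ltnW q2) _; apply: (@leq_trans ((s.+1 * s.+1) * (s.+1 * s.+1))).
    exact: leq_mul.
  have h : (s.+1 <= s * s)%N by move: s_ge2; clear; nia.
  rewrite (_ : s ^ 8 = (s * s * (s * s)) * (s * s * (s * s)))%N; last by ring.
  by do 2!apply: leq_mul => //; apply: leq_mul.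
have sn : (s * s <= #|T|)%N by apply: leq_trans qn.
have [X hX hW] := hs0 T e b s e_sym e_irr hb hb2 n8 sn ss0.
pose u := (#|X| %/ 10)%N.
have u1 : (10 * u <= #|X|)%N by rewrite mulnC leq_divM.
have X10 : (10 <= #|X|)%N.
  rewrite -(ler_nat R); apply: le_trans hX.
  have : c * s%:R <= c * #|T|%:R by rewrite ler_pM2l // ler_nat (leq_trans sq).
  by lra.
have u2 : (#|X| <= 20 * u)%N.
  have h1 := ltn_ceil #|X| (isT : 0 < 10)%N; have h2 : (1 <= u)%N by rewrite divn_gt0.
  by move: h1 h2; rewrite -/u; clear; lia.
have h2 : #|X|%:R <= 20 * u%:R :> R by rewrite -natrM ler_nat.
have hr : rich e eps s u X.
  apply: rich_of_sets => W WX hWu; apply: hW => //; apply: le_trans hWu.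
  have := ler_wpM2l (ltW eps30) h2; rewrite /del; lra.
have hu : rho * q%:R ^+ 2 <= u%:R.
  have h3 : rho * q%:R ^+ 2 <= c / 20 * #|T|%:R.
    by apply: ler_pM; rewrite ?exprn_ge0 // ?(ltW rho0) // -natrX ler_nat -mulnn.
  by move: h3; lra.
have uq : (u <= q ^ 2)%N.
  have h : (#|X| <= #|T|)%N := max_card _.
  rewrite -mulnn; move: u1 h q2 q0; clear; nia.
have := hs1 T e s q u X e_sym e_irr hr u1 hu uq ss1 ss1'.
apply: le_trans.
apply: (@le_trans _ _ (c2 / 32 * #|T|%:R `^ (5 / 2))).
  by rewrite ler_wpM2r ?powR_ge0 // ge_min lexx.
have := ler_wpM2l (_ : 0 <= c2 / 32) (powR_le_pow5 R q2 q0).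
by rewrite divr_ge0 ?(ltW c20) // => /(_ isT) /le_trans; apply; lra.
Qed.
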